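(* Let $\lambda>1$. Then there is $\lambda_0$ with $1<\lambda_0<\lambda$ such that for every $\zeta_0$ with $0<\zeta_0\le\frac{\lambda-\lambda_0}{2(C+C_1+C_2)}$, the pair $(u_{\zeta_0,\lambda_0},d^{\mathrm{ext}}_{\lambda_0})$ is a subsolution for the parameter $\lambda$. Here $C=1+\big(\frac{\lambda_0-1}{K(\lambda_0)}\big)^2$ and $C_1,C_2$ are positive constants, depending only on $\lambda_0$, such that the function $L=L_{\lambda_0}$ satisfies $L\,\Delta L\le C_1+C_2$ in $\mathcal C_{\lambda_0}\cap\Omega$.
   Context: Points of $\mathbb R^2$ are written $(y,z)$; $\Omega=(-1,1)\times(-\infty,0)$. $\mathcal X=\{u\in W^{1,2}(\Omega): u(\pm1,\cdot)=0,\ z\nabla u\in L^1(\Omega,\mathbb R^2)\}$ and $\Lambda=\{q\in L^2_{\mathrm{loc}}(\Omega,\mathbb R^2):|q|\le1\text{ a.e.}\}$. Subsolution for the parameter $\lambda$: a pair $(u,q)$ with $u\in\mathcal X$, $u\ge0$, $q\in\Lambda$, such that $\int_\Omega\nabla u\cdot\nabla\varphi+|z|q\cdot\nabla\varphi\le\lambda\int_\Omega\varphi$ for all $\varphi\in\mathcal X$ with $\varphi\ge0$, and $q\cdot\nabla u=|\nabla u|$ a.e. in $\Omega$. For $\lambda>1$ and $Z\in[\frac1\lambda,\frac1{\lambda-1}]$ set $$f_\lambda(Z)=\frac{1}{(\lambda^2-1)^{3/2}}\Big\{\mathrm{Arcsin}\big[(\lambda^2-1)Z-\lambda\big]-\lambda\sqrt{1-\big((\lambda^2-1)Z-\lambda\big)^2}\Big\}$$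 (strictly increasing), and $$K(\lambda)=\frac{1}{f_\lambda(\frac1\lambda)-f_\lambda(\frac1{\lambda-1})}<0,\qquad \phi_{K(\lambda)}(y)=K(\lambda)\,f_\lambda^{-1}\Big(f_\lambda\big(\tfrac{1}{\lambda-1}\big)+\tfrac{|y|}{K(\lambda)}\Big),\quad y\in[-1,1].$$ The function $\phi_{K(\lambda)}$ is even, negative, continuous on $[-1,1]$ and smooth on $(-1,1)$, with $\phi_{K(\lambda)}'(y)\to\pm\infty$ as $y\to\pm1$. Let $\mathcal C_\lambda=\{(y,z)\in\mathbb R^2: |y|<z\lambda/K(\lambda)\}$. For $(y,z)\in\overline{\mathcal C_\lambda\cap\Omega}\setminus\{(0,0)\}$ let $L=L_\lambda(y,z)\in(0,+\infty)$ be the unique number with $|y|\le L$ and $z=L\,\phi_{K(\lambda)}(y/L)$; $L$ is smooth in $\mathcal C_\lambda\cap\Omega$. Define on $\mathcal C_\lambda\cap\Omega$ $$q_\lambda(y,z)=\frac{(-\phi_{K(\lambda)}'(y/L),\,1)}{\sqrt{1+|\phi_{K(\lambda)}'(y/L)|^2}},\qquad L=L_\lambda(y,z).$$ For $\zeta>0$ define $$u_{\zeta,\lambda}(y,z)=\begin{cases}-\zeta y^2+\zeta&\text{in }\Omega\setminus\mathcal C_\lambda,\\ -\zeta L_\lambda^2(y,z)+\zeta&\text{in }\{(y,z)\in\mathcal C_\lambda\cap\Omega: z\ge\phi_{K(\lambda)}(y)\},\\ 0&\text{in }\{(y,z)\in\Omega: z<\phi_{K(\lambda)}(y)\},\end{cases}\qquad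 d^{\mathrm{ext}}_\lambda(y,z)=\begin{cases}(-\frac{y}{|y|},0)&\text{in }\Omega\setminus\mathcal C_\lambda,\\ q_\lambda(y,z)&\text{in }\mathcal C_\lambda\cap\Omega.\end{cases}$$ *)

(* Defs.v *)
From HB Require Import structures.
From mathcomp Require Import all_boot all_order all_algebra.
From mathcomp Require Import all_classical all_reals all_analysis.

Set Implicit Arguments.
Unset Strict Implicit.
Unset Printing Implicit Defensive.

Import Order.TTheory GRing.Theory Num.Theory.
Import numFieldNormedType.Exports.

Local Open Scope classical_set_scope.
Local Open Scope ring_scope.

Section Plane.
Context {R : realType}.
Implicit Types (p v w : R * R) (f : R * R -> R).

(* The library norm on R * R is the sup norm, hence an explicit Euclidean one. *)
Definition dot v w : R := v.1 * w.1 + v.2 * w.2.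
Definition enorm v : R := Num.sqrt (dot v v).

Definition dy f : R * R -> R := 'D_((1, 0) : R * R) f.
Definition dz f : R * R -> R := 'D_((0, 1) : R * R) f.
Definition laplacian f p : R := dy (dy f) p + dz (dz f) p.

Fixpoint Ck (k : nat) f : Prop :=
  if k is k'.+1 then
    [/\ continuous f,
        forall p, derivable f p ((1, 0) : R * R) /\
                  derivable f p ((0, 1) : R * R),
        Ck k' (dy f) & Ck k' (dz f)]
  else continuous f.

Definition smooth f : Prop := forall k, Ck k f.

Definition supp f : set (R * R) := closure [set p | f p != 0].

Definition leb2 :
    {measure set (measurableTypeR R * measurableTypeR R) -> \bar R} :=
  (@lebesgue_measure R \x @lebesgue_measure R)%E.

Definition Omega : set (R * R) := [set p | -1 < p.1 < 1 /\ p.2 < 0].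

Definition test_function f : Prop :=
  [/\ smooth f, compact (supp f) & supp f `<=` Omega].

End Plane.

(* Elements of L^p and Sobolev spaces are represented by Borel functions on the
   plane; only their values almost everywhere in Omega matter. *)
Section FunctionSpaces.
Context {R : realType}.
Implicit Types (u f : R * R -> R) (g q : R * R -> R * R).

Definition L2 f : Prop :=
  measurable_fun Omega f /\
  (\int[leb2]_(p in Omega) ((f p) ^+ 2)%:E < +oo)%E.

Definition L2loc f : Prop :=
  measurable_fun Omega f /\
  forall A : set (R * R), compact A -> A `<=` Omega ->
    (\int[leb2]_(p in A) ((f p) ^+ 2)%:E < +oo)%E.

Definition weak_gradient u g : Prop :=
  forall psi, test_function psi ->
    (\int[leb2]_(p in Omega) (u p * dy psi p)%:E =
       - \int[leb2]_(p in Omega) ((g p).1 * psi p)%:E)%E /\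
    (\int[leb2]_(p in Omega) (u p * dz psi p)%:E =
       - \int[leb2]_(p in Omega) ((g p).2 * psi p)%:E)%E.

Definition W12 u g : Prop :=
  [/\ L2 u, L2 (fst \o g), L2 (snd \o g) & weak_gradient u g].

(* The trace on {-1, 1} x (-oo, 0) is the continuous extension to W^{1,2} of the
   restriction map on functions that are C^1 up to the boundary: (tm, tp) is the
   trace of u when some v_n in C^1_c(R^2) satisfy v_n -> u in W^{1,2}(Omega),
   v_n(-1, .) -> tm and v_n(1, .) -> tp in L^2((-oo, 0)). *)
Definition lateral_trace u g (tm tp : R -> R) : Prop :=
  [/\ measurable_fun (`]-oo, 0[ : set R) tm,
      measurable_fun (`]-oo, 0[ : set R) tp &
  exists v : nat -> R * R -> R,
    (forall n, Ck 1 (v n) /\ compact (supp (v n))) /\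
    [/\ (\int[leb2]_(p in Omega) ((v n p - u p) ^+ 2)%:E @[n --> \oo] --> 0)%E,
        (\int[leb2]_(p in Omega) ((dy (v n) p - (g p).1) ^+ 2)%:E @[n --> \oo]
           --> 0)%E,
        (\int[leb2]_(p in Omega) ((dz (v n) p - (g p).2) ^+ 2)%:E @[n --> \oo]
           --> 0)%E,
        (\int[lebesgue_measure]_(z in `]-oo, 0%R[)
           ((v n (-1, z) - tm z) ^+ 2)%:E @[n --> \oo] --> 0)%E &
        (\int[lebesgue_measure]_(z in `]-oo, 0%R[)
           ((v n (1, z) - tp z) ^+ 2)%:E @[n --> \oo] --> 0)%E]].

(* [inX u g]: u belongs to the space X, with weak gradient g. *)
Definition inX u g : Prop :=
  [/\ W12 u g, lateral_trace u g (cst 0) (cst 0),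
      leb2.-integrable Omega (fun p => (p.2 * (g p).1)%:E) &
      leb2.-integrable Omega (fun p => (p.2 * (g p).2)%:E)].

Definition inLambda q : Prop :=
  [/\ L2loc (fst \o q), L2loc (snd \o q) &
      {ae leb2, forall p, Omega p -> enorm (q p) <= 1}].

Definition ae_nonneg u : Prop := {ae leb2, forall p, Omega p -> 0 <= u p}.

(* The weak gradient is unique up to null sets, so the existential on gu only
   names it. *)
Definition subsolution (lambda : R) u q : Prop :=
  exists gu : R * R -> R * R,
    [/\ inX u gu, ae_nonneg u, inLambda q,
        forall phi gphi, inX phi gphi -> ae_nonneg phi ->
          (\int[leb2]_(p in Omega)
             (dot (gu p) (gphi p) + `|p.2| * dot (q p) (gphi p))%:E
           <= lambda%:E * \int[leb2]_(p in Omega) (phi p)%:E)%E &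
        {ae leb2, forall p, Omega p -> dot (q p) (gu p) = enorm (gu p)}].

End FunctionSpaces.

Section Candidate.
Context {R : realType}.
Implicit Types (lambda zeta y Z : R) (p : R * R).

Definition f_ lambda Z : R :=
  let w := (lambda ^+ 2 - 1) * Z - lambda in
  ((lambda ^+ 2 - 1) `^ (3 / 2))^-1 *
    (asin w - lambda * Num.sqrt (1 - w ^+ 2)).

Definition finv lambda : R -> R :=
  'pinv_(fun=> 0) `[1 / lambda, 1 / (lambda - 1)] (f_ lambda).

Definition K_ lambda : R :=
  1 / (f_ lambda (1 / lambda) - f_ lambda (1 / (lambda - 1))).

Definition phi_ lambda y : R :=
  K_ lambda * finv lambda (f_ lambda (1 / (lambda - 1)) + `|y| / K_ lambda).

Definition cone lambda : set (R * R) :=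
  [set p | `|p.1| < p.2 * lambda / K_ lambda].

(* The default value 0 is only taken outside the closed cone, or at the origin. *)
Definition L_ lambda p : R :=
  xget 0 [set L | [/\ 0 < L, `|p.1| <= L & p.2 = L * phi_ lambda (p.1 / L)]].

Definition q_ lambda p : R * R :=
  let s := derive1 (phi_ lambda) (p.1 / L_ lambda p) in
  (- s / Num.sqrt (1 + `|s| ^+ 2), 1 / Num.sqrt (1 + `|s| ^+ 2)).

Definition u_ zeta lambda p : R :=
  if p \in cone lambda then
    if phi_ lambda p.1 <= p.2 then - zeta * (L_ lambda p) ^+ 2 + zeta else 0
  else - zeta * p.1 ^+ 2 + zeta.

Definition dext lambda p : R * R :=
  if p \in cone lambda then q_ lambda p else (- (p.1 / `|p.1|), 0).

Definition LLaplacian_bounded lambda (c : R) : Prop :=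
  forall p, (cone lambda `&` Omega) p ->
    L_ lambda p * laplacian (L_ lambda) p <= c.

Definition C_ lambda : R := 1 + ((lambda - 1) / K_ lambda) ^+ 2.

End Candidate.

(* Main.v *)
(* Write l for lambda0. The graph of phi_{K(l)} is the curve
   y = a (t + l sin t), z = - a sqrt(l^2 - 1) (l + cos t), |t| <= acos (- 1 / l), and L and q
   depend on (y, z) only through |z| and the parameter t of the ray through (y, z).
   Extended by |y| outside the cone, L satisfies |grad L|^2 <= C, and L^2 is C^1 with
   bounded second derivatives off the boundary of the cone, where
   Delta(L^2) = 2 (|grad L|^2 + L Delta L) <= 2 (C + C1 + C2). Moreover grad(L^2) is a
   nonpositive multiple of q, and |z| q is continuous with divergence - l in the cone and
   0 outside. As u = zeta (1 - L^2)^+ and the kink of u along L = 1 contributes with the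
   favourable sign, - Delta u - div (|z| q) <= 2 zeta (C + C1 + C2) + l <= lambda weakly.

   For test functions in X, the positive part is replaced by smooth convex functions and
   |z| q is multiplied by cutoffs chi_n (z) with |z chi_n'(z)| <= 2. The fields then vanish
   far down, and the integration by parts is done against the C^1 approximations provided
   by the zero trace, by Fubini and the fundamental theorem of calculus on lines. The
   integrability of z grad phi and dominated convergence remove the cutoff. *)

Require Import Defs.
From HB Require Import structures.
From mathcomp Require Import all_boot all_order all_algebra.
From mathcomp Require Import ring lra.
From mathcomp Require Import all_classical all_reals all_analysis.
From mathcomp Require Import measurable_realfun.
Import Order.TTheory GRing.Theory Num.Theory.
Import numFieldNormedType.Exports.
Local Open Scope classical_set_scope.
Local Open Scope ring_scope.

Set Implicit Arguments.
Unset Strict Implicit.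
Unset Printing Implicit Defensive.

(** * Real functions of one variable *)

Section FTC.
Context {R : realType}.
Notation mu := (@lebesgue_measure R).

(** The substitution [w = cos t] turns the arcsine in [f_] into an affine function of [t]. Up to
    constants and the factor [z], L, its gradient and q are then rational in [t], [cos t] and
    [sin t], and the identities between them are polynomial modulo [sin^2 + cos^2 = 1]. Freezing [t]
    at its extreme values outside the cone reproduces both exterior formulas, [|y|] for L and
    [(- y / |y|, 0)] for q, so that one formula serves on all of Omega. Across the boundary of the
    cone grad L and q match, but their derivatives jump; hence a fundamental theorem of calculus for
    bounded derivatives that may fail to exist at finitely many points of a line. X imposes no
    condition on the top side z = 0, so the vertical component of every field integrated by parts
    has to vanish there: the z-derivative of L^2 does, and [|z| q] does because of its factor. The
    constant C is [1 + nmax^2], where 1 and [nmax] bound the two partial derivatives of L. The room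
    between lambda0 and lambda pays for the diffusion term alone, the transport term costing exactly
    lambda0. *)

Lemma bounded_integrable d (T : measurableType d) (nu : {measure set T -> \bar R})
    (A : set T) (f : T -> R) (M : R) :
  measurable A -> (nu A < +oo)%E -> measurable_fun A f ->
  (forall x, A x -> `|f x| <= M) -> nu.-integrable A (fun x => (f x)%:E).
Proof.
move=> mA fA mf fM; apply: measurable_bounded_integrable => //.
exists M; split; first exact: num_real.
by move=> y My x Ax /=; apply: (le_trans (fM x Ax)); exact: ltW.
Qed.

Definition clamp (a b x : R) : R := Num.max a (Num.min b x).

Lemma clamp_itv (a b x : R) : a <= b -> a <= clamp a b x <= b.
Proof.
by move=> ab; rewrite /clamp le_max lexx /= ge_max ab /= ge_min lexx.
Qed.

Lemma clamp_id (a b x : R) : a <= x <= b -> clamp a b x = x.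
Proof. by move=> /andP[ax xb]; rewrite /clamp min_r// max_r. Qed.

Lemma clamp_le (a b x : R) : a <= b -> x <= a -> clamp a b x = a.
Proof. by move=> ab xa; rewrite /clamp min_r ?max_l//; exact: le_trans ab. Qed.

Lemma clamp_ge (a b x : R) : a <= b -> b <= x -> clamp a b x = b.
Proof. by move=> ab xa; rewrite /clamp min_l ?max_r. Qed.

Lemma continuous_clamp (a b : R) : continuous (clamp a b).
Proof.
move=> x; apply: continuous_max; first exact: cst_continuous.
by apply: continuous_min; [exact: cst_continuous|exact: cvg_id].
Qed.

Lemma clamp_lip (a b x y : R) : a <= b -> `|clamp a b x - clamp a b y| <= `|x - y|.
Proof.
move=> ab; rewrite /clamp.
case: (leP b x) => bx; case: (leP b y) => bye; rewrite ?(max_r ab);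
  try (case: (leP a x) => ax); try (case: (leP a y) => ay);
  rewrite ?subrr ?normr0 ?normr_ge0//;
  rewrite ler_norml; apply/andP; split; case: (ger0P (x - y)) => ?; lra.
Qed.

Lemma is_derive1_eq (f g : R -> R) (x a b : R) :
  is_derive x 1 f a -> f =1 g -> a = b -> is_derive x 1 g b.
Proof. by move=> fa /funext <- <-. Qed.

Lemma is_derive1_near (f g : R -> R) (x a : R) :
  is_derive x 1 f a -> (\near x, f x = g x) -> is_derive x 1 g a.
Proof. by move=> fa fg; apply: near_eq_is_derive fa. Qed.

Lemma is_derive1_cst (k x : R) : is_derive x 1 (fun=> k) (0 : R).
Proof. exact: is_derive_cst. Qed.

Lemma is_derive1_id (x : R) : is_derive x 1 (fun y : R => y) (1 : R).
Proof. exact: is_derive_id. Qed.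

Lemma is_derive1D (f g : R -> R) (x a b : R) :
  is_derive x 1 f a -> is_derive x 1 g b ->
  is_derive x 1 (fun y => f y + g y) (a + b).
Proof. exact: is_deriveD. Qed.

Lemma is_derive1N (f : R -> R) (x a : R) :
  is_derive x 1 f a -> is_derive x 1 (fun y => - f y) (- a).
Proof. exact: is_deriveN. Qed.

Lemma is_derive1B (f g : R -> R) (x a b : R) :
  is_derive x 1 f a -> is_derive x 1 g b ->
  is_derive x 1 (fun y => f y - g y) (a - b).
Proof. by move=> fa gb; apply: is_derive1D => //; exact: is_derive1N. Qed.

Lemma is_derive1M (f g : R -> R) (x a b : R) :
  is_derive x 1 f a -> is_derive x 1 g b ->
  is_derive x 1 (fun y => f y * g y) (a * g x + f x * b).
Proof.
move=> fa gb; apply: (is_derive1_eq (is_deriveM fa gb)) => //.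
by rewrite /GRing.scale /= addrC (mulrC a).
Qed.

Lemma is_derive1Z (k : R) (f : R -> R) (x a : R) :
  is_derive x 1 f a -> is_derive x 1 (fun y => k * f y) (k * a).
Proof. exact: is_deriveZ. Qed.

Lemma is_derive1V (f : R -> R) (x a : R) :
  is_derive x 1 f a -> f x != 0 -> is_derive x 1 (fun y => (f y)^-1) (- a / f x ^+ 2).
Proof.
move=> fa fx0; apply: (is_derive1_eq (is_deriveV fx0 fa)) => //.
by rewrite /GRing.scale /= mulrC mulrN mulNr.
Qed.

Lemma is_derive1_div (f g : R -> R) (x a b : R) :
  is_derive x 1 f a -> is_derive x 1 g b -> g x != 0 ->
  is_derive x 1 (fun y => f y / g y) ((a * g x - f x * b) / g x ^+ 2).
Proof.
move=> fa gb gx0; apply: (is_derive1_eq (is_derive1M fa (is_derive1V gb gx0))) => //.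
by field.
Qed.

Lemma is_derive1_comp' (f g : R -> R) (x a b : R) :
  is_derive x 1 g b -> is_derive (g x) 1 f a ->
  is_derive x 1 (fun y => f (g y)) (a * b).
Proof. by move=> gb fa; exact: is_derive1_comp. Qed.

Lemma is_derive1_continuous (f : R -> R) (x a : R) :
  is_derive x 1 f a -> {for x, continuous f}.
Proof.
by move=> [df _]; apply: differentiable_continuous; apply/derivable1_diffP.
Qed.

Lemma lip_of_derive (a b M : R) (H h : R -> R) : a < b ->
  {within `[a, b], continuous H} ->
  (forall x, a < x < b -> is_derive x 1 H (h x)) ->
  (forall x, a < x < b -> `|h x| <= M) ->
  forall x y, a <= x <= b -> a <= y <= b -> `|H x - H y| <= M * `|x - y|.
Proof.
move=> ab cH dH hM.
have main x y : a <= x -> x < y -> y <= b -> `|H y - H x| <= M * `|y - x|.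
  move=> ax xy yb; have [||c] := @MVT R H h x y xy.
  - move=> z; rewrite in_itv/= => /andP[xz zy]; apply: dH.
    by rewrite (le_lt_trans ax xz) (lt_le_trans zy yb).
  - apply: continuous_subspaceW cH => z /=; rewrite !in_itv/= => /andP[xz zy].
    by rewrite (le_trans ax xz) (le_trans zy yb).
  rewrite in_itv/= => /andP[xc cy] ->; rewrite normrM ler_wpM2r//; apply: hM.
  by rewrite (le_lt_trans ax xc) (lt_le_trans cy yb).
move=> x y /andP[ax xb] /andP[ay yb]; have [xy|yx|->] := ltgtP x y.
- by rewrite distrC (distrC x); exact: main.
- exact: main.
- by rewrite !subrr normr0 mulr0.
Qed.

Lemma cvg_diff_quotient (f : R -> R) (x l : R) : is_derive x 1 f l ->
  (fun n => n.+1%:R * (f (x + n.+1%:R^-1) - f x)) @ \oo --> l.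
Proof.
move=> [df <-].
have -> : (fun n => n.+1%:R * (f (x + n.+1%:R^-1) - f x)) =
  (fun h => h^-1 *: (f (h *: 1 + x) - f x)) \o (fun n => n.+1%:R^-1).
  by apply/funext => n /=; rewrite invrK; congr (_ * (f _ - _)); rewrite /GRing.scale /= mulr1 addrC.
have h0 : (fun n => n.+1%:R^-1 : R) @ \oo --> (0 : R)^'.
  move=> A A0; have {}A0 : nbhs (0 : R) [set y | y != 0 -> A y] by exact: A0.
  have := @cvg_harmonic R _ A0; rewrite /nbhs /=; apply: filterS => n.
  by apply; rewrite gt_eqF// invr_gt0 ltr0n.
exact: cvg_comp h0 df.
Qed.

(* [h] need not be continuous: the integrals of the difference quotients of the Lipschitz
   function [H] are computed explicitly and converge by domination. *)
Lemma FTC_bounded_derive_nokink (a b M : R) (H h : R -> R) : a < b ->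
  continuous H ->
  (forall x, a < x < b -> is_derive x 1 H (h x)) ->
  (forall x, a < x < b -> `|h x| <= M) ->
  measurable_fun `]a, b[ h ->
  (\int[mu]_(x in `]a, b[) (h x)%:E = (H b - H a)%:E)%E.
Proof.
move=> ab cH dH hM mh.
have ab' := ltW ab.
(* Freezing [H] beyond [a] and [b] keeps it [M]-Lipschitz on the whole line, so the difference
   quotients stay bounded even where the increment leaves the interval. *)
pose Hc x := H (clamp a b x).
have cHc : continuous Hc.
  by move=> x; apply: continuous_comp; [exact: continuous_clamp|exact: cH].
have HcE x : a <= x <= b -> Hc x = H x by move=> xab; rewrite /Hc clamp_id.
have lipHc x y : `|Hc x - Hc y| <= M * `|x - y|.
  apply: (@le_trans _ _ (M * `|clamp a b x - clamp a b y|)).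
    apply: (lip_of_derive ab (continuous_subspaceT cH) dH hM);
      exact: clamp_itv.
  rewrite ler_wpM2l ?clamp_lip//.
  have /hM : a < (a + b) / 2 < b by rewrite midf_lt//= midf_lt.
  exact: le_trans.
(* Starting the primitive at [a - 1] makes [a] an interior point, so that [G] is differentiable at
   both ends of the interval. *)
pose G y := (\int[mu]_(t in `[(a - 1)%R, y]) Hc t)%R.
have dG x : a - 1 < x -> is_derive x 1 G (Hc x).
  move=> ax; have x1 : x < x + 1 by rewrite ltrDl.
  have [||dG1 dG2] := @continuous_FTC1_closed R Hc (a - 1) x (x + 1) x1 _ ax.
  - apply: continuous_compact_integrable; first exact: segment_compact.
    exact: continuous_subspaceT.
  - exact: cHc.
  by split => //; rewrite -dG2 derive1E.
pose qn n x := n.+1%:R * (Hc (x + n.+1%:R^-1) - Hc x) : R.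
have shiftE e : 0 <= e ->
    (\int[mu]_(x in `]a, b[) (Hc (x + e))%:E = (G (b + e) - G (a + e))%:E)%E.
  move=> e0; rewrite -(@integral_itv_bndoo _ a b _ true false); last first.
    apply/measurable_EFinP; apply: measurable_funTS.
    apply: continuous_measurable_fun => x.
    apply: continuous_comp; last exact: cHc.
    by apply: continuousD; [exact: cvg_id|exact: cst_continuous].
  have dGe x : a - 1 < x + e -> is_derive x 1 (fun y => G (y + e)) (Hc (x + e)).
    move=> xe; apply: (is_derive1_eq (is_derive1_comp' (is_derive1D (is_derive1_id x) (is_derive1_cst e x))
      (dG _ xe))) => //.
    by rewrite addr0 mulr1.
  rewrite (@continuous_FTC2 R (fun x => Hc (x + e)) (fun x => G (x + e)) a b) ?EFinB//.
  - apply: continuous_subspaceT => x; apply: continuous_comp; last exact: cHc.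
    by apply: continuousD; [exact: cvg_id|exact: cst_continuous].
  - split.
    + by move=> x; rewrite in_itv/= => /andP[ax xb]; have [] := dGe x; first lra.
    + by apply: cvg_at_right_filter; apply: is_derive1_continuous (dGe a _); lra.
    + by apply: cvg_at_left_filter; apply: is_derive1_continuous (dGe b _); lra.
  - move=> x; rewrite in_itv/= => /andP[ax xb].
    by rewrite derive1E; apply: derive_val; apply: dGe; lra.
have intHc e : mu.-integrable `]a, b[ (EFin \o (fun x => Hc (x + e))).
  have : mu.-integrable `[a, b] (EFin \o (fun x => Hc (x + e))).
    apply: continuous_compact_integrable; first exact: segment_compact.
    apply: continuous_subspaceT => x; apply: continuous_comp; last exact: cHc.
    by apply: continuousD; [exact: cvg_id|exact: cst_continuous].
  by apply: integrableS => //; exact: subset_itv_oo_cc.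
(* By translation, the integral of a difference quotient of [Hc] is a difference of two quotients of
   the primitive [G], at [b] and at [a]; their limit needs only the continuity of [Hc]. *)
have intq n : (\int[mu]_(x in `]a, b[) (qn n x)%:E =
    (n.+1%:R * (G (b + n.+1%:R^-1) - G b) - n.+1%:R * (G (a + n.+1%:R^-1) - G a))%:E)%E.
  rewrite /qn; under eq_integral do rewrite EFinM.
  have int0 : mu.-integrable `]a, b[ (EFin \o Hc).
    by have := intHc 0; apply: eq_integrable => // x _ /=; rewrite addr0.
  rewrite integralZl//; last exact: (integrableB _ (intHc _) int0).
  under eq_integral do rewrite EFinB.
  rewrite integralB//; last exact: intHc.
  rewrite shiftE ?invr_ge0//.
  have -> : (\int[mu]_(x in `]a, b[) (Hc x)%:E = (G b - G a)%:E)%E.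
    have := shiftE 0 (lexx 0); rewrite !addr0 => <-.
    by apply: eq_integral => x _; congr (Hc _)%:E; rewrite addr0.
  by rewrite -EFinB -EFinM; congr (_%:E); ring.
have lim1 : (\int[mu]_(x in `]a, b[) (qn n x)%:E)%E @[n --> \oo] --> (H b - H a)%:E.
  under eq_fun do rewrite intq.
  apply: cvg_EFin; first exact: nearW.
  apply: cvgB.
  - rewrite -(HcE b) ?lexx ?ab'//; apply: (@cvg_diff_quotient G b (Hc b)).
    by apply: dG; lra.
  - rewrite -(HcE a) ?lexx ?ab'//; apply: (@cvg_diff_quotient G a (Hc a)).
    by apply: dG; lra.
have lim2 : (\int[mu]_(x in `]a, b[) (qn n x)%:E)%E @[n --> \oo] -->
    (\int[mu]_(x in `]a, b[) (h x)%:E)%E.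
  have [||||||_ _] := @dominated_convergence _ _ R mu `]a, b[ _
    (fun n x => (qn n x)%:E) (fun x => (h x)%:E) (cst M%:E).
  - by [].
  - move=> n; apply/measurable_EFinP; apply: measurable_funTS.
    apply: continuous_measurable_fun => x; apply: cvgM; first exact: cvg_cst.
    apply: cvgB; last exact: cHc.
    apply: continuous_comp; last exact: cHc.
    by apply: continuousD; [exact: cvg_id|exact: cst_continuous].
  - exact/measurable_EFinP.
  - apply: aeW => x /=; rewrite in_itv/= => /andP[ax xb].
    apply: cvg_EFin; first exact: nearW.
    apply: cvg_diff_quotient; have xab : a < x < b by rewrite ax.
    apply: (is_derive1_near (dH x xab)); near=> y; rewrite HcE//.
    by apply/andP; split; apply: ltW; near: y; [exact: lt_nbhsr|exact: lt_nbhsl].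
  - apply: (@bounded_integrable _ _ mu _ (cst M) `|M|) => //=.
    by rewrite lebesgue_measure_itv/= lte_fin ab -EFinB ltry.
  - apply: aeW => x n _ /=; rewrite lee_fin /qn normrM ger0_norm//.
    rewrite mulrC -ler_pdivlMr// (le_trans (lipHc _ _))//.
    by rewrite addrC addKr ger0_norm// invr_ge0.
  - exact.
exact: (cvg_unique _ lim2 lim1).
Unshelve. all: by end_near. Qed.

(** Cutting at each listed point reduces to the case without kinks, since the values of [H] at the
    cuts telescope. The points will be those where a line meets the boundary of the cone. *)
Lemma FTC_bounded_derive (a b M : R) (H h : R -> R) (s : seq R) : a < b ->
  continuous H ->
  (forall x, a < x < b -> x \notin s -> is_derive x 1 H (h x)) ->
  (forall x, a < x < b -> `|h x| <= M) ->
  measurable_fun `]a, b[ h ->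
  (\int[mu]_(x in `]a, b[) (h x)%:E = (H b - H a)%:E)%E.
Proof.
elim: s a b => [|k s IH] a b ab cH dH hM mh.
  by apply: (FTC_bounded_derive_nokink ab cH _ hM mh) => x xab; exact: dH.
have [kab|kab] := boolP (a < k < b); last first.
  apply: IH => // x xab xs; apply: dH => //.
  by rewrite inE negb_or xs andbT; apply: contra kab => /eqP <-.
have /andP[ak kb] := kab.
have sub1 : (`]a, k[ `<=` `]a, b[)%classic by apply: subset_itvl; rewrite bnd_simp ltW.
have sub2 : (`]k, b[ `<=` `]a, b[)%classic by apply: subset_itvr; rewrite bnd_simp ltW.
have <- : ((H k - H a)%:E + (H b - H k)%:E = (H b - H a)%:E)%E.
  by rewrite -EFinD; congr (_%:E); ring.
have <- : (\int[mu]_(x in `]a, k[) (h x)%:E = (H k - H a)%:E)%E.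
  apply: (IH _ _ ak cH).
  - move=> x /andP[ax xk] xs; apply: dH; first by rewrite ax (lt_trans xk kb).
    by rewrite inE negb_or xs andbT lt_eqF.
  - by move=> x /andP[ax xk]; apply: hM; rewrite ax (lt_trans xk kb).
  - exact: measurable_funS mh.
have <- : (\int[mu]_(x in `]k, b[) (h x)%:E = (H b - H k)%:E)%E.
  apply: (IH _ _ kb cH).
  - move=> x /andP[ax xk] xs; apply: dH; first by rewrite xk (lt_trans ak ax).
    by rewrite inE negb_or xs andbT gt_eqF.
  - by move=> x /andP[ax xk]; apply: hM; rewrite xk (lt_trans ak ax).
  - exact: measurable_funS mh.
rewrite (@integral_itv_obnd_cbnd _ k); last first.
  by apply/measurable_EFinP; exact: measurable_funS mh.
have -> : (`]a, b[ = `]a, k[ `|` `[k, b[)%classic.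
  by rewrite -itv_bndbnd_setU// bnd_simp ltW.
rewrite integral_setU//=.
- apply/measurable_EFinP; rewrite -itv_bndbnd_setU// ?bnd_simp ?ltW//.
- apply/disj_set2P; rewrite -subset0 => x /=; rewrite !in_itv/= => -[/andP[_ xk] /andP[kx _]].
  by move: (lt_le_trans xk kx); rewrite ltxx.
Qed.

End FTC.

(** * Measurability and slices in the plane *)

Section Plane2.
Context {R : realType}.
Notation mu := (@lebesgue_measure R).
Implicit Types (p : R * R) (A : set (R * R)).

(** Measurability in the plane refers to the product sigma-algebra, which is generated by
    rectangles; a countable base of boxes brings the open sets into it. *)
Let rat_box (i : rat * rat * nat) : set (R * R) :=
  ball (ratr i.1.1 : R) i.2.+1%:R^-1 `*` ball (ratr i.1.2 : R) i.2.+1%:R^-1.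

Let open_bigcup_rat_box (A : set (R * R)) : open A ->
  A = \bigcup_i (if `[< rat_box i `<=` A >] then rat_box i else set0).
Proof.
move=> oA; rewrite eqEsubset; split; last first.
  by move=> p [i _]; case: asboolP => // + pi; exact.
move=> p Ap; have /nbhs_ballP[e /= e0 eA] : nbhs p A by exact: open_nbhs_nbhs.
(* Radius below [e / 2]: a point of the box is within one radius of the centre, and the centre
   within one radius of [p]. *)
have [n _ /(_ n (leqnn _)) en] := near_infty_natSinv_lt (PosNum (divr_gt0 e0 (ltr0n R 2))).
have n0 : 0 < n.+1%:R^-1 :> R by rewrite invr_gt0.
have ratx (x d : R) : 0 < d -> exists q, x - d < ratr q < x + d.
  move=> d0; have /rat_in_itvoo[q] : x - d < x + d by lra.
  by rewrite in_itv/=; exists q.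
have [q1 q1p] := ratx p.1 _ n0; have [q2 q2p] := ratx p.2 _ n0.
have bp : rat_box (q1, q2, n) p.
  move: n0 q1p q2p; rewrite /rat_box /=; move: (n.+1%:R^-1) => d ? /andP[? ?] /andP[? ?].
  split; rewrite /ball/= ltr_norml; apply/andP; split; lra.
exists (q1, q2, n) => //; case: asboolP => // -[] p' [/= b1 b2]; apply: eA.
move: bp b1 b2 en => [/=]; move: (n.+1%:R^-1) => d.
rewrite /ball/= !ltr_norml => /andP[? ?] /andP[? ?] /andP[? ?] /andP[? ?] ?.
by split; rewrite /ball/= ltr_norml; apply/andP; split; lra.
Qed.

Lemma open_measurable_plane (A : set (measurableTypeR R * measurableTypeR R)) :
  open (A : set (R * R)) -> measurable A.
Proof.
move=> /open_bigcup_rat_box ->.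
apply: countable_bigcupT_measurable; first exact: countableP.
move=> i; case: asboolP => // _.
by apply: measurableX; apply: open_measurable; exact: ball_open.
Qed.

Lemma continuous_measurable_plane (f : R * R -> R)
    (U : set (measurableTypeR R * measurableTypeR R)) :
  open (U : set (R * R)) -> (forall p, U p -> {for p, continuous f}) ->
  measurable_fun U (f : measurableTypeR R * measurableTypeR R -> R).
Proof.
move=> oU cf; apply: (measurability _ (RGenOpens.measurableE R)).
move=> _ [B [a [b ->] <-]]; apply: open_measurable_plane.
rewrite openE => p [Up fp]; apply: filterI; first exact: open_nbhs_nbhs.
apply: (cf p Up); apply: open_nbhs_nbhs; split => //.
Qed.

Lemma closed_measurable_plane (A : set (measurableTypeR R * measurableTypeR R)) :
  closed (A : set (R * R)) -> measurable A.
Proof.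
move=> cA; rewrite -[A]setCK; apply: measurableC; apply: open_measurable_plane.
exact: closed_openC.
Qed.

Lemma OmegaE : Omega = (`]-1, 1[ : set R) `*` (`]-oo, 0[ : set R).
Proof.
by apply/seteqP; split => p /=; rewrite /Omega/= !in_itv/= => -[].
Qed.

Lemma measurable_Omega : measurable (Omega : set (measurableTypeR R * measurableTypeR R)).
Proof. by rewrite OmegaE; apply: measurableX; exact: measurable_itv. Qed.

Lemma open_setX (B C : set R) : open B -> open C -> open (B `*` C).
Proof.
rewrite !openE => oB oC p [pB pC]; exists (B, C) => //=.
by split; [exact: oB|exact: oC].
Qed.

Lemma open_Omega : open (Omega : set (R * R)).
Proof. by rewrite OmegaE; apply: open_setX; exact: interval_open. Qed.

Let Omega_patch (g : R * R -> \bar R) y z :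
  (g \_ Omega) (y, z) =
  ((fun z => ((fun y => g (y, z)) \_ `]-1, 1[) y) \_ `]-oo, 0[) z.
Proof.
rewrite /patch OmegaE; case: ifPn => [|/negP yz].
  by rewrite inE => -[/= y1 z0]; rewrite !mem_set.
case: ifPn => // /set_mem z0; case: ifPn => // /set_mem y1.
by exfalso; apply: yz; rewrite inE.
Qed.

Lemma integral_Omega21 (g : R * R -> \bar R) : leb2.-integrable Omega g ->
  (\int[leb2]_(p in Omega) g p =
   \int[mu]_(z in `]-oo, 0%R[) \int[mu]_(y in `](-1)%R, 1%R[) g (y, z))%E.
Proof.
move=> ig; rewrite integral_mkcond.
have ig' : leb2.-integrable setT (g \_ Omega).
  exact: ((integrable_mkcond _ measurable_Omega).1 ig).
rewrite /leb2 -integral21_prod_meas1//; rewrite /fubini_G [RHS]integral_mkcond.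
apply: eq_integral => z _; rewrite [in RHS]/patch.
under eq_integral do rewrite Omega_patch /patch.
case: ifP => _; last by rewrite integral0.
by rewrite [RHS]integral_mkcond.
Qed.

Lemma integral_Omega12 (g : R * R -> \bar R) : leb2.-integrable Omega g ->
  (\int[leb2]_(p in Omega) g p =
   \int[mu]_(y in `](-1)%R, 1%R[) \int[mu]_(z in `]-oo, 0%R[) g (y, z))%E.
Proof.
move=> ig; rewrite integral_mkcond.
have ig' : leb2.-integrable setT (g \_ Omega).
  exact: ((integrable_mkcond _ measurable_Omega).1 ig).
rewrite /leb2 -integral12_prod_meas1//; rewrite /fubini_F [RHS]integral_mkcond.
apply: eq_integral => y _; rewrite [in RHS]/patch.
case: ifPn => y1.
  rewrite [RHS]integral_mkcond; apply: eq_integral => z _.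
  by rewrite Omega_patch /patch y1.
under eq_integral do rewrite Omega_patch /patch (negbTE y1) if_same.
by rewrite integral0.
Qed.

Lemma measurable_Omega_slice_y (g : R * R -> R) (z : R) : z < 0 ->
  measurable_fun (Omega : set (measurableTypeR R * measurableTypeR R)) g ->
  measurable_fun (`]-1, 1[ : set R) (fun y => g (y, z)).
Proof.
move=> z0 mg; apply: (measurable_comp measurable_Omega _ mg).
  by move=> _ [y + <-] /=; rewrite ?in_itv/= /Omega /= => ?; split.
by apply: measurable_funTS; exact: pair2_measurable.
Qed.

Lemma measurable_Omega_slice_z (g : R * R -> R) (y : R) : -1 < y < 1 ->
  measurable_fun (Omega : set (measurableTypeR R * measurableTypeR R)) g ->
  measurable_fun (`]-oo, 0[ : set R) (fun z => g (y, z)).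
Proof.
move=> y1 mg; apply: (measurable_comp measurable_Omega _ mg).
  by move=> _ [z + <-] /=; rewrite ?in_itv/= /Omega /= => ?; split.
by apply: measurable_funTS; exact: pair1_measurable.
Qed.

Lemma leb2_box (a b c d : R) : a <= b -> c <= d ->
  leb2 (`[a, b] `*` `[c, d]) = ((b - a) * (d - c))%:E.
Proof.
move=> ab cd.
have -> : leb2 (`[a, b] `*` `[c, d]) = (mu `[a, b]%classic * mu `[c, d]%classic)%E.
  by apply: product_measure1E; exact: measurable_itv.
rewrite !lebesgue_measure_itv/= !lte_fin.
case: ltP => [_|ba]; last first.
  have -> : b = a by apply/eqP; rewrite eq_le ab ba.
  by rewrite subrr mul0r mul0e.
case: ltP => [_|dc]; last first.
  have -> : d = c by apply/eqP; rewrite eq_le cd dc.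
  by rewrite subrr mulr0 mule0.
by rewrite EFinM !EFinB.
Qed.

Lemma is_derive_slice_y (f : R * R -> R) y z d :
  is_derive (y, z) ((1, 0) : R * R) f d <-> is_derive y 1 (fun t => f (t, z)) d.
Proof.
have E : (fun h : R => h^-1 *: (f (h *: ((1, 0) : R * R) + (y, z)) - f (y, z))) =
    (fun h => h^-1 *: (f (h *: 1 + y, z) - f (y, z))).
  apply/funext => h; congr (_ *: (f _ - _)).
  by apply/eqP; rewrite xpair_eqE /=; rewrite scaler0 add0r !eqxx.
split=> -[d1 d2]; split.
- by rewrite /derivable -E.
- by rewrite -d2 /derive -E.
- by rewrite /derivable E.
- by rewrite -d2 /derive E.
Qed.

Lemma is_derive_slice_z (f : R * R -> R) y z d :
  is_derive (y, z) ((0, 1) : R * R) f d <-> is_derive z 1 (fun t => f (y, t)) d.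
Proof.
have E : (fun h : R => h^-1 *: (f (h *: ((0, 1) : R * R) + (y, z)) - f (y, z))) =
    (fun h => h^-1 *: (f (y, h *: 1 + z) - f (y, z))).
  apply/funext => h; congr (_ *: (f _ - _)).
  by apply/eqP; rewrite xpair_eqE /=; rewrite scaler0 add0r !eqxx.
split=> -[d1 d2]; split.
- by rewrite /derivable -E.
- by rewrite -d2 /derive -E.
- by rewrite /derivable E.
- by rewrite -d2 /derive E.
Qed.

Lemma continuous_slice_y (f : R * R -> R) z : continuous f ->
  continuous (fun y => f (y, z)).
Proof.
move=> cf y; apply: (@continuous_comp _ _ _ (fun t => (t, z)) f y); last exact: cf.
exact: (cvg_pair (@cvg_id _ (nbhs y)) (cvg_cst z)).
Qed.

Lemma continuous_slice_z (f : R * R -> R) y : continuous f ->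
  continuous (fun z => f (y, z)).
Proof.
move=> cf z; apply: (@continuous_comp _ _ _ (fun t => (y, t)) f z); last exact: cf.
exact: (cvg_pair (cvg_cst y) (@cvg_id _ (nbhs z))).
Qed.

Lemma Ck1P (v : R * R -> R) : Ck 1 v ->
  [/\ continuous v, continuous (dy v), continuous (dz v),
     forall y z : R, is_derive y 1 (fun t => v (t, z)) (dy v (y, z)) &
     forall y z : R, is_derive z 1 (fun t => v (y, t)) (dz v (y, z))].
Proof.
move=> [cv dv cy cz]; split => // y z.
- by apply/is_derive_slice_y; split; [exact: (dv _).1|].
- by apply/is_derive_slice_z; split; [exact: (dv _).2|].
Qed.

Lemma compact_box (a b c d : R) : compact (`[a, b] `*` `[c, d] : set (R * R)).
Proof. by apply: compact_setX; exact: segment_compact. Qed.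

Lemma bounded_on_box (f : R * R -> R) (a b c d : R) : continuous f ->
  exists2 M, 0 <= M & forall p, a <= p.1 <= b -> c <= p.2 <= d -> `|f p| <= M.
Proof.
move=> cf; have := @compact_box a b c d.
move=> /(continuous_compact (continuous_subspaceT cf)) /compact_bounded[M [_ hM]].
exists (`|M| + 1) => [|p p1 p2]; first by rewrite addr_ge0.
apply: (hM (`|M| + 1)); first by rewrite (le_lt_trans (ler_norm M))// ltrDl.
by exists p => //; split; rewrite /= in_itv.
Qed.

End Plane2.

(** * Integration by parts *)

Section L2.
Context d (T : measurableType d) {R : realType} (nu : {measure set T -> \bar R}).
Variable D : set T.
Hypothesis mD : measurable D.
Implicit Types f g W : T -> R.

Definition square_integrable f := measurable_fun D f /\
  (\int[nu]_(x in D) ((f x) ^+ 2)%:E < +oo)%E.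

Lemma cvg0_near_lt (u : nat -> \bar R) (e : R) : 0 < e ->
  u @ \oo --> 0%E -> \forall n \near \oo, (u n < e%:E)%E.
Proof.
move=> e0 /fine_cvgP[ufin /cvgrPdist_lt/(_ _ e0) ue].
near=> n; have un : u n \is a fin_num by near: n.
rewrite -(fineK un) lte_fin.
have : `|0 - fine (u n)| < e by near: n.
by rewrite sub0r normrN; apply: le_lt_trans; exact: ler_norm.
Unshelve. all: by end_near. Qed.

Lemma measurable_sqr f : measurable_fun D f ->
  measurable_fun D (fun x => ((f x) ^+ 2)%:E).
Proof. by move=> mf; apply/measurable_EFinP; exact: measurable_funX. Qed.

(* By AM-GM, [|W f| <= (dl W^2 + f^2 / dl) / 2] for every [dl > 0]. *)
Lemma L2_weight_near W (f_ : nat -> T -> R) (e : R) : 0 < e ->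
  square_integrable W -> (forall n, measurable_fun D (f_ n)) ->
  (\int[nu]_(x in D) ((f_ n x) ^+ 2)%:E)%E @[n --> \oo] --> 0%E ->
  \forall n \near \oo, (\int[nu]_(x in D) `|(W x * f_ n x)%:E| <= e%:E)%E.
Proof.
move=> e0 [mW W2] mf f0.
set A := (\int[nu]_(x in D) ((W x) ^+ 2)%:E)%E in W2.
have A0 : (0 <= A)%E by apply: integral_ge0 => x _; rewrite lee_fin sqr_ge0.
have Afin : A \is a fin_num by rewrite ge0_fin_numE.
have fA0 : 0 <= fine A by rewrite fine_ge0.
(* With this weight the term in [W] is at most [dl * A / 2 <= e / 2], and the other one is below
   [e / 2] once the integral of [f_n^2] drops below [dl * e]. The [+ 1] covers [A = 0]. *)
pose dl := e / (fine A + 1).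
have dl0 : 0 < dl by rewrite divr_gt0// ltr_wpDl.
have := cvg0_near_lt (mulr_gt0 dl0 e0) f0; apply: filterS => n fn.
have pw x : `|W x * f_ n x| <= dl / 2 * (W x) ^+ 2 + (2 * dl)^-1 * (f_ n x) ^+ 2.
  rewrite normrM -[W x ^+ 2]real_normK ?num_real// -[f_ n x ^+ 2]real_normK ?num_real//.
  move: `|W x| `|f_ n x| => w z; rewrite -subr_ge0.
  have -> : dl / 2 * w ^+ 2 + (2 * dl)^-1 * z ^+ 2 - w * z =
    (dl * w - z) ^+ 2 / (2 * dl) by field; rewrite gt_eqF.
  by rewrite divr_ge0 ?sqr_ge0// mulr_ge0// ltW.
apply: (@le_trans _ _ (\int[nu]_(x in D)
   ((dl / 2)%:E * ((W x) ^+ 2)%:E + (2 * dl)^-1%:E * ((f_ n x) ^+ 2)%:E))%E).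
  apply: ge0_le_integral => //.
  - by apply: measurableT_comp => //; apply/measurable_EFinP; exact: measurable_funM.
  - by apply: emeasurable_funD; apply: measurable_funeM; exact: measurable_sqr.
  - by move=> x Dx; rewrite -!EFinM -EFinD abse_EFin lee_fin pw.
rewrite ge0_integralD//; first last.
- by apply: measurable_funeM; exact: measurable_sqr.
- by move=> x _; rewrite -EFinM lee_fin mulr_ge0 ?sqr_ge0// invr_ge0 mulr_ge0// ltW.
- by apply: measurable_funeM; exact: measurable_sqr.
- by move=> x _; rewrite -EFinM lee_fin mulr_ge0 ?sqr_ge0// divr_ge0// ltW.
rewrite !ge0_integralZl_EFin//; first last.
- by rewrite divr_ge0// ltW.
- exact: measurable_sqr.
- by move=> x _; rewrite lee_fin sqr_ge0.
- by rewrite invr_ge0 mulr_ge0// ltW.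
- exact: measurable_sqr.
- by move=> x _; rewrite lee_fin sqr_ge0.
rewrite -/A -(fineK Afin).
apply: (@le_trans _ _ ((dl / 2 * fine A)%:E + ((2 * dl)^-1 * (dl * e))%:E)%E).
  by rewrite leeD ?lexx// EFinM lee_pmul2l// ?ltW// lte_fin invr_gt0 mulr_gt0.
rewrite -EFinD lee_fin.
have -> : (2 * dl)^-1 * (dl * e) = e / 2 by field; rewrite gt_eqF.
suff : dl * fine A <= e by lra.
by rewrite /dl mulrAC ler_pdivrMr ?ltr_wpDl// ler_pM2l// lerDl.
Qed.

Lemma L2_mul_integrable f g : square_integrable f -> square_integrable g ->
  nu.-integrable D (fun x => (f x * g x)%:E).
Proof.
move=> [mf f2] [mg g2].
have i2 (h : T -> R) : measurable_fun D h -> (\int[nu]_(x in D) ((h x) ^+ 2)%:E < +oo)%E ->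
    nu.-integrable D (fun x => ((h x) ^+ 2)%:E).
  move=> mh h2; apply/integrableP; split; first exact: measurable_sqr.
  by under eq_integral do rewrite gee0_abs ?lee_fin ?sqr_ge0//.
apply: (le_integrable mD _ _ (integrableD mD (i2 _ mf f2) (i2 _ mg g2))).
  by apply/measurable_EFinP; exact: measurable_funM.
move=> x _; rewrite -EFinD !abse_EFin lee_fin [leRHS]ger0_norm ?addr_ge0 ?sqr_ge0//.
rewrite normrM -[f x ^+ 2]real_normK ?num_real// -[g x ^+ 2]real_normK ?num_real//.
have := sqr_ge0 (`|f x| - `|g x|); have := sqr_ge0 (`|f x|); have := sqr_ge0 (`|g x|).
lra.
Qed.

Lemma bounded_support_integrable (A : set T) f (M : R) :
  measurable A -> (nu A < +oo)%E -> measurable_fun D f ->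
  (forall x, D x -> `|f x| <= M) -> (forall x, D x -> ~ A x -> f x = 0) ->
  nu.-integrable D (fun x => (f x)%:E).
Proof.
move=> mA Afin mf fM f0.
have iA : nu.-integrable setT (fun x => (`|M| * \1_A x)%:E).
  under eq_fun do rewrite EFinM; apply: integrableZl => //.
  apply/integrableP; split; first exact/measurable_EFinP/measurable_indicP.
  under eq_integral do rewrite gee0_abs ?lee_fin//.
  by rewrite integral_indic// setIT.
have : nu.-integrable D (fun x => (`|M| * \1_A x)%:E) by exact: integrableS iA.
apply: le_integrable => //; first exact/measurable_EFinP.
move=> x Dx; rewrite !abse_EFin lee_fin [leRHS]ger0_norm ?mulr_ge0//.
have [Ax|nAx] := pselect (A x); last by rewrite f0// normr0 mulr_ge0.
by rewrite indicE mem_set// mulr1 (le_trans (fM x Dx))// ler_norm.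
Qed.

Lemma bounded_support_L2 (A : set T) f (M : R) :
  measurable A -> (nu A < +oo)%E -> measurable_fun D f ->
  (forall x, D x -> `|f x| <= M) -> (forall x, D x -> ~ A x -> f x = 0) ->
  square_integrable f.
Proof.
move=> mA Afin mf fM f0; split => //.
have : nu.-integrable D (fun x => ((f x) ^+ 2)%:E).
  apply: (@bounded_support_integrable A (fun x => (f x) ^+ 2) (M ^+ 2)) => //.
  - exact: measurable_funX.
  - move=> x Dx; rewrite normrX ler_pXn2r// ?nnegrE//; first exact: fM.
    exact: le_trans (fM x Dx).
  - by move=> x Dx nAx; rewrite f0// expr0n.
move=> /integrableP[_]; under eq_integral do rewrite gee0_abs ?lee_fin ?sqr_ge0//.
by [].
Qed.

End L2.

(** * Integration by parts against C^1 functions *)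

Section IBP.
Context {R : realType}.
Notation mu := (@lebesgue_measure R).
Notation pl := (measurableTypeR R * measurableTypeR R)%type.
Implicit Types F d v : R * R -> R.

(** The absolute value keeps the interval nonempty for every real [N], so that the area formula
    applies without a sign condition. *)
Let box (N : R) : set pl := `[-1, 1] `*` `[- `|N|, 0].

Let measurable_box N : measurable (box N).
Proof. by apply: measurableX; exact: measurable_itv. Qed.

Let finite_box N : (leb2 (box N) < +oo)%E.
Proof. by rewrite leb2_box ?ltry// oppr_le0. Qed.

Let Omega_box N (g : R * R -> R) : (forall p, Omega p -> p.2 < - N -> g p = 0) ->
  forall p, Omega p -> ~ box N p -> g p = 0.
Proof.
move=> g0 p Op nb; apply: g0 => //; rewrite ltNge; apply/negP => Np; apply: nb.
move: Op => [/andP[p1 p1'] p2]; split; rewrite /= in_itv/=; first by rewrite !ltW.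
by rewrite (ltW p2) andbT (le_trans _ Np)// lerN2 ler_norm.
Qed.

Lemma box_integrable (g : R * R -> R) (N M : R) :
  measurable_fun (Omega : set pl) g -> (forall p, Omega p -> `|g p| <= M) ->
  (forall p, Omega p -> p.2 < - N -> g p = 0) ->
  leb2.-integrable Omega (fun p => (g p)%:E).
Proof.
move=> mg gM g0.
apply: (@bounded_support_integrable _ _ _ leb2 _ measurable_Omega (box N) g M) => //.
exact: Omega_box.
Qed.

Lemma box_L2 (g : R * R -> R) (N M : R) :
  measurable_fun (Omega : set pl) g -> (forall p, Omega p -> `|g p| <= M) ->
  (forall p, Omega p -> p.2 < - N -> g p = 0) ->
  square_integrable leb2 Omega g.
Proof.
move=> mg gM g0.
apply: (@bounded_support_L2 _ _ _ leb2 _ measurable_Omega (box N) g M) => //.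
exact: Omega_box.
Qed.

Section core.
Variables (F d v : R * R -> R) (N B : R).
Hypothesis N0 : 0 <= N.
Hypothesis cF : continuous F.
Hypothesis md : measurable_fun (Omega : set pl) d.
Hypothesis dB : forall p : R * R, Omega p -> `|d p| <= B.
Hypothesis FN : forall p : R * R, p.2 < - N -> F p = 0.
Hypothesis dN : forall p : R * R, Omega p -> p.2 < - N -> d p = 0.
Hypothesis cv : Ck 1 v.

Lemma measurable_Omega_continuous (f : R * R -> R) : continuous f ->
  measurable_fun (Omega : set pl) f.
Proof.
by move=> cf; apply: continuous_measurable_plane; [exact: open_Omega|move=> p _; exact: cf].
Qed.

Let ibp_bound (w : R * R -> R) : continuous w ->
  exists M, forall p, Omega p -> `|F p * w p + d p * v p| <= M.
Proof.
move=> cw; have [cv0 _ _ _ _] := Ck1P cv.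
have [M1 M10 hM1] := bounded_on_box (-1) 1 (- N) 0 cF.
have [M2 M20 hM2] := bounded_on_box (-1) 1 (- N) 0 cw.
have [M3 M30 hM3] := bounded_on_box (-1) 1 (- N) 0 cv0.
exists (M1 * M2 + `|B| * M3) => p Op.
have [pN|Np] := ltP p.2 (- N).
  by rewrite FN// dN// !mul0r addr0 normr0 addr_ge0// mulr_ge0.
have [/andP[p1 p1'] p2] := Op.
have p1b : -1 <= p.1 <= 1 by rewrite !ltW.
have p2b : - N <= p.2 <= 0 by rewrite Np ltW.
rewrite (le_trans (ler_normD _ _))// !normrM lerD// ler_pM//; [exact: hM1|exact: hM2| |exact: hM3].
by rewrite (le_trans (dB Op))// ler_norm.
Qed.

Let ibp_measurable (w : R * R -> R) : continuous w ->
  measurable_fun (Omega : set pl) (fun p => F p * w p + d p * v p).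
Proof.
move=> cw; have [cv0 _ _ _ _] := Ck1P cv.
apply: measurable_funD; apply: measurable_funM => //; exact: measurable_Omega_continuous.
Qed.

Lemma ibp_integrable (w : R * R -> R) : continuous w ->
  leb2.-integrable Omega (fun p => (F p * w p + d p * v p)%:E).
Proof.
move=> cw; have [M hM] := ibp_bound cw.
apply: (@box_integrable _ N M) => //; first exact: ibp_measurable.
by move=> p Op pN; rewrite FN// dN// !mul0r addr0.
Qed.

(** The exceptional points [s z] may move with the line, as the points of the boundary of the cone
    do; only their finiteness on each line matters. *)
Lemma ibp_y_core (s : R -> seq R) :
  (forall y z : R, z < 0 -> -1 < y < 1 -> y \notin s z ->
     is_derive y 1 (fun t => F (t, z)) (d (y, z))) ->
  (\int[leb2]_(p in Omega) (F p * dy v p + d p * v p)%:E =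
   \int[mu]_(z in `]-oo, 0%R[) (F (1, z) * v (1, z) - F (-1, z) * v (-1, z))%:E)%E.
Proof.
move=> dF; have [cv0 cvy _ dvy _] := Ck1P cv.
rewrite integral_Omega21; last exact: ibp_integrable.
apply: eq_integral => z; rewrite inE/= in_itv/= => z0.
have [M hM] := ibp_bound cvy.
apply: (@FTC_bounded_derive _ (-1) 1 M (fun t => F (t, z) * v (t, z)) _ (s z)).
- by lra.
- by move=> y; apply: cvgM; [exact: (continuous_slice_y cF)|exact: (continuous_slice_y cv0)].
- move=> y y1 ys; apply: (is_derive1_eq (is_derive1M (dF y z z0 y1 ys) (dvy y z))) => //.
  by rewrite addrC.
- by move=> y y1; apply: hM.
- exact: (measurable_Omega_slice_y z0 (ibp_measurable cvy)).
Qed.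

(** No boundary term survives: the product vanishes at the top by hypothesis and [F] vanishes far
    down, which also replaces the half line by a bounded interval. *)
Lemma ibp_z_core (s : R -> seq R) :
  (forall y : R, -1 < y < 1 -> F (y, 0) * v (y, 0) = 0) ->
  (forall y z : R, z < 0 -> -1 < y < 1 -> z \notin s y ->
     is_derive z 1 (fun t => F (y, t)) (d (y, z))) ->
  (\int[leb2]_(p in Omega) (F p * dz v p + d p * v p)%:E = 0)%E.
Proof.
move=> Fv0 dF; have [cv0 _ cvz _ dvz] := Ck1P cv.
rewrite integral_Omega12; last exact: ibp_integrable.
rewrite -[RHS](integral0 mu `](-1)%R, 1%R[).
apply: eq_integral => y; rewrite inE/= in_itv/= => y1.
have [M hM] := ibp_bound cvz.
(* The lower end is [- (N + 1)] because [F] is assumed to vanish only strictly below [- N]; this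
   also makes the interval nondegenerate for [N = 0]. *)
have NN : - (N + 1) < 0 by rewrite oppr_lt0 ltr_wpDl.
have mh : measurable_fun (`]-oo, 0[ : set R) (fun z => F (y, z) * dz v (y, z) + d (y, z) * v (y, z)).
  exact: (measurable_Omega_slice_z y1 (ibp_measurable cvz)).
transitivity (\int[mu]_(z in `](- (N + 1))%R, 0%R[)
    (F (y, z) * dz v (y, z) + d (y, z) * v (y, z))%:E)%E.
  have sub : (`]- (N + 1), 0[ : set R) `<=` `]-oo, 0[ by exact: subset_itvr.
  rewrite -[in RHS](setIidr sub) integral_mkcondr.
  apply: eq_integral => z; rewrite inE/= in_itv/= => z0.
  rewrite /patch; case: ifPn => // /negP zN.
  have {}zN : z < - N.
    rewrite ltNge; apply/negP => Nz; apply: zN; rewrite inE/= in_itv/= z0 andbT; lra.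
  by rewrite FN// dN// !mul0r addr0.
transitivity (F (y, 0) * v (y, 0) - F (y, - (N + 1)) * v (y, - (N + 1)))%:E.
  2: by rewrite Fv0// FN ?mul0r ?subrr//= ltrN2 ltrDl.
apply: (@FTC_bounded_derive _ (- (N + 1)) 0 M (fun t => F (y, t) * v (y, t)) _ (s y)).
- by [].
- by move=> z; apply: cvgM; [exact: (continuous_slice_z cF)|exact: (continuous_slice_z cv0)].
- move=> z /andP[_ z0] ys; apply: (is_derive1_eq (is_derive1M (dF y z z0 y1 ys) (dvz y z))) => //.
  by rewrite addrC.
- by move=> z /andP[_ z0]; apply: hM.
- by apply: measurable_funS mh => //; exact: subset_itvr.
Qed.

End core.
End IBP.

(** * Integration by parts against functions with zero lateral trace *)

Section IBPX.
Context {R : realType}.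
Notation mu := (@lebesgue_measure R).
Notation pl := (measurableTypeR R * measurableTypeR R)%type.
Variables (F d : R * R -> R) (N B : R) (phi : R * R -> R) (g : R * R -> R * R).
Hypothesis N0 : 0 <= N.
Hypothesis cF : continuous F.
Hypothesis md : measurable_fun (Omega : set pl) d.
Hypothesis dB : forall p : R * R, Omega p -> `|d p| <= B.
Hypothesis FN : forall p : R * R, p.2 < - N -> F p = 0.
Hypothesis dN : forall p : R * R, Omega p -> p.2 < - N -> d p = 0.
Hypothesis L2phi : L2 phi.
Hypothesis L2g1 : L2 (fst \o g).
Hypothesis L2g2 : L2 (snd \o g).
Hypothesis trphi : lateral_trace phi g (cst 0) (cst 0).

Lemma field_L2 : square_integrable leb2 Omega F.
Proof.
have [M M0 hM] := bounded_on_box (-1) 1 (- N) 0 cF.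
apply: (@box_L2 _ _ N M); first exact: measurable_Omega_continuous; last first.
  by move=> p _; exact: FN.
move=> p [/andP[p1 p1'] p2]; have [pN|Np] := ltP p.2 (- N).
  by rewrite FN// normr0.
by apply: hM; [rewrite !ltW|rewrite Np ltW].
Qed.

Lemma field_derivative_L2 : square_integrable leb2 Omega d.
Proof. exact: (@box_L2 _ _ N B). Qed.

Let field_trace_L2 (c : R) : `|c| <= 1 ->
  square_integrable mu (`]-oo, 0[ : set R) (fun z => F (c, z)).
Proof.
move=> c1; have [M M0 hM] := bounded_on_box (-1) 1 (- N) 0 cF.
apply: (@bounded_support_L2 _ _ _ mu _ _ `[- N, 0] _ M) => //.
- by rewrite /= lebesgue_measure_itv/=; case: ifPn => //; rewrite -EFinB ltry.
- apply: measurable_funTS; apply: continuous_measurable_fun.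
  exact: (continuous_slice_z cF).
- move=> z; rewrite /= in_itv/= => z0; have [zN|Nz] := ltP z (- N).
    by rewrite FN// normr0.
  by apply: hM => /=; [rewrite -ler_norml|rewrite Nz ltW].
- move=> z; rewrite /= !in_itv/= => z0 zN; apply: FN => /=.
  by rewrite ltNge; apply/negP => Nz; apply: zN; rewrite Nz ltW.
Qed.

Lemma field_integrable1 : leb2.-integrable Omega (fun p => (F p * (g p).1)%:E).
Proof.
exact: (@L2_mul_integrable _ _ _ leb2 _ measurable_Omega F (fst \o g) field_L2 L2g1).
Qed.

Lemma field_integrable2 : leb2.-integrable Omega (fun p => (F p * (g p).2)%:E).
Proof.
exact: (@L2_mul_integrable _ _ _ leb2 _ measurable_Omega F (snd \o g) field_L2 L2g2).
Qed.

Lemma field_integrable0 : leb2.-integrable Omega (fun p => (d p * phi p)%:E).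
Proof.
exact: (@L2_mul_integrable _ _ _ leb2 _ measurable_Omega d phi field_derivative_L2 L2phi).
Qed.

(* [w] stands for a partial derivative of the approximations of [phi], and [h] for the
   corresponding component of [g]. *)
Let ibp_approx (h : R * R -> R) (v w : nat -> R * R -> R) (t : nat -> \bar R) :
  L2 h -> (forall n, Ck 1 (v n)) -> (forall n, continuous (w n)) ->
  (\int[leb2]_(p in Omega) ((v n p - phi p) ^+ 2)%:E @[n --> \oo] --> 0)%E ->
  (\int[leb2]_(p in Omega) ((w n p - h p) ^+ 2)%:E @[n --> \oo] --> 0)%E ->
  (forall n, `|\int[leb2]_(p in Omega) (F p * w n p + d p * v n p)%:E| <= t n)%E ->
  (forall e : R, 0 < e -> \forall n \near \oo, (t n <= e%:E)%E) ->
  (\int[leb2]_(p in Omega) (F p * h p + d p * phi p)%:E = 0)%E.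
Proof.
move=> L2h Cv cw v0 w0 Et t0.
have mO := @measurable_Omega R.
have mh : measurable_fun (Omega : set pl) h by have [] := L2h.
have mphi : measurable_fun (Omega : set pl) phi by have [] := L2phi.
have mF : measurable_fun (Omega : set pl) F by exact: measurable_Omega_continuous.
have mw n : measurable_fun (Omega : set pl) (w n) by exact: measurable_Omega_continuous.
have mv n : measurable_fun (Omega : set pl) (v n).
  by apply: measurable_Omega_continuous; have [] := Ck1P (Cv n).
have iFh : leb2.-integrable Omega (fun p => (F p * h p)%:E).
  exact: (@L2_mul_integrable _ _ _ leb2 _ mO F h field_L2 L2h).
have i0 := field_integrable0.
have iI : leb2.-integrable Omega (fun p => (F p * h p + d p * phi p)%:E).
  exact: (integrableD mO iFh i0).
have iE n : leb2.-integrable Omega (fun p => (F p * w n p + d p * v n p)%:E).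
  exact: (ibp_integrable cF md dB FN dN (Cv n) (cw n)).
set I := (\int[leb2]_(p in Omega) _)%E.
suff : (`|I| <= 0)%E.
  by move=> I0; apply/eqP; rewrite -abse_eq0 eq_le I0 abse_ge0.
apply/lee_addgt0Pr => e e0; rewrite add0e.
have e3 : 0 < e / 3 by rewrite divr_gt0.
have n1 := L2_weight_near mO e3 field_L2 (fun n => measurable_funB (mw n) mh) w0.
have n2 := L2_weight_near mO e3 field_derivative_L2 (fun n => measurable_funB (mv n) mphi) v0.
have n3 := t0 _ e3.
near \oo => n.
(* The integral for [phi] is the one for [v n], small by the bound [t n], minus two errors that pair
   a fixed square-integrable weight with an L^2-small difference; each of the three gets [e / 3]. *)
have -> : I = (\int[leb2]_(p in Omega) (F p * w n p + d p * v n p)%:E -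
  \int[leb2]_(p in Omega) (F p * (w n p - h p) + d p * (v n p - phi p))%:E)%E.
  rewrite -integralB//.
    by apply: eq_integral => p _; rewrite -EFinB; congr (_%:E); ring.
  have := integrableB mO (iE n) iI; apply: eq_integrable => // p _ /=.
  by rewrite -EFinB; congr (_%:E); ring.
rewrite (le_trans (lee_abs_sub _ _))//.
have -> : e%:E = ((e / 3)%:E + ((e / 3)%:E + (e / 3)%:E))%E.
  by rewrite -!EFinD; congr (_%:E); field.
apply: leeD.
  by apply: (le_trans (Et n)); near: n.
have mA : measurable_fun (Omega : set pl) (fun p => F p * (w n p - h p)).
  by apply: measurable_funM => //; exact: measurable_funB.
have mB : measurable_fun (Omega : set pl) (fun p => d p * (v n p - phi p)).
  by apply: measurable_funM => //; exact: measurable_funB.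
apply: (le_trans (le_abse_integral _ mO _)).
  by apply/measurable_EFinP; exact: measurable_funD.
apply: (@le_trans _ _ (\int[leb2]_(p in Omega)
   (`|(F p * (w n p - h p))%:E| + `|(d p * (v n p - phi p))%:E|))%E).
  apply: ge0_le_integral => //.
  - by apply: measurableT_comp => //; apply/measurable_EFinP; exact: measurable_funD.
  - by apply: emeasurable_funD; apply: measurableT_comp => //; exact/measurable_EFinP.
  - by move=> p _; rewrite EFinD; exact: lee_abs_add.
rewrite ge0_integralD//; last 2 first.
- by apply: measurableT_comp => //; exact/measurable_EFinP.
- by apply: measurableT_comp => //; exact/measurable_EFinP.
by apply: leeD; near: n.
Unshelve. all: by end_near. Qed.

(** The side terms of the approximations pair [F (1, z)] and [F (-1, z)], which are bounded with
    bounded support, with traces tending to 0 in L^2. Hence [F] itself need not vanish on the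
    sides. *)
Lemma ibp_y (s : R -> seq R) :
  (forall y z : R, z < 0 -> -1 < y < 1 -> y \notin s z ->
     is_derive y 1 (fun t => F (t, z)) (d (y, z))) ->
  (\int[leb2]_(p in Omega) (F p * (g p).1 + d p * phi p)%:E = 0)%E.
Proof.
move=> dF; have [_ _ [v [Cv [v0 vy0 vz0 tm tp]]]] := trphi.
have Cv1 n := (Cv n).1.
have h1 : `|1 : R| <= 1 by rewrite normr1.
have h2 : `|-1 : R| <= 1 by rewrite normrN1.
have mv n (c : R) : measurable_fun (`]-oo, 0[ : set R) (fun z => v n (c, z)).
  apply: measurable_funTS; apply: continuous_measurable_fun.
  by apply: continuous_slice_z; have [] := Ck1P (Cv1 n).
have mFc (c : R) : measurable_fun (`]-oo, 0[ : set R) (fun z => F (c, z)).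
  by apply: measurable_funTS; apply: continuous_measurable_fun; exact: continuous_slice_z.
have mFv n (c : R) : measurable_fun (`]-oo, 0[ : set R) (fun z => F (c, z) * v n (c, z)).
  by apply: measurable_funM; [exact: mFc|exact: mv].
have tm' : (\int[mu]_(z in `]-oo, 0%R[) ((v n (-1, z)) ^+ 2)%:E @[n --> \oo] --> 0)%E.
  by move: tm; under eq_fun do under eq_integral do rewrite subr0.
have tp' : (\int[mu]_(z in `]-oo, 0%R[) ((v n (1, z)) ^+ 2)%:E @[n --> \oo] --> 0)%E.
  by move: tp; under eq_fun do under eq_integral do rewrite subr0.
apply: (@ibp_approx (fst \o g) v (fun n => dy (v n)) (fun n =>
  \int[mu]_(z in `]-oo, 0%R[) `|(F (1, z) * v n (1, z))%:E| +
  \int[mu]_(z in `]-oo, 0%R[) `|(F (-1, z) * v n (-1, z))%:E|)%E) => //.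
- by move=> n; have [] := Ck1P (Cv1 n).
- move=> n; rewrite (ibp_y_core cF md dB FN dN (Cv1 n) dF).
  apply: (le_trans (le_abse_integral _ _ _)) => //.
    by apply/measurable_EFinP; apply: measurable_funB; exact: mFv.
  rewrite -ge0_integralD//; last 2 first.
  - by apply: measurableT_comp => //; apply/measurable_EFinP; exact: mFv.
  - by apply: measurableT_comp => //; apply/measurable_EFinP; exact: mFv.
  apply: ge0_le_integral => //.
  - by apply: measurableT_comp => //; apply/measurable_EFinP; apply: measurable_funB; exact: mFv.
  - by apply: emeasurable_funD; apply: measurableT_comp => //; apply/measurable_EFinP; exact: mFv.
  - by move=> z _; rewrite EFinB; exact: lee_abs_sub.
- move=> e e0; have e2 : 0 < e / 2 by rewrite divr_gt0.
  have m0 : measurable (`]-oo, 0[ : set R) by exact: measurable_itv.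
  have n1 := @L2_weight_near _ _ _ mu _ m0 _ _ _ e2 (field_trace_L2 h1) (fun n => mv n 1) tp'.
  have n2 := @L2_weight_near _ _ _ mu _ m0 _ _ _ e2 (field_trace_L2 h2) (fun n => mv n (-1)) tm'.
  near=> n; rewrite [e]splitr EFinD.
  by apply: leeD; near: n.
Unshelve. all: by end_near. Qed.

(** The approximations are uncontrolled on [z = 0]; the vanishing of [F] there makes the boundary
    term of each of them exactly zero. *)
Lemma ibp_z (s : R -> seq R) :
  (forall y : R, -1 < y < 1 -> F (y, 0) = 0) ->
  (forall y z : R, z < 0 -> -1 < y < 1 -> z \notin s y ->
     is_derive z 1 (fun t => F (y, t)) (d (y, z))) ->
  (\int[leb2]_(p in Omega) (F p * (g p).2 + d p * phi p)%:E = 0)%E.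
Proof.
move=> F0 dF; have [_ _ [v [Cv [v0 vy0 vz0 tm tp]]]] := trphi.
have Cv1 n := (Cv n).1.
apply: (@ibp_approx (snd \o g) v (fun n => dz (v n)) (fun n => 0%E)) => //.
- by move=> n; have [] := Ck1P (Cv1 n).
- move=> n; rewrite (ibp_z_core N0 cF md dB FN dN (Cv1 n) _ dF) ?abse0//.
  by move=> y y1; rewrite F0// mul0r.
- by move=> e e0; apply: nearW => n; rewrite lee_fin ltW.
Qed.

End IBPX.

(** * The parametrisation of the curve by an angle *)

Section Calculus.
Context {R : realType}.

(** In Caratheodory's form of the derivative, gluing comes down to the continuity at [x] of the
    glued slope functions. *)
Lemma is_derive1_glue (f1 f2 : R -> R) (x d : R) :
  is_derive x 1 f1 d -> is_derive x 1 f2 d -> f1 x = f2 x ->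
  is_derive x 1 (fun y => if y <= x then f1 y else f2 y) d.
Proof.
move=> /is_derive1_caratheodory[g1 [h1 c1 e1]] /is_derive1_caratheodory[g2 [h2 c2 e2]] f12.
apply/is_derive1_caratheodory; exists (fun y => if y <= x then g1 y else g2 y).
split; last by rewrite lexx.
- by move=> z; rewrite lexx; case: ifP => _; rewrite ?h1// f12 h2.
- apply/cvgrPdist_lt => e e0 /=; rewrite lexx e1.
  move/cvgrPdist_lt : c1 => /(_ _ e0); move/cvgrPdist_lt : c2 => /(_ _ e0).
  rewrite e1 e2 => n2 n1; near=> y.
  by case: ifP => _; near: y.
Unshelve. all: by end_near. Qed.

Lemma increasing_of_derive (a b : R) (f f' : R -> R) :
  (forall x, a <= x <= b -> is_derive x 1 f (f' x)) ->
  (forall x, a < x < b -> 0 < f' x) ->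
  forall x y, a <= x -> x < y -> y <= b -> f x < f y.
Proof.
move=> df f'0 x y ax xy yb.
have [||c] := @MVT R f f' x y xy.
- move=> z; rewrite in_itv/= => /andP[xz zy]; apply: df.
  by rewrite (le_trans ax (ltW xz)) (le_trans (ltW zy) yb).
- apply: continuous_in_subspaceT => z; rewrite inE/= in_itv/= => /andP[xz zy].
  by apply: is_derive1_continuous (df z _); rewrite (le_trans ax xz) (le_trans zy yb).
rewrite in_itv/= => /andP[xc cy] E; rewrite -subr_gt0 E mulr_gt0 ?subr_gt0//.
by apply: f'0; rewrite (le_lt_trans ax xc) (lt_le_trans cy yb).
Qed.

Section inverse.
Variables (c : R) (f f' : R -> R).
Hypothesis c0 : 0 < c.
Hypothesis df : forall x, - c <= x <= c -> is_derive x 1 f (f' x).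
Hypothesis f'0 : forall x, - c < x < c -> 0 < f' x.

Definition inverse_on (v : R) : R := xget 0 [set x | - c <= x <= c /\ f x = v].

Let f_incr := increasing_of_derive df f'0.

Lemma inverse_on_le x y : - c <= x <= c -> - c <= y <= c -> f x <= f y -> x <= y.
Proof.
move=> /andP[cx xc] /andP[cy yc]; apply: contraTT; rewrite -!ltNge => yx.
exact: f_incr.
Qed.

Lemma inverse_onK x : - c <= x <= c -> inverse_on (f x) = x.
Proof.
move=> xc; rewrite /inverse_on; case: xgetP => [y _ [yc fyx]|/(_ x)]; last by case.
by apply/eqP; rewrite eq_le; apply/andP; split; apply: inverse_on_le => //; rewrite fyx.
Qed.

Lemma is_derive_inverse_on x : - c < x < c ->
  is_derive (f x) 1 inverse_on (f' x)^-1.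
Proof.
move=> xc; have xc' : - c <= x <= c by case/andP: xc => ? ?; rewrite !ltW.
apply: (@is_derive_inverse R f inverse_on (f' x) x).
- near=> y; apply: inverse_onK; apply/andP; split; apply/ltW; near: y;
    [apply: lt_nbhsr|apply: lt_nbhsl]; by case/andP: xc.
- near=> y; apply: is_derive1_continuous (df _).
  apply/andP; split; apply/ltW; near: y;
    [apply: lt_nbhsr|apply: lt_nbhsl]; by case/andP: xc.
- exact: df.
- by rewrite gt_eqF// f'0.
Unshelve. all: by end_near. Qed.

End inverse.
End Calculus.

(** * The profile curve and its limiting angles *)

Section Profile.
Context {R : realType}.
Variable l : R.
Hypothesis l1 : 1 < l.

(* The graph of [phi_ l] is the curve [y = aa (t + l sin t)], [z = - aa sm (l + cos t)] for
   [`|t| <= th0]; [rr] is the slope [y / (- z)], which increases on the larger interval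
   [`|t| <= th1] since its derivative has the sign of [D_]. *)
Definition sm : R := Num.sqrt (l ^+ 2 - 1).
Definition th0 : R := acos (- l^-1).
Definition th1 : R := acos (- (2 * l / (1 + l ^+ 2))).
Definition aa : R := (th0 + l * sin th0)^-1.
Definition D_ (t : R) : R := 2 * l + (1 + l ^+ 2) * cos t + t * sin t.
Definition rr (t : R) : R := (t + l * sin t) / (sm * (l + cos t)).

Let l0 : 0 < l. Proof. exact: lt_trans l1. Qed.
Let mu0 : 0 < l ^+ 2 - 1. Proof. by rewrite subr_gt0 exprn_egt1. Qed.

Lemma sm_gt0 : 0 < sm. Proof. by rewrite sqrtr_gt0. Qed.

Lemma sm2 : sm ^+ 2 = l ^+ 2 - 1. Proof. by rewrite sqr_sqrtr// ltW. Qed.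

Lemma l_cos_gt0 t : 0 < l + cos t.
Proof. by have := cos_geN1 t; move: l1 => ? ?; lra. Qed.

Let ithN : -1 <= - l^-1 <= 1.
Proof.
have i1 : l^-1 < 1 by rewrite invf_lt1.
have i0 : 0 < l^-1 by rewrite invr_gt0.
by apply/andP; split; lra.
Qed.

Lemma cos_th0 : cos th0 = - l^-1.
Proof. by rewrite acosK// in_itv. Qed.

(** [1 + l cos t] is, up to the factor [aa], the derivative of the abscissa of the curve, so the
    curve becomes vertical at its endpoints. *)
Lemma l_cos_th0 : 1 + l * cos th0 = 0.
Proof. by rewrite cos_th0 mulrN divff ?subrr// gt_eqF. Qed.

Lemma th0_gt0 : 0 < th0.
Proof.
apply: acos_gt0; case/andP: ithN => -> _/=.
by apply: (@lt_trans _ _ 0) => //; rewrite oppr_lt0 invr_gt0.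
Qed.

Lemma th0_ltpi : th0 < pi.
Proof.
apply: acos_ltpi; case/andP: ithN => _ ->; rewrite andbT ltrN2.
by rewrite invf_lt1.
Qed.

Lemma sin_th0 : sin th0 = sm / l.
Proof.
rewrite sin_acos// /sm sqrrN exprVn.
have -> : 1 - (l ^+ 2)^-1 = (l ^+ 2 - 1) / l ^+ 2 by field; rewrite gt_eqF.
by rewrite sqrtrM ?ltW// sqrtrV ?sqr_ge0// sqrtr_sqr gtr0_norm.
Qed.

Lemma sin_th0_gt0 : 0 < sin th0.
Proof. by rewrite sin_th0 divr_gt0// sm_gt0. Qed.

Lemma aa_gt0 : 0 < aa.
Proof. by rewrite invr_gt0 addr_gt0 ?th0_gt0// mulr_gt0// sin_th0_gt0. Qed.

Lemma aaE : aa * (th0 + l * sin th0) = 1.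
Proof. by rewrite mulVf// gt_eqF// addr_gt0 ?th0_gt0// mulr_gt0// sin_th0_gt0. Qed.

Let q1 : -1 < - (2 * l / (1 + l ^+ 2)) < - l^-1.
Proof.
have p0 : 0 < 1 + l ^+ 2 by rewrite addr_gt0// exprn_gt0.
apply/andP; split.
  rewrite ltrN2 ltr_pdivrMr// mul1r -subr_gt0.
  have -> : 1 + l ^+ 2 - 2 * l = (l - 1) ^+ 2 by ring.
  by rewrite exprn_gt0// subr_gt0.
by rewrite ltrN2 ltr_pdivlMr// mulrC ltr_pdivrMr//; move: mu0 => ?; lra.
Qed.

Lemma th0_lt_th1 : th0 < th1.
Proof.
have /andP[q2 q3] := q1; have /andP[q4 q5] := ithN.
have q6 : -1 <= - (2 * l / (1 + l ^+ 2)) <= 1.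
  by rewrite ltW//= (le_trans (ltW q3)).
rewrite -ltr_cos ?in_itv/= ?acos_ge0 ?acos_lepi//.
by rewrite !acosK// in_itv.
Qed.

Lemma th1_ltpi : th1 < pi.
Proof.
have /andP[q2 q3] := q1; have /andP[q4 q5] := ithN.
by apply: acos_ltpi; rewrite q2/= (le_trans (ltW q3)).
Qed.

Lemma cos_th1 : (1 + l ^+ 2) * cos th1 = - (2 * l).
Proof.
have /andP[q2 q3] := q1; have /andP[q4 q5] := ithN.
rewrite acosK; first by field; rewrite gt_eqF// addr_gt0// exprn_gt0.
by rewrite in_itv/= ltW//= (le_trans (ltW q3)).
Qed.

Lemma mul_sin_ge0 (t : R) : `|t| <= pi -> 0 <= t * sin t.
Proof.
rewrite ler_norml => /andP[t1 t2]; have [t0|t0] := leP 0 t.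
  by rewrite mulr_ge0// sin_ge0_pi// t0.
rewrite -mulrNN -sinN; apply: mulr_ge0; first by rewrite oppr_ge0 ltW.
by apply: sin_ge0_pi; rewrite oppr_ge0 ltW//= lerNl.
Qed.

Lemma cos_ge_of_norm_le (c t : R) : 0 <= c <= pi -> `|t| <= c -> cos c <= cos t.
Proof.
move=> /andP[c0 cpi] tc; rewrite -(cos_norm t) leNgt; apply/negP.
rewrite ltr_cos ?in_itv/= ?c0 ?normr_ge0 ?(le_trans tc)//.
by rewrite ltNge tc.
Qed.

(** [th1] is the zero of [2 l + (1 + l^2) cos t], so this part is nonnegative; the remaining
    [t sin t] is positive unless [t = 0], where the first part is positive. *)
Lemma D_gt0 t : `|t| <= th1 -> 0 < D_ t.
Proof.
move=> tt1; have th1pi := th1_ltpi; have th01 := th0_lt_th1; have th00 := th0_gt0.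
have tpi : `|t| <= pi by apply: le_trans tt1 _; exact: ltW.
have s0 := mul_sin_ge0 tpi.
have c1 : cos th1 <= cos t by apply: cos_ge_of_norm_le => //; apply/andP; split; lra.
have c2 : (1 + l ^+ 2) * cos th1 <= (1 + l ^+ 2) * cos t.
  by rewrite ler_pM2l// addr_gt0// exprn_gt0.
have := cos_th1 => E.
have [t0|t0] := eqVneq t 0.
  by rewrite /D_ t0 cos0 sin0 mulr0 addr0 mulr1; rewrite !addr_gt0 ?mulr_gt0 ?exprn_gt0.
have tp : 0 < `|t| < pi by rewrite normr_gt0 t0 (le_lt_trans tt1).
have : 0 < t * sin t.
  rewrite lt_neqAle s0 andbT eq_sym mulf_neq0//.
  have := sin_gt0_pi tp; case: (ger0P t) => _; first by move=> /lt0r_neq0.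
  by rewrite sinN oppr_gt0 => /ltr0_neq0.
by rewrite /D_; lra.
Qed.

(** The bound is the value of [2 l + (1 + l^2) cos t] at [th0], where the cosine is smallest. It
    keeps the second derivatives bounded up to the boundary of the cone. *)
Lemma D_ge t : `|t| <= th0 -> (l ^+ 2 - 1) / l <= D_ t.
Proof.
move=> tt0; have th1pi := th0_ltpi; have th00 := th0_gt0.
have s0 : 0 <= t * sin t by apply: mul_sin_ge0; rewrite (le_trans tt0)// ltW.
have c1 : cos th0 <= cos t by apply: cos_ge_of_norm_le => //; rewrite !ltW.
have c2 : (1 + l ^+ 2) * cos th0 <= (1 + l ^+ 2) * cos t.
  by rewrite ler_pM2l// addr_gt0// exprn_gt0.
move: c2; rewrite cos_th0 /D_.
have -> : (l ^+ 2 - 1) / l = 2 * l + (1 + l ^+ 2) * - l^-1 by field; rewrite gt_eqF.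
by lra.
Qed.

Lemma one_l_cos_ge0 t : `|t| <= th0 -> 0 <= 1 + l * cos t.
Proof.
move=> tt0; rewrite -l_cos_th0 lerD2l ler_pM2l//.
by apply: cos_ge_of_norm_le => //; rewrite !ltW ?th0_gt0 ?th0_ltpi.
Qed.

Lemma one_l_cos_gt0 t : `|t| < th0 -> 0 < 1 + l * cos t.
Proof.
move=> tt0; rewrite -l_cos_th0 ltrD2l ltr_pM2l// -(cos_norm t).
rewrite ltr_cos// in_itv/= ?normr_ge0/= ?ltW ?th0_gt0 ?th0_ltpi//.
by rewrite (lt_trans tt0)// th0_ltpi.
Qed.

End Profile.

(** * Derivatives and identities along the curve *)

Section ThetaDerivatives.
Context {R : realType}.
Variable l : R.
Hypothesis l1 : 1 < l.
Implicit Types t : R.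

(* In the cone, at a point of the ray of parameter [t]: [(ee, nn)] is the gradient of [L],
   [(Q1, Q2)] is [q_], and [L = - z * ih t]; [dTh] is the derivative of the inverse of [rr]. *)
Definition ee t := sin t / (aa l * D_ l t).
Definition nn t := - (1 + l * cos t) / (aa l * sm l * D_ l t).
Definition Q1 t := - (sm l * sin t) / (l + cos t).
Definition Q2 t := (1 + l * cos t) / (l + cos t).
Definition ih t := (aa l * sm l * (l + cos t))^-1.
Definition ee' t := (l + cos t) ^+ 2 / (aa l * D_ l t ^+ 2).
Definition dTh t := sm l * (l + cos t) ^+ 2 / D_ l t.

Let lc t : l + cos t != 0. Proof. by rewrite gt_eqF// l_cos_gt0. Qed.
Let a0 : aa l != 0. Proof. by rewrite gt_eqF// aa_gt0. Qed.
Let s0 : sm l != 0. Proof. by rewrite gt_eqF// sm_gt0. Qed.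

Lemma is_derive1_lcos (k t : R) : is_derive t 1 (fun x => k + cos x) (- sin t).
Proof.
apply: (is_derive1_eq (is_derive1D (is_derive1_cst k t) (is_derive_cos t))) => //.
by rewrite add0r.
Qed.

Lemma is_derive_D t : is_derive t 1 (D_ l) (t * cos t - l ^+ 2 * sin t).
Proof.
apply: (is_derive1_eq (is_derive1D
  (is_derive1D (is_derive1_cst (2 * l) t) (is_derive1Z (1 + l ^+ 2) (is_derive_cos t)))
  (is_derive1M (is_derive1_id t) (is_derive_sin t)))) => //.
by ring.
Qed.

Lemma is_derive_tls t : is_derive t 1 (fun x => x + l * sin x) (1 + l * cos t).
Proof. exact: (is_derive1D (is_derive1_id t) (is_derive1Z l (is_derive_sin t))). Qed.

Lemma is_derive_olc t : is_derive t 1 (fun x => 1 + l * cos x) (- (l * sin t)).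
Proof.
apply: (is_derive1_eq (is_derive1D (is_derive1_cst 1 t) (is_derive1Z l (is_derive_cos t)))) => //.
by ring.
Qed.

(** Up to the factor [aa^2 * sm], this is the determinant [y z' - z y'] of position and tangent of
    the curve: [D_ > 0] says that the rays cross the curve transversally. *)
Lemma D_split t : D_ l t = (1 + l * cos t) * (l + cos t) + (t + l * sin t) * sin t.
Proof. by rewrite /D_; ring: (sin2cos2 t). Qed.

Lemma is_derive_rr t : is_derive t 1 (rr l) (D_ l t / (sm l * (l + cos t) ^+ 2)).
Proof.
have h : sm l * (l + cos t) != 0 by rewrite mulf_neq0.
apply: (is_derive1_eq (is_derive1_div (is_derive_tls t)
  (is_derive1Z (sm l) (is_derive1_lcos l t)) h)) => //.
rewrite D_split; field.
by rewrite s0 lc.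
Qed.

Lemma is_derive_ih t : is_derive t 1 ih (sin t / (aa l * sm l * (l + cos t) ^+ 2)).
Proof.
have h : aa l * sm l * (l + cos t) != 0 by rewrite !mulf_neq0.
apply: (is_derive1_eq (is_derive1V (is_derive1Z (aa l * sm l) (is_derive1_lcos l t)) h)) => //.
by field; rewrite s0 lc a0.
Qed.

Lemma is_derive_Q1 t :
  is_derive t 1 Q1 (- (sm l * (1 + l * cos t)) / (l + cos t) ^+ 2).
Proof.
apply: (is_derive1_eq (is_derive1_div
  (is_derive1N (is_derive1Z (sm l) (is_derive_sin t))) (is_derive1_lcos l t) (lc t))) => //.
by field: (sin2cos2 t).
Qed.

Lemma is_derive_Q2 t :
  is_derive t 1 Q2 (- ((l ^+ 2 - 1) * sin t) / (l + cos t) ^+ 2).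
Proof.
apply: (is_derive1_eq (is_derive1_div (is_derive_olc t) (is_derive1_lcos l t) (lc t))) => //.
by field.
Qed.

Lemma is_derive_ee t : D_ l t != 0 -> is_derive t 1 ee (ee' t).
Proof.
move=> D0; have h : aa l * D_ l t != 0 by rewrite mulf_neq0.
apply: (is_derive1_eq (is_derive1_div (is_derive_sin t)
  (is_derive1Z (aa l) (is_derive_D t)) h)) => //.
rewrite /ee'; have -> : (l + cos t) ^+ 2 =
    cos t * D_ l t - sin t * (t * cos t - l ^+ 2 * sin t).
  by rewrite /D_; ring: (sin2cos2 t).
by field; rewrite D0 a0.
Qed.

(** L is homogeneous of degree one, so [y ee' + z nn' = 0] along each ray, that is [nn' = rr * ee'].
    All second derivatives of L are thereby governed by [ee']. *)
Lemma is_derive_nn t : D_ l t != 0 -> is_derive t 1 nn (rr l t * ee' t).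
Proof.
move=> D0; have h : aa l * sm l * D_ l t != 0 by rewrite !mulf_neq0.
apply: (is_derive1_eq (is_derive1_div (is_derive1N (is_derive_olc t))
  (is_derive1Z (aa l * sm l) (is_derive_D t)) h)) => //.
rewrite /ee' /rr.
have E : l * sin t * D_ l t + (1 + l * cos t) * (t * cos t - l ^+ 2 * sin t) =
    (l + cos t) * (t + l * sin t).
  by rewrite /D_; ring: (sin2cos2 t).
transitivity ((l * sin t * D_ l t + (1 + l * cos t) * (t * cos t - l ^+ 2 * sin t)) /
    (aa l * sm l * D_ l t ^+ 2)).
  by field; rewrite D0 a0 s0.
by rewrite E; field; rewrite D0 a0 s0 lc.
Qed.

(** Euler's identity [L = y L_y + z L_z], divided by [- z]. *)
Lemma ih_split t : D_ l t != 0 -> rr l t * ee t - nn t = ih t.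
Proof.
move=> D0; rewrite /rr /ee /nn /ih.
transitivity (((1 + l * cos t) * (l + cos t) + (t + l * sin t) * sin t) /
    (aa l * sm l * (l + cos t) * D_ l t)).
  by field; rewrite D0 a0 s0 lc.
by rewrite -D_split; field; rewrite D0 a0 s0 lc.
Qed.

(** Only the second term of [D_split] survives at the vertical endpoint, and [aa] normalises it;
    this gives L_y = 1 on the boundary of the cone, matching [|y|] outside. *)
Lemma D_th0 : aa l * D_ l (th0 l) = sin (th0 l).
Proof.
have E : D_ l (th0 l) = sin (th0 l) * (th0 l + l * sin (th0 l)).
  by rewrite D_split l_cos_th0// mul0r add0r mulrC.
by rewrite E mulrCA aaE// mulr1.
Qed.

Lemma DN t : D_ l (- t) = D_ l t.
Proof. by rewrite /D_ cosN sinN mulrNN. Qed.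

Lemma eeN t : ee (- t) = - ee t.
Proof. by rewrite /ee sinN DN mulNr. Qed.

Lemma nnN t : nn (- t) = nn t.
Proof. by rewrite /nn cosN DN. Qed.

Lemma rrN t : rr l (- t) = - rr l t.
Proof. by rewrite /rr cosN sinN; rewrite mulrN -opprD mulNr. Qed.

Lemma ee_th0 : ee (th0 l) = 1.
Proof. by rewrite /ee D_th0 divff// gt_eqF// sin_th0_gt0. Qed.

Lemma nn_th0 : nn (th0 l) = 0.
Proof. by rewrite /nn l_cos_th0// oppr0 mul0r. Qed.

Lemma Q1_th0 : Q1 (th0 l) = - 1.
Proof.
have l0 : l != 0 by rewrite gt_eqF// (lt_trans _ l1).
have m0 : l ^+ 2 - 1 != 0 by rewrite gt_eqF// subr_gt0 exprn_egt1.
rewrite /Q1 sin_th0// cos_th0// mulrA -expr2 sm2//; field.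
by rewrite m0 l0.
Qed.

Lemma Q2_th0 : Q2 (th0 l) = 0.
Proof. by rewrite /Q2 l_cos_th0// mul0r. Qed.

Lemma Q1N t : Q1 (- t) = - Q1 t.
Proof. by rewrite /Q1 sinN cosN mulrN !mulNr. Qed.

Lemma Q2N t : Q2 (- t) = Q2 t.
Proof. by rewrite /Q2 cosN. Qed.

Lemma Q12 t : Q1 t ^+ 2 + Q2 t ^+ 2 = 1.
Proof.
rewrite /Q1 /Q2 !exprMn sqrrN !exprMn sm2// exprVn.
by field: (sin2cos2 t).
Qed.

Lemma ee_Q1 t : D_ l t != 0 -> ee t = - Q1 t * ((l + cos t) / (aa l * sm l * D_ l t)).
Proof. by move=> D0; rewrite /ee /Q1; field; rewrite D0 a0 s0 lc. Qed.

Lemma nn_Q2 t : D_ l t != 0 -> nn t = - Q2 t * ((l + cos t) / (aa l * sm l * D_ l t)).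
Proof. by move=> D0; rewrite /nn /Q2; field; rewrite D0 a0 s0 lc. Qed.

End ThetaDerivatives.

(** * The angle as a function of the slope *)

Section Angle.
Context {R : realType}.
Variable l : R.
Hypothesis l1 : 1 < l.
Implicit Types t rho : R.

(* [r0] is the slope of the boundary of the cone and [Ang] the parameter of the ray of a
   given slope, frozen outside the cone; [- z * mm] extends [L] by [`|y|]. *)
Definition r0 : R := rr l (th0 l).
Definition Th : R -> R := inverse_on (th1 l) (rr l).
Definition Ang rho : R := Th (clamp (- r0) r0 rho).
Definition mm rho : R := rho * ee l (Ang rho) - nn l (Ang rho).
(* The derivative of [G \o Ang] off the kinks [`|rho| = r0]. *)
Definition chain (G' : R -> R) rho : R :=
  if `|rho| < r0 then G' (Ang rho) * dTh l (Ang rho) else 0.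

Let th00 := th0_gt0 l1.
Let th01 := th0_lt_th1 l1.

Let drr' t := D_ l t / (sm l * (l + cos t) ^+ 2).

Let drr'_gt0 t : `|t| <= th1 l -> 0 < drr' t.
Proof.
by move=> tt; rewrite divr_gt0 ?D_gt0// mulr_gt0 ?sm_gt0// exprn_gt0// l_cos_gt0.
Qed.

Let drr_pos x : - th1 l < x < th1 l -> 0 < drr' x.
Proof.
by move=> /andP[x1 x2]; apply: drr'_gt0; rewrite ler_norml !ltW.
Qed.

Let norm_th1 t : `|t| <= th0 l -> - th1 l < t < th1 l.
Proof. by move=> tt; rewrite -ltr_norml (le_lt_trans tt). Qed.

Let norm_th1W t : `|t| <= th0 l -> - th1 l <= t <= th1 l.
Proof. by move=> tt; rewrite -ler_norml (le_trans tt)// ltW. Qed.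

Lemma dThE t : `|t| <= th0 l -> dTh l t = (drr' t)^-1.
Proof. by move=> tt; rewrite /drr' invf_div. Qed.

Lemma D_neq0 t : `|t| <= th0 l -> D_ l t != 0.
Proof. by move=> tt; rewrite gt_eqF// D_gt0// (le_trans tt)// ltW. Qed.

Lemma rr_lt t1 t2 : `|t1| <= th0 l -> `|t2| <= th0 l -> t1 < t2 -> rr l t1 < rr l t2.
Proof.
move=> h1 h2 t12.
have /andP[a1 a2] := norm_th1W h1; have /andP[a3 a4] := norm_th1W h2.
exact: (increasing_of_derive (fun x _ => is_derive_rr l1 x) drr_pos).
Qed.

Lemma ThK t : `|t| <= th0 l -> Th (rr l t) = t.
Proof.
move=> tt; apply: (inverse_onK (fun x _ => is_derive_rr l1 x) drr_pos).
exact: norm_th1W.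
Qed.

Lemma r0_gt0 : 0 < r0.
Proof.
have := @rr_lt 0 (th0 l); rewrite normr0 gtr0_norm// lexx ltW// => /(_ isT isT th00).
by rewrite /r0 {1}/rr sin0 mulr0 addr0 mul0r.
Qed.

Let r0N : - r0 <= r0. Proof. by rewrite ge0_cp// ltW// r0_gt0. Qed.

Lemma rr_itv t : `|t| <= th0 l -> - r0 <= rr l t <= r0.
Proof.
move=> tt; have tt' := tt; move: tt; rewrite ler_norml => /andP[t1 t2].
have n0 : `|th0 l| <= th0 l by rewrite gtr0_norm.
have n0' : `|- th0 l| <= th0 l by rewrite normrN.
apply/andP; split.
  move: t1; rewrite le_eqVlt => /predU1P[<-|t1]; first by rewrite rrN.
  by rewrite -rrN ltW// rr_lt.
move: t2; rewrite le_eqVlt => /predU1P[->//|t2].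
by rewrite ltW// rr_lt.
Qed.

Lemma rr_surj v : - r0 <= v <= r0 -> exists2 t, `|t| <= th0 l & rr l t = v.
Proof.
move=> vr.
have [|||x] := @IVT R (rr l) (- th0 l) (th0 l) v.
- by rewrite ge0_cp// ltW.
- apply: continuous_in_subspaceT => z _.
  exact: is_derive1_continuous (is_derive_rr l1 z).
- by rewrite rrN -/r0 min_l// max_r.
by rewrite in_itv/= -ler_norml => xt xv; exists x.
Qed.

Lemma Th_itv v : - r0 <= v <= r0 -> `|Th v| <= th0 l /\ rr l (Th v) = v.
Proof. by move=> /rr_surj[t tt <-]; rewrite ThK. Qed.

(** The endpoints [r0] and [- r0] are included because [Th] inverts [rr] on the larger interval
    [|t| <= th1], of which [th0] and [- th0] are interior points. *)
Lemma is_derive_Th v : - r0 <= v <= r0 -> is_derive v 1 Th (dTh l (Th v)).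
Proof.
move=> /rr_surj[t tt <-]; rewrite ThK// dThE//.
exact: (is_derive_inverse_on (fun x _ => is_derive_rr l1 x) drr_pos (norm_th1 tt)).
Qed.

Lemma Ang_itv rho : `|Ang rho| <= th0 l.
Proof. by have [] := Th_itv (clamp_itv rho r0N). Qed.

Lemma Ang_in rho : `|rho| <= r0 -> Ang rho = Th rho.
Proof. by rewrite ler_norml => rr0; rewrite /Ang clamp_id. Qed.

Lemma rr_Ang rho : `|rho| <= r0 -> rr l (Ang rho) = rho.
Proof. by move=> h; rewrite Ang_in//; apply: (Th_itv _).2; rewrite -ler_norml. Qed.

Lemma Ang_rr t : `|t| <= th0 l -> Ang (rr l t) = t.
Proof. by move=> tt; rewrite Ang_in ?ThK// ler_norml rr_itv. Qed.

Lemma Ang_ge rho : r0 <= rho -> Ang rho = th0 l.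
Proof. by move=> h; rewrite /Ang clamp_ge// ThK// gtr0_norm. Qed.

Lemma Ang_le rho : rho <= - r0 -> Ang rho = - th0 l.
Proof. by move=> h; rewrite /Ang clamp_le// -rrN ThK// normrN gtr0_norm. Qed.

Lemma continuous_Ang : continuous Ang.
Proof.
move=> rho; apply: continuous_comp; first exact: continuous_clamp.
exact: is_derive1_continuous (is_derive_Th (clamp_itv rho r0N)).
Qed.

Let near_norm_lt (r rho : R) : `|rho| < r -> \forall x \near rho, `|x| < r.
Proof.
rewrite ltr_norml => /andP[h1 h2]; near=> x.
by rewrite ltr_norml; apply/andP; split; near: x; [exact: lt_nbhsr|exact: lt_nbhsl].
Unshelve. all: by end_near. Qed.

Lemma is_derive_Ang_in rho : `|rho| < r0 -> is_derive rho 1 Ang (dTh l (Ang rho)).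
Proof.
move=> h; have h' := ltW h; rewrite Ang_in//.
have := is_derive_Th; move=> /(_ rho); rewrite -ler_norml => /(_ h') dT.
apply: (is_derive1_near dT); near=> x; rewrite Ang_in// ltW//.
by near: x; exact: near_norm_lt.
Unshelve. all: by end_near. Qed.

(** The excluded slopes are corners of [Ang]: its one-sided derivative is [dTh > 0] from inside and
    0 from outside. *)
Lemma is_derive_comp_Ang (G G' : R -> R) rho :
  (forall t, `|t| <= th0 l -> is_derive t 1 G (G' t)) -> `|rho| != r0 ->
  is_derive rho 1 (fun x => G (Ang x)) (chain G' rho).
Proof.
move=> dG; rewrite neq_lt => /orP[h|h]; rewrite /chain.
  rewrite h; apply: (is_derive1_comp' (is_derive_Ang_in h)).
  exact: dG (Ang_itv rho).
rewrite ltNge (ltW h)/=.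
move: h; rewrite lter_normr orbC => /orP[h|h].
  apply: (is_derive1_near (is_derive1_cst (G (- th0 l)) rho)).
  by near=> x; rewrite Ang_le// ltW//; near: x; apply: lt_nbhsl; rewrite ltrNr.
apply: (is_derive1_near (is_derive1_cst (G (th0 l)) rho)).
by near=> x; rewrite Ang_ge// ltW//; near: x; apply: lt_nbhsr.
Unshelve. all: by end_near. Qed.

Lemma mm_in rho : `|rho| <= r0 -> mm rho = ih l (Ang rho).
Proof.
by move=> h; rewrite /mm -[X in X * _](rr_Ang h) ih_split// D_neq0// Ang_itv.
Qed.

Lemma mm_out rho : r0 <= `|rho| -> mm rho = `|rho|.
Proof.
rewrite lter_normr orbC => /orP[h|h]; rewrite /mm.
  have h' : rho <= - r0 by rewrite lerNr.
  rewrite Ang_le// eeN nnN ee_th0// nn_th0// subr0 mulrN1 ltr0_norm//.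
  by rewrite (le_lt_trans h')// oppr_lt0 r0_gt0.
rewrite Ang_ge// ee_th0// nn_th0// subr0 mulr1 gtr0_norm//.
by rewrite (lt_le_trans r0_gt0).
Qed.

Let is_derive_ihTh v : - r0 <= v <= r0 ->
  is_derive v 1 (fun x => ih l (Th x)) (ee l (Th v)).
Proof.
move=> h; have [h1 h2] := Th_itv h.
apply: (is_derive1_eq (is_derive1_comp' (is_derive_Th h) (is_derive_ih l1 (Th v)))) => //.
rewrite /dTh /ee; field.
have := D_neq0 h1; rewrite ?(gt_eqF (aa_gt0 l1)) ?(gt_eqF (sm_gt0 l1)) ?(gt_eqF (l_cos_gt0 l1 _))//.
by move=> ->.
Qed.

(** The corners of [Ang] do not reach [mm]: at [|rho| = r0] the inner branch [ih] of [Th] has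
    derivative [ee], equal to 1 at [th0] and to -1 at [- th0], as has the outer branch [|rho|]. This
    is why the extension of L is C^1 below the top side. *)
Lemma is_derive_mm rho : is_derive rho 1 mm (ee l (Ang rho)).
Proof.
have rp := r0_gt0.
have [h|h|h] := ltgtP `|rho| r0.
- have h' : - r0 <= rho <= r0 by rewrite -ler_norml ltW.
  rewrite Ang_in ?ltW//; apply: (is_derive1_near (is_derive_ihTh h')).
  near=> x; have xr : `|x| <= r0.
    by rewrite ltW//; near: x; exact: near_norm_lt.
  by rewrite mm_in// Ang_in.
- move: h; rewrite lter_normr orbC => /orP[h|h].
    rewrite Ang_le; last lra.
    rewrite eeN ee_th0//.
    apply: (is_derive1_near (is_derive1N (is_derive1_id rho))).
    near=> x; have xr : x < - r0 by near: x; apply: lt_nbhsl; lra.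
    by rewrite mm_out ?ltr0_norm//; lra.
  rewrite Ang_ge ?ltW// ee_th0//.
  apply: (is_derive1_near (is_derive1_id rho)).
  near=> x; have xr : r0 < x by near: x; apply: lt_nbhsr.
  by rewrite mm_out ?gtr0_norm//; lra.
- have rr0 : - r0 <= r0 <= r0 by rewrite r0N lexx.
  have rr1 : - r0 <= - r0 <= r0 by rewrite r0N lexx.
  have Thr0 : Th r0 = th0 l by rewrite ThK// gtr0_norm.
  have ThNr0 : Th (- r0) = - th0 l by rewrite -rrN ThK// normrN gtr0_norm.
  have [h0|h0] := leP 0 rho.
    move: h; rewrite ger0_norm// => {h0}->.
    rewrite Ang_ge// ee_th0//.
    have d1 := is_derive_ihTh rr0; rewrite Thr0 ee_th0// in d1.
    have e1 : ih l (Th r0) = r0.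
      by rewrite -Ang_in ?ger0_norm ?(ltW rp)// -mm_in ?mm_out// ger0_norm ?(ltW rp).
    apply: (is_derive1_near (is_derive1_glue d1 (is_derive1_id r0) e1)).
    near=> x; have x0 : - r0 < x by near: x; apply: lt_nbhsr; lra.
    case: ifPn => [xr|]; last first.
      by rewrite -ltNge => xr; rewrite mm_out ger0_norm//; lra.
    have xn : `|x| <= r0 by rewrite ler_norml xr ltW.
    by rewrite mm_in// Ang_in.
  have {h h0}-> : rho = - r0 by rewrite -h ltr0_norm// opprK.
  rewrite Ang_le// eeN ee_th0//.
  have d1 := is_derive_ihTh rr1; rewrite ThNr0 eeN ee_th0// in d1.
  have nr : `|- r0| = r0 by rewrite normrN gtr0_norm.
  have e1 : - - r0 = ih l (Th (- r0)).
    by rewrite -Ang_in ?nr// -mm_in ?mm_out ?nr// opprK.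
  apply: (is_derive1_near (is_derive1_glue (is_derive1N (is_derive1_id (- r0))) d1 e1)).
  near=> x; have x0 : x < r0 by near: x; apply: lt_nbhsl; lra.
  case: ifPn => [xr|].
    by rewrite mm_out ler0_norm//; lra.
  rewrite -ltNge => xr; have xn : `|x| <= r0 by rewrite ler_norml !ltW.
  by rewrite mm_in// Ang_in.
Unshelve. all: by end_near. Qed.

Lemma continuous_mm : continuous mm.
Proof. by move=> rho; exact: is_derive1_continuous (is_derive_mm rho). Qed.

Lemma mm_gt0 rho : 0 < mm rho.
Proof.
have [h|h] := leP `|rho| r0.
  by rewrite mm_in// invr_gt0 !mulr_gt0 ?aa_gt0 ?sm_gt0 ?l_cos_gt0.
by rewrite mm_out ?ltW// (lt_trans r0_gt0).
Qed.

Lemma ih_ge t : (aa l * sm l * (l + 1))^-1 <= ih l t.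
Proof.
have a0 := aa_gt0 l1; have s0 := sm_gt0 l1; have lc := l_cos_gt0 l1 t.
have l0 : 0 < l + 1 by rewrite addr_gt0// (lt_trans _ l1).
rewrite lef_pV2 ?posrE ?mulr_gt0//.
by rewrite ler_pM2l ?mulr_gt0// lerD2l cos_le1.
Qed.

(** The bound is the value on the axis, where [cos t = 1]; outside the cone [mm] is at least its
    value on the boundary. *)
Lemma mm_ge rho : (aa l * sm l * (l + 1))^-1 <= mm rho.
Proof.
have [h|h] := leP `|rho| r0; first by rewrite mm_in// ih_ge.
have r00 := r0_gt0; rewrite (mm_out (ltW h)); apply: (le_trans _ (ltW h)).
have -> : r0 = mm r0 by rewrite mm_out gtr0_norm.
by rewrite mm_in ?ih_ge// gtr0_norm.
Qed.

(* Half angles: [sin u - sin t + l sin (u - t) = 2 sin ((u - t)/2) (cos ((u + t)/2) + l cos ((u - t)/2))]. *)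
Let sin_incr t u : 0 <= t -> t <= u -> u <= pi -> 0 <= sin u - sin t + l * sin (u - t).
Proof.
move=> t0 tu upi.
have p0 := pi_gt0 R; pose x := u / 2; pose y := t / 2.
have uE : u = x + x by rewrite /x -splitr.
have tE : t = y + y by rewrite /y -splitr.
have -> : sin u - sin t + l * sin (u - t) = 2 * sin (x - y) * (cos (x + y) + l * cos (x - y)).
  have -> : u - t = (x - y) + (x - y) by rewrite uE tE; ring.
  rewrite uE tE !sinD !cosD sinN cosN.
  have := sin2cos2 x; have := sin2cos2 y; move: (sin x) (cos x) (sin y) (cos y) => a b c d h1 h2.
  by ring: h1 h2.
apply: mulr_ge0.
  rewrite mulr_ge0// sin_ge0_pi//; apply/andP; split; lra.
have cd : 0 <= cos (x - y) by apply: cos_ge0_pihalf; apply/andP; split; lra.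
have cx : 0 <= cos x by apply: cos_ge0_pihalf; apply/andP; split; lra.
have cy : 0 <= cos y by apply: cos_ge0_pihalf; apply/andP; split; lra.
have : 0 <= cos (x + y) + cos (x - y).
  rewrite !cosD sinN cosN.
  have -> : cos x * cos y - sin x * sin y + (cos x * cos y - sin x * - sin y) =
    2 * (cos x * cos y) by ring.
  by rewrite mulr_ge0// mulr_ge0.
have : cos (x - y) <= l * cos (x - y) by rewrite ler_peMl// ltW.
lra.
Qed.

Let sin_le_aaD t : 0 <= t -> t <= th0 l -> sin t <= aa l * D_ l t.
Proof.
move=> t0 tt0; have a0 := aa_gt0 l1; have tpi := th0_ltpi l1.
have l0 : 0 < l by exact: lt_trans l1.
rewrite mulrC -ler_pdivrMr// /aa invrK.
(* [D_ t - sin t * (th0 + l sin th0)] equals [k th0 - k t + (1 + l cos t) * (l - 1 / l)]. The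
   increment of [k] is nonnegative since [k'] is the quantity of [sin_incr]. *)
pose k u := (1 + l * cos t) * - cos u - sin t * (u + l * sin u).
pose k' u := sin u - sin t + l * sin (u - t).
have dk (u : R) : is_derive u 1 k (k' u).
  apply: (is_derive1_eq (is_derive1B
    (is_derive1Z (1 + l * cos t) (is_derive1N (is_derive_cos u)))
    (is_derive1Z (sin t) (is_derive_tls l u)))) => //.
  by rewrite /k' sinB; ring.
have [|c] := @MVT_segment R k k' t (th0 l) tt0.
  by apply: continuous_in_subspaceT => x _; exact: is_derive1_continuous (dk x).
rewrite in_itv/= => /andP[tc ct] kE.
have : 0 <= k (th0 l) - k t.
  by rewrite kE mulr_ge0 ?subr_ge0// sin_incr// (le_trans ct)// ltW.
rewrite /k cos_th0// D_split => h.
have : 0 <= (1 + l * cos t) * (l - l^-1).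
  apply: mulr_ge0; first by rewrite one_l_cos_ge0// ger0_norm.
  by rewrite subr_ge0; apply: (@le_trans _ _ 1); [rewrite invf_le1// ltW|exact: ltW].
move: h; move: (l^-1) (cos t) (sin t) (sin (th0 l)) (th0 l) => li c' s s0 tt.
lra.
Qed.

Lemma ee_le1 t : `|t| <= th0 l -> `|ee l t| <= 1.
Proof.
wlog t0 : t / 0 <= t => [hw tt|].
  have [t0|t0] := leP 0 t; first exact: hw.
  by rewrite -normrN -eeN; apply: hw; rewrite ?normrN// oppr_ge0 ltW.
rewrite ger0_norm// => tt; have a0 := aa_gt0 l1.
have D0 : 0 < D_ l t by rewrite D_gt0// ger0_norm// (le_trans tt)// ltW.
have s0 : 0 <= sin t by rewrite sin_ge0_pi// t0 (le_trans tt)// ltW// th0_ltpi.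
rewrite ger0_norm /ee ?divr_ge0 ?mulr_ge0 ?(ltW a0) ?(ltW D0)//.
by rewrite ler_pdivrMr ?mulr_gt0// mul1r sin_le_aaD.
Qed.

(** The bound is attained at [t = 0], on the axis of the cone; the deficit is
    [(l - 1) (1 - cos t) + t sin t] up to a positive factor. *)
Lemma nn_le t : `|t| <= th0 l -> `|nn l t| <= (aa l * sm l * (l + 1))^-1.
Proof.
move=> tt; have a0 := aa_gt0 l1; have s0 := sm_gt0 l1.
have l0 : 0 < l + 1 by rewrite addr_gt0// (lt_trans _ l1).
have D0 : 0 < D_ l t by rewrite D_gt0// (le_trans tt)// ltW.
have c0 := one_l_cos_ge0 l1 tt.
have ts : 0 <= t * sin t by rewrite mul_sin_ge0// (le_trans tt)// ltW// th0_ltpi.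
have X0 : 0 < aa l * sm l * D_ l t by rewrite !mulr_gt0.
rewrite /nn mulNr normrN ger0_norm; last by rewrite divr_ge0// ltW.
rewrite ler_pdivrMr//.
have -> : (aa l * sm l * (l + 1))^-1 * (aa l * sm l * D_ l t) = D_ l t / (l + 1).
  by field; rewrite !gt_eqF.
rewrite ler_pdivlMr// -subr_ge0.
have -> : D_ l t - (1 + l * cos t) * (l + 1) = (l - 1) * (1 - cos t) + t * sin t.
  by rewrite /D_; ring.
by rewrite addr_ge0// mulr_ge0 ?subr_ge0 ?cos_le1// ltW.
Qed.

End Angle.

(** * The extension of L and its derivatives *)

Section PlaneFunctions.
Context {R : realType}.
Variable l : R.
Hypothesis l1 : 1 < l.
Implicit Types (p : R * R) (y z rho : R).

(* [Lt] extends [L] to the plane by [`|y|], and its square [PP] is C^1 with gradient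
   [(Py, Pz)], also across the boundary of the cone and at the origin. The field
   [(Fq1, Fq2)] is [|z| q]. [Pyy], [Pzz], [Fq1y] and [Fq2z] are the corresponding
   derivatives, valid only off the boundary of the cone. *)
Definition slope p : R := p.1 / - p.2.
Definition ang p : R := Ang l (slope p).
Definition Lt p : R :=
  if p.2 < 0 then p.1 * ee l (ang p) + p.2 * nn l (ang p) else `|p.1|.
Definition PP p : R := Lt p ^+ 2.
Definition Py p : R := if p.2 < 0 then 2 * Lt p * ee l (ang p) else 2 * p.1.
Definition Pz p : R := if p.2 < 0 then 2 * Lt p * nn l (ang p) else 0.
Definition Fq1 p : R := if p.2 < 0 then - p.2 * Q1 l (ang p) else 0.
Definition Fq2 p : R := if p.2 < 0 then - p.2 * Q2 l (ang p) else 0.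

Definition EE rho : R := chain l (ee' l) rho.
Definition dQ1 t : R := - (sm l * (1 + l * cos t)) / (l + cos t) ^+ 2.
Definition dQ2 t : R := - ((l ^+ 2 - 1) * sin t) / (l + cos t) ^+ 2.
Definition Pyy p : R := 2 * ee l (ang p) ^+ 2 + 2 * mm l (slope p) * EE (slope p).
Definition Pzz p : R :=
  2 * nn l (ang p) ^+ 2 + 2 * mm l (slope p) * slope p ^+ 2 * EE (slope p).
Definition Fq1y p : R := chain l dQ1 (slope p).
Definition Fq2z p : R := - Q2 l (ang p) + slope p * chain l dQ2 (slope p).

Lemma Lt_mm p : p.2 < 0 -> Lt p = - p.2 * mm l (slope p).
Proof.
move=> p2; rewrite /Lt p2 /mm /slope /ang /slope; have p20 : p.2 != 0 by rewrite lt_eqF.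
by field.
Qed.

Lemma Lt_gt0 p : p.2 < 0 -> 0 < Lt p.
Proof. by move=> p2; rewrite Lt_mm// mulr_gt0 ?mm_gt0// oppr_gt0. Qed.

Lemma Lt_ge0 p : 0 <= Lt p.
Proof.
by have [/Lt_gt0/ltW//|p2] := ltP p.2 0; rewrite /Lt ltNge p2 normr_ge0.
Qed.

Lemma slope_norm p : p.2 < 0 -> `|slope p| = `|p.1| / - p.2.
Proof. by move=> p2; rewrite /slope normrM normfV normrN (ltr0_norm p2). Qed.

Lemma slope_ge p : p.2 < 0 -> (r0 l <= `|slope p|) = (- r0 l * p.2 <= `|p.1|).
Proof. by move=> p2; rewrite slope_norm// ler_pdivlMr ?oppr_gt0// mulrN mulNr. Qed.

Lemma slope_lt p : p.2 < 0 -> (`|slope p| < r0 l) = (`|p.1| < - r0 l * p.2).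
Proof. by move=> p2; rewrite !ltNge slope_ge. Qed.

Lemma Lt_out p : - r0 l * p.2 <= `|p.1| -> Lt p = `|p.1|.
Proof.
have [p2|p2] := ltP p.2 0; last by rewrite /Lt ltNge p2.
move=> h; rewrite Lt_mm// mm_out ?slope_ge// slope_norm// mulrC divfK//.
by rewrite oppr_eq0 lt_eqF.
Qed.

Lemma ang_out p : p.2 < 0 -> - r0 l * p.2 <= `|p.1| ->
  ang p = if 0 <= p.1 then th0 l else - th0 l.
Proof.
move=> p2; rewrite -slope_ge// lter_normr => /orP[h|h]; rewrite /ang.
  rewrite Ang_ge//; case: ifPn => //; rewrite -ltNge => p1.
  have : slope p < 0 by rewrite pmulr_llt0// invr_gt0 oppr_gt0.
  by move/(le_lt_trans h); rewrite ltNge (ltW (r0_gt0 l1)).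
rewrite Ang_le//; last by rewrite lerNr.
case: ifPn => // p1.
have : 0 <= slope p by rewrite mulr_ge0// invr_ge0 oppr_ge0 ltW.
by move=> sp; have := lt_le_trans (r0_gt0 l1) h; rewrite oppr_gt0 ltNge sp.
Qed.

Lemma Py_out p : - r0 l * p.2 <= `|p.1| -> Py p = 2 * p.1.
Proof.
move=> h; rewrite /Py; case: ifPn => // p2.
rewrite Lt_out// ang_out//; case: (leP 0 p.1) => p1.
  by rewrite ee_th0// mulr1 ger0_norm.
by rewrite eeN ee_th0// ltr0_norm// mulrN1 mulrN opprK.
Qed.

Lemma Pz_out p : - r0 l * p.2 <= `|p.1| -> Pz p = 0.
Proof.
move=> h; rewrite /Pz; case: ifPn => // p2.
by rewrite Lt_out// ang_out//; case: ifP => _; rewrite ?nnN nn_th0// mulr0.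
Qed.

Lemma ee_ang_le1 p : `|ee l (ang p)| <= 1.
Proof. by apply: ee_le1 => //; exact: Ang_itv. Qed.

(** Equal to [(1 - l) / K_ l], the number whose square appears in [C_ l]. It is also the value of L
    at [(0, -1)]. *)
Definition nmax : R := (aa l * sm l * (l + 1))^-1.

Lemma nmax_gt0 : 0 < nmax.
Proof.
by rewrite invr_gt0 !mulr_gt0 ?aa_gt0 ?sm_gt0// addr_gt0// (lt_trans _ l1).
Qed.

Lemma nn_ang_le p : `|nn l (ang p)| <= nmax.
Proof. by apply: nn_le => //; exact: Ang_itv. Qed.

Lemma Lt_le p : Lt p <= (1 + nmax) * (`|p.1| + `|p.2|).
Proof.
have n0 := nmax_gt0.
have h : `|p.1| + nmax * `|p.2| <= (1 + nmax) * (`|p.1| + `|p.2|).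
  have := normr_ge0 p.1; have := normr_ge0 p.2; move: `|p.1| `|p.2| => u v; nra.
rewrite (le_trans _ h)// /Lt; case: ifPn => _; last first.
  by rewrite lerDl mulr_ge0// ltW.
rewrite (le_trans (ler_norm _))// (le_trans (ler_normD _ _))// (normrM p.1) (normrM p.2) lerD//.
  by apply: ler_piMr => //; exact: ee_ang_le1.
by rewrite mulrC; apply: ler_wpM2r => //; exact: nn_ang_le.
Qed.

Lemma continuous_slope p : p.2 < 0 -> {for p, continuous slope}.
Proof.
move=> p2; rewrite /slope; apply: cvgM; first exact: cvg_fst.
apply: cvgV; first by rewrite oppr_eq0 lt_eqF.
by apply: cvgN; exact: cvg_snd.
Qed.

Lemma continuous_at_slope (G : R -> R) p : p.2 < 0 ->
  {for slope p, continuous G} -> {for p, continuous (fun q => G (slope q))}.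
Proof.
by move=> p2 cG; apply: (continuous_comp (continuous_slope p2)).
Qed.

Lemma continuous_at_ang (G : R -> R) p : p.2 < 0 ->
  {for ang p, continuous G} -> {for p, continuous (fun q => G (ang q))}.
Proof.
move=> p2 cG; apply: (@continuous_at_slope (fun r => G (Ang l r))) => //.
by apply: continuous_comp => //; exact: continuous_Ang.
Qed.

Lemma near_snd_lt0 p : p.2 < 0 -> \forall q \near p, q.2 < 0.
Proof.
move=> p2; have : (fun q : R * R => q.2) @ p --> p.2 by exact: cvg_snd.
by move=> /cvgr_lt /(_ _ p2).
Qed.

Lemma near_eq_continuous (f g : R * R -> R) p :
  (\forall q \near p, f q = g q) -> {for p, continuous f} -> {for p, continuous g}.
Proof.
move=> fg cf; rewrite /prop_for /continuous_at -(nbhs_singleton fg).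
by apply: cvg_trans cf; exact: (near_eq_cvg fg).
Qed.

Lemma ee_ang_continuous p : p.2 < 0 -> {for p, continuous (fun q => ee l (ang q))}.
Proof.
move=> p2; apply: continuous_at_ang => //.
by apply: is_derive1_continuous (is_derive_ee _ _) => //; apply: D_neq0 => //; exact: Ang_itv.
Qed.

Lemma nn_ang_continuous p : p.2 < 0 -> {for p, continuous (fun q => nn l (ang q))}.
Proof.
move=> p2; apply: continuous_at_ang => //.
by apply: is_derive1_continuous (is_derive_nn _ _) => //; apply: D_neq0 => //; exact: Ang_itv.
Qed.

Lemma Q1_ang_continuous p : p.2 < 0 -> {for p, continuous (fun q => Q1 l (ang q))}.
Proof.
by move=> p2; apply: continuous_at_ang => //; exact: is_derive1_continuous (is_derive_Q1 l1 _).
Qed.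

Lemma Q2_ang_continuous p : p.2 < 0 -> {for p, continuous (fun q => Q2 l (ang q))}.
Proof.
by move=> p2; apply: continuous_at_ang => //; exact: is_derive1_continuous (is_derive_Q2 l1 _).
Qed.

Let Lt_continuous_lt0 p : p.2 < 0 -> {for p, continuous Lt}.
Proof.
move=> p2; apply: (@near_eq_continuous (fun q => q.1 * ee l (ang q) + q.2 * nn l (ang q))).
  by near=> q; rewrite /Lt ifT//; near: q; exact: near_snd_lt0.
apply: cvgD; apply: cvgM.
- exact: cvg_fst.
- exact: ee_ang_continuous.
- exact: cvg_snd.
- exact: nn_ang_continuous.
Unshelve. all: by end_near. Qed.

(* The half plane [z < 0], the complement of the closed cone and the origin cover the plane. *)
Let continuous_glue (F g : R * R -> R) (C : R) :
  (forall p, p.2 < 0 -> {for p, continuous F}) ->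
  continuous g -> (forall p, - r0 l * p.2 <= `|p.1| -> F p = g p) ->
  (forall p, `|F p| <= C * (`|p.1| + `|p.2|)) -> continuous F.
Proof.
move=> cF cg Fg FC p; have [p2|p2] := ltP p.2 0; first exact: cF.
have [hp|hp] := ltP (- r0 l * p.2) `|p.1|.
  apply: (near_eq_continuous _ (cg p)).
  have : (fun q : R * R => `|q.1| - - r0 l * q.2) @ p --> `|p.1| - - r0 l * p.2.
    apply: cvgB; first by apply: cvg_norm; exact: cvg_fst.
    by apply: cvgM; [exact: cvg_cst|exact: cvg_snd].
  move=> /cvgr_gt; move: hp; rewrite -subr_gt0 => hp /(_ _ hp).
  by apply: filterS => q; rewrite subr_gt0 => /ltW /Fg.
have p1 : p.1 = 0.
  apply/eqP; rewrite -normr_eq0 eq_le normr_ge0 andbT (le_trans hp)//.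
  by rewrite mulNr oppr_le0 mulr_ge0// ltW// r0_gt0.
have {}p2 : p.2 = 0.
  apply/eqP; rewrite eq_le p2 andbT; move: hp; rewrite p1 normr0 mulNr oppr_ge0.
  by rewrite pmulr_rle0// r0_gt0.
have F0 : F p = 0.
  by apply/eqP; rewrite -normr_le0; have := FC p; rewrite p1 p2 normr0 addr0 mulr0.
rewrite /continuous_at F0; apply/norm_cvg0P.
apply: (@squeeze_cvgr _ _ _ _ (fun=> 0) (fun q => C * (`|q.1| + `|q.2|))).
- by apply: nearW => q; rewrite normr_ge0 FC.
- exact: cvg_cst.
- have -> : 0 = C * (`|p.1| + `|p.2|) by rewrite p1 p2 normr0 addr0 mulr0.
  apply: cvgM; first exact: cvg_cst.
  by apply: cvgD; apply: cvg_norm; [exact: cvg_fst|exact: cvg_snd].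
Qed.

Lemma continuous_Lt : continuous Lt.
Proof.
apply: (@continuous_glue _ (fun p => `|p.1|) (1 + nmax)).
- exact: Lt_continuous_lt0.
- by move=> p; apply: cvg_norm; exact: cvg_fst.
- by move=> p; exact: Lt_out.
- by move=> p; rewrite ger0_norm ?Lt_ge0// Lt_le.
Qed.

Lemma continuous_PP : continuous PP.
Proof. by move=> p; apply: cvgM; exact: continuous_Lt. Qed.

Lemma continuous_Py : continuous Py.
Proof.
have n0 := nmax_gt0.
apply: (@continuous_glue _ (fun p => 2 * p.1) (2 * (1 + nmax))).
- move=> p p2; apply: (@near_eq_continuous (fun q => 2 * Lt q * ee l (ang q))).
    by near=> q; rewrite /Py ifT//; near: q; exact: near_snd_lt0.
  apply: cvgM; last exact: ee_ang_continuous.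
  by apply: cvgM; [exact: cvg_cst|exact: continuous_Lt].
- by move=> p; apply: cvgM; [exact: cvg_cst|exact: cvg_fst].
- by move=> p; exact: Py_out.
- move=> p; rewrite /Py; case: ifPn => _.
    rewrite normrM -mulrA normrM ger0_norm// -mulrA.
    rewrite ler_pM2l// (le_trans _ (Lt_le p))// ger0_norm ?Lt_ge0// ler_piMr ?Lt_ge0//.
    exact: ee_ang_le1.
  rewrite normrM ger0_norm// -mulrA ler_pM2l//.
  have := normr_ge0 p.1; have := normr_ge0 p.2; move: `|p.1| `|p.2| => u v; nra.
Unshelve. all: by end_near. Qed.

Lemma continuous_Pz : continuous Pz.
Proof.
have n0 := nmax_gt0.
apply: (@continuous_glue _ (fun p => 0) (2 * (1 + nmax) * nmax)).
- move=> p p2; apply: (@near_eq_continuous (fun q => 2 * Lt q * nn l (ang q))).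
    by near=> q; rewrite /Pz ifT//; near: q; exact: near_snd_lt0.
  apply: cvgM; last exact: nn_ang_continuous.
  by apply: cvgM; [exact: cvg_cst|exact: continuous_Lt].
- by move=> p; exact: cvg_cst.
- by move=> p; exact: Pz_out.
- move=> p; rewrite /Pz; case: ifPn => _; last first.
    by rewrite normr0 !mulr_ge0 ?addr_ge0// ltW.
  have -> : 2 * (1 + nmax) * nmax * (`|p.1| + `|p.2|) =
    2 * ((1 + nmax) * (`|p.1| + `|p.2|)) * nmax by ring.
  rewrite normrM; apply: ler_pM => //; last exact: nn_ang_le.
  rewrite normrM ger0_norm// ler_pM2l// ger0_norm ?Lt_ge0//.
  exact: Lt_le.
Unshelve. all: by end_near. Qed.

Let continuous_halfplane (F : R * R -> R) :
  (forall p, p.2 < 0 -> {for p, continuous F}) ->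
  (forall p, 0 <= p.2 -> F p = 0) ->
  (forall p, `|F p| <= `|p.2|) -> continuous F.
Proof.
move=> cF F0 FC p; have [p2|p2] := ltP p.2 0; first exact: cF.
move: p2; rewrite le_eqVlt => /predU1P[p2|p2].
  rewrite /continuous_at F0 -?p2//; apply/norm_cvg0P.
  apply: (@squeeze_cvgr _ _ _ _ (fun=> 0) (fun q => `|q.2|)).
  - by apply: nearW => q; rewrite normr_ge0 FC.
  - exact: cvg_cst.
  - have -> : 0 = `|p.2| by rewrite -p2 normr0.
    by apply: cvg_norm; exact: cvg_snd.
apply: (@near_eq_continuous (fun=> 0)); last exact: cvg_cst.
have : (fun q : R * R => q.2) @ p --> p.2 by exact: cvg_snd.
by move=> /cvgr_gt /(_ _ p2); apply: filterS => q /ltW /F0.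
Qed.

Lemma Q_ang_le1 p : `|Q1 l (ang p)| <= 1 /\ `|Q2 l (ang p)| <= 1.
Proof.
have h := Q12 l1 (ang p); have s1 := sqr_ge0 (Q1 l (ang p)); have s2 := sqr_ge0 (Q2 l (ang p)).
by split; rewrite -(@ler_pXn2r _ 2) ?nnegrE// expr1n real_normK ?num_real//; lra.
Qed.

Lemma continuous_Fq1 : continuous Fq1.
Proof.
apply: continuous_halfplane => p.
- move=> p2; apply: (@near_eq_continuous (fun q => - q.2 * Q1 l (ang q))).
    by near=> q; rewrite /Fq1 ifT//; near: q; exact: near_snd_lt0.
  apply: cvgM; last exact: Q1_ang_continuous.
  by apply: cvgN; exact: cvg_snd.
- by move=> p2; rewrite /Fq1 ltNge p2.
- rewrite /Fq1; case: ifP => _; last by rewrite normr0.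
  by rewrite normrM normrN ler_piMr// (Q_ang_le1 p).1.
Unshelve. all: by end_near. Qed.

Lemma continuous_Fq2 : continuous Fq2.
Proof.
apply: continuous_halfplane => p.
- move=> p2; apply: (@near_eq_continuous (fun q => - q.2 * Q2 l (ang q))).
    by near=> q; rewrite /Fq2 ifT//; near: q; exact: near_snd_lt0.
  apply: cvgM; last exact: Q2_ang_continuous.
  by apply: cvgN; exact: cvg_snd.
- by move=> p2; rewrite /Fq2 ltNge p2.
- rewrite /Fq2; case: ifP => _; last by rewrite normr0.
  by rewrite normrM normrN ler_piMr// (Q_ang_le1 p).2.
Unshelve. all: by end_near. Qed.

End PlaneFunctions.

(** * Partial derivatives of L^2 and of the field |z| q *)

Section SliceDerivatives.
Context {R : realType}.
Variable l : R.
Hypothesis l1 : 1 < l.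
Implicit Types (p : R * R) (y z rho : R).

Lemma is_derive_slope_y y z : is_derive y 1 (fun t => slope (t, z)) (- z)^-1.
Proof.
apply: (is_derive1_eq (is_derive1M (is_derive1_id y) (is_derive1_cst (- z)^-1 y))) => //.
by rewrite mul1r mulr0 addr0.
Qed.

Lemma is_derive_slope_z y z : z < 0 ->
  is_derive z 1 (fun t => slope (y, t)) (slope (y, z) / - z).
Proof.
move=> z0; have zN : - z != 0 by rewrite oppr_eq0 lt_eqF.
apply: (is_derive1_eq (is_derive1_div (is_derive1_cst y z) (is_derive1N (is_derive1_id z)) zN)) => //.
rewrite /slope /=; field.
by rewrite lt_eqF.
Qed.

Let near_lt0 z : z < 0 -> \forall t \near z, t < 0.
Proof. by move=> z0; exact: lt_nbhsl. Qed.

Lemma is_derive_Lt_y y z : z < 0 ->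
  is_derive y 1 (fun t => Lt l (t, z)) (ee l (ang l (y, z))).
Proof.
move=> z0; have zN : - z != 0 by rewrite oppr_eq0 lt_eqF.
apply: (is_derive1_eq (is_derive1Z (- z)
  (is_derive1_comp' (is_derive_slope_y y z) (is_derive_mm l1 (slope (y, z)))))).
- by move=> t; rewrite Lt_mm.
- by rewrite /ang; field; rewrite lt_eqF.
Qed.

Lemma is_derive_Lt_z y z : z < 0 ->
  is_derive z 1 (fun t => Lt l (y, t)) (nn l (ang l (y, z))).
Proof.
move=> z0; have zN : - z != 0 by rewrite oppr_eq0 lt_eqF.
have d := is_derive1M (is_derive1N (is_derive1_id z))
  (is_derive1_comp' (is_derive_slope_z y z0) (is_derive_mm l1 (slope (y, z)))).
have d' : is_derive z 1 (fun t => - t * mm l (slope (y, t))) (nn l (ang l (y, z))).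
  by apply: (is_derive1_eq d) => //; rewrite /mm /ang /=; field; rewrite lt_eqF.
apply: (is_derive1_near d'); near=> t; rewrite Lt_mm//=.
by near: t; exact: near_lt0.
Unshelve. all: by end_near. Qed.

Lemma is_derive_PP_y y z : is_derive y 1 (fun t => PP l (t, z)) (Py l (y, z)).
Proof.
have [z0|z0] := ltP z 0.
  have d := is_derive_Lt_y y z0.
  apply: (is_derive1_eq (is_derive1M d d)); first by move=> t; rewrite /PP expr2.
  by rewrite /Py /= z0; ring.
apply: (is_derive1_eq (is_derive1M (is_derive1_id y) (is_derive1_id y))).
  by move=> t; rewrite /PP /Lt /= ltNge z0 /= real_normK ?num_real// expr2.
by rewrite /Py /= ltNge z0 /=; ring.
Qed.

Lemma is_derive_PP_z y z : is_derive z 1 (fun t => PP l (y, t)) (Pz l (y, z)).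
Proof.
have rp := r0_gt0 l1.
have cst0 : (forall t, - r0 l * t <= `|y| -> PP l (y, t) = y ^+ 2).
  by move=> t h; rewrite /PP Lt_out//= real_normK ?num_real.
have [z0|z0] := ltP z 0.
  have d := is_derive_Lt_z y z0.
  apply: (is_derive1_eq (is_derive1M d d)); first by move=> t; rewrite /PP expr2.
  by rewrite /Pz /= z0; ring.
rewrite /Pz /= ltNge z0 /=.
have [h|h] := ltP (- r0 l * z) `|y|.
  apply: (is_derive1_near (is_derive1_cst (y ^+ 2) z)); near=> t; rewrite cst0// ltW//.
  rewrite mulNr -ltrN2 opprK mulrC -ltr_pdivrMr//.
  near: t; apply: lt_nbhsr.
  by rewrite ltr_pdivrMr// mulrC -ltrN2 opprK -mulNr.
have y0 : y = 0.
  apply/eqP; rewrite -normr_eq0 eq_le normr_ge0 andbT (le_trans h)//.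
  by rewrite mulNr oppr_le0 mulr_ge0// ltW.
have {}z0 : z = 0.
  apply/eqP; rewrite eq_le z0 andbT; move: h; rewrite y0 normr0 mulNr oppr_ge0.
  by rewrite pmulr_rle0.
(* Only the origin is left. On the vertical axis L^2 is [k t^2] below it and 0 above, and both
   branches are flat at 0. *)
rewrite y0 z0; pose k := nn l (Ang l 0) ^+ 2.
have d1 : is_derive (0 : R) 1 (fun t => k * (t * t)) 0.
  apply: (is_derive1_eq (is_derive1Z k (is_derive1M (is_derive1_id 0) (is_derive1_id 0)))) => //.
  by ring.
have e : k * (0 * 0) = (fun=> 0 : R) (0 : R) by rewrite !mulr0.
apply: (is_derive1_near (is_derive1_glue d1 (is_derive1_cst 0 0) e)).
near=> t.
rewrite /PP /Lt /=; case: (ltgtP t 0) => t0.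
- by rewrite /ang /slope /= !mul0r add0r /k; ring.
- by rewrite normr0 expr0n.
- by rewrite t0 normr0 expr0n !mulr0.
Unshelve. all: by end_near. Qed.

(* Where a horizontal, resp. vertical, line meets the boundary of the cone. *)
Definition kink_y z : seq R := [:: r0 l * - z; - (r0 l * - z)].
Definition kink_z y : seq R := [:: - (`|y| / r0 l)].

Let kink_yP y z : z < 0 -> y \notin kink_y z -> `|slope (y, z)| != r0 l.
Proof.
move=> z0; apply: contraNneq => h; rewrite !inE.
have E : `|y| = r0 l * - z.
  by rewrite -h slope_norm//= divfK// oppr_eq0 lt_eqF.
by rewrite -E; case: (ger0P y) => _; rewrite ?opprK eqxx ?orbT.
Qed.

Let kink_zP y z : z < 0 -> z \notin kink_z y -> `|slope (y, z)| != r0 l.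
Proof.
move=> z0; apply: contraNneq => h; rewrite !inE.
have [y0|y0] := eqVneq y 0.
  by move: (r0_gt0 l1); rewrite -h /slope y0 /= mul0r normr0 ltxx.
rewrite -h slope_norm//= invf_div.
by rewrite mulrC divfK ?opprK// normr_eq0.
Qed.

Lemma chain_nn rho : chain l (fun t => rr l t * ee' l t) rho = rho * EE l rho.
Proof.
rewrite /EE /chain; case: ifPn => [h|_]; last by rewrite mulr0.
by rewrite rr_Ang ?ltW// mulrA.
Qed.

Lemma is_derive_ee_Ang rho : `|rho| != r0 l -> is_derive rho 1 (fun x => ee l (Ang l x)) (EE l rho).
Proof.
by apply: is_derive_comp_Ang => // t tt; apply: is_derive_ee => //; exact: D_neq0.
Qed.

Lemma is_derive_nn_Ang rho : `|rho| != r0 l ->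
  is_derive rho 1 (fun x => nn l (Ang l x)) (rho * EE l rho).
Proof.
rewrite -chain_nn.
by apply: is_derive_comp_Ang => // t tt; apply: is_derive_nn => //; exact: D_neq0.
Qed.

Lemma is_derive_Py_y y z : z < 0 -> y \notin kink_y z ->
  is_derive y 1 (fun t => Py l (t, z)) (Pyy l (y, z)).
Proof.
move=> z0 /(kink_yP z0) h; have zN : - z != 0 by rewrite oppr_eq0 lt_eqF.
have d1 := is_derive_Lt_y y z0.
have d2 := is_derive1_comp' (is_derive_slope_y y z) (is_derive_ee_Ang h).
apply: (is_derive1_eq (is_derive1M (is_derive1Z 2 d1) d2)).
  by move=> t; rewrite /Py /= z0.
rewrite Lt_mm// /Pyy /ang /=; field; by rewrite lt_eqF.
Qed.

Lemma is_derive_Pz_z y z : z < 0 -> z \notin kink_z y ->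
  is_derive z 1 (fun t => Pz l (y, t)) (Pzz l (y, z)).
Proof.
move=> z0 /(kink_zP z0) h; have zN : - z != 0 by rewrite oppr_eq0 lt_eqF.
have d1 := is_derive_Lt_z y z0.
have d2 := is_derive1_comp' (is_derive_slope_z y z0) (is_derive_nn_Ang h).
have d := is_derive1M (is_derive1Z 2 d1) d2.
have d' : is_derive z 1 (fun t => 2 * Lt l (y, t) * nn l (ang l (y, t))) (Pzz l (y, z)).
  apply: (is_derive1_eq d) => //.
  by rewrite Lt_mm// /Pzz /ang /=; field; rewrite lt_eqF.
apply: (is_derive1_near d'); near=> t; rewrite /Pz /= ifT//.
by near: t; exact: near_lt0.
Unshelve. all: by end_near. Qed.

Lemma is_derive_Fq1_y y z : z < 0 -> y \notin kink_y z ->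
  is_derive y 1 (fun t => Fq1 l (t, z)) (Fq1y l (y, z)).
Proof.
move=> z0 /(kink_yP z0) h; have zN : - z != 0 by rewrite oppr_eq0 lt_eqF.
have d := is_derive_comp_Ang l1 (fun t _ => is_derive_Q1 l1 t) h.
apply: (is_derive1_eq (is_derive1Z (- z) (is_derive1_comp' (is_derive_slope_y y z) d))).
  by move=> t; rewrite /Fq1 /= z0.
by rewrite /Fq1y /=; field; rewrite lt_eqF.
Qed.

Lemma is_derive_Fq2_z y z : z < 0 -> z \notin kink_z y ->
  is_derive z 1 (fun t => Fq2 l (y, t)) (Fq2z l (y, z)).
Proof.
move=> z0 /(kink_zP z0) h; have zN : - z != 0 by rewrite oppr_eq0 lt_eqF.
have d1 := is_derive_comp_Ang l1 (fun t _ => is_derive_Q2 l1 t) h.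
have d := is_derive1M (is_derive1N (is_derive1_id z)) (is_derive1_comp' (is_derive_slope_z y z0) d1).
have d' : is_derive z 1 (fun t => - t * Q2 l (ang l (y, t))) (Fq2z l (y, z)).
  by apply: (is_derive1_eq d) => //; rewrite /Fq2z /ang /=; field; rewrite lt_eqF.
apply: (is_derive1_near d'); near=> t; rewrite /Fq2 /= ifT//.
by near: t; exact: near_lt0.
Unshelve. all: by end_near. Qed.

Lemma div_q p : Fq1y l p + Fq2z l p = if `|slope p| < r0 l then - l else - Q2 l (ang l p).
Proof.
rewrite /Fq1y /Fq2z /chain; case: ifPn => [h|_]; last by rewrite mulr0 addr0 add0r.
rewrite -[X in _ + X * _](rr_Ang l1 (ltW h)) -/(ang l p).
have D0 : D_ l (ang l p) != 0 by apply: D_neq0 => //; exact: Ang_itv.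
have lc : l + cos (ang l p) != 0 by rewrite gt_eqF// l_cos_gt0.
have s0 : sm l != 0 by rewrite gt_eqF// sm_gt0.
rewrite /dQ1 /dQ2 /dTh /Q2 /rr -/(ang l p); move: D0; rewrite D_split => D0.
have := sm2 l1 => s2.
by field: s2; rewrite D0 lc s0.
Qed.

(** [Q2 <= l] amounts to [l^2 >= 1], so the two branches of [div_q] obey the same bound. *)
Lemma div_q_ge p : - l <= Fq1y l p + Fq2z l p.
Proof.
rewrite div_q; case: ifPn => // _; rewrite lerN2.
have h : 0 < l + cos (ang l p) by exact: l_cos_gt0.
rewrite /Q2 ler_pdivrMr// -subr_ge0.
have -> : l * (l + cos (ang l p)) - (1 + l * cos (ang l p)) = l ^+ 2 - 1 by ring.
by rewrite subr_ge0 ltW// exprn_egt1.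
Qed.

Lemma dTh_bound t : `|t| <= th0 l -> 0 <= dTh l t <= sm l * (l + 1) ^+ 2 / ((l ^+ 2 - 1) / l).
Proof.
move=> tt; have l0 : 0 < l by exact: lt_trans l1.
have m0 : 0 < (l ^+ 2 - 1) / l by rewrite divr_gt0// subr_gt0 exprn_egt1.
have D0 := D_ge l1 tt; have h := l_cos_gt0 l1 t; have s0 := sm_gt0 l1.
have Dp : 0 < D_ l t by exact: lt_le_trans D0.
rewrite /dTh divr_ge0 ?mulr_ge0 ?sqr_ge0 ?(ltW s0) ?(ltW Dp) ?(ltW h)//=.
apply: ler_pM; rewrite ?mulr_ge0 ?sqr_ge0 ?invr_ge0 ?(ltW s0) ?(ltW Dp) ?(ltW h)//.
  rewrite ler_pM2l// ler_pXn2r ?nnegrE ?(ltW h) ?addr_ge0 ?(ltW l0)//.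
  by rewrite lerD2l cos_le1.
by rewrite lef_pV2 ?posrE.
Qed.

Lemma chain_bound (G' : R -> R) M : (forall t, `|t| <= th0 l -> `|G' t| <= M) ->
  exists M', forall rho, `|chain l G' rho| <= M'.
Proof.
move=> GM; exists (M * (sm l * (l + 1) ^+ 2 / ((l ^+ 2 - 1) / l))) => rho.
have tt := Ang_itv l1 rho; have /andP[d0 d1] := dTh_bound tt.
have M0 : 0 <= M by apply: le_trans (GM _ tt).
rewrite /chain; case: ifPn => _; last by rewrite normr0 mulr_ge0// (le_trans d0).
by rewrite normrM ler_pM ?GM// ger0_norm.
Qed.

Lemma EE_bound : exists M, forall rho, `|EE l rho| <= M.
Proof.
have l0 : 0 < l by exact: lt_trans l1.
have m0 : 0 < (l ^+ 2 - 1) / l by rewrite divr_gt0// subr_gt0 exprn_egt1.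
have a0 := aa_gt0 l1.
apply: (@chain_bound _ ((l + 1) ^+ 2 / (aa l * ((l ^+ 2 - 1) / l) ^+ 2))) => t tt.
have D0 := D_ge l1 tt; have h := l_cos_gt0 l1 t.
have Dp : 0 < D_ l t by exact: lt_le_trans D0.
rewrite ger0_norm; last by rewrite divr_ge0 ?sqr_ge0// mulr_ge0 ?sqr_ge0// ltW.
apply: ler_pM; rewrite ?sqr_ge0 ?invr_ge0 ?mulr_ge0 ?sqr_ge0 ?(ltW a0) ?(ltW h) ?(ltW Dp)//.
  rewrite ler_pXn2r ?nnegrE ?(ltW h) ?addr_ge0 ?(ltW l0)//.
  by rewrite lerD2l cos_le1.
rewrite lef_pV2 ?posrE; [|by rewrite pmulr_rgt0// exprn_gt0..].
by rewrite ler_pM2l// ler_pXn2r// ?nnegrE ?(ltW m0) ?(ltW Dp).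
Qed.

(** [mm] and [rho] grow without bound, but [EE] vanishes for [|rho| >= r0], so only slopes inside
    the cone count. *)
Lemma mm_EE_bound : exists2 M, 0 <= M & forall rho, `|mm l rho * EE l rho| <= M /\
  `|mm l rho * rho ^+ 2 * EE l rho| <= M.
Proof.
have [M hM] := EE_bound; have rp := r0_gt0 l1; have n0 := nmax_gt0 l1.
have M0 : 0 <= M by apply: le_trans (hM 0).
pose B := (r0 l + nmax l) * (1 + r0 l ^+ 2) * M.
have B0 : 0 <= B by rewrite !mulr_ge0// ?addr_ge0 ?ltW// exprn_gt0.
exists B => // rho; have [h|h] := ltP `|rho| (r0 l); last first.
  by rewrite /EE /chain ltNge h /= !mulr0 normr0.
have mB : `|mm l rho| <= r0 l + nmax l.
  rewrite /mm (le_trans (ler_normB _ _))// lerD//; last first.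
    by apply: nn_le => //; exact: Ang_itv.
  rewrite normrM -[leRHS]mulr1 ler_pM ?(ltW h)//.
  by apply: ee_le1 => //; exact: Ang_itv.
have r2 : `|rho ^+ 2| <= r0 l ^+ 2.
  by rewrite normrX ler_pXn2r// ?nnegrE ?(ltW h) ?(ltW rp).
have c1 : 0 <= r0 l + nmax l by exact: le_trans mB.
have c2 := sqr_ge0 (r0 l).
split; rewrite /B.
  rewrite normrM; apply: ler_pM => //; apply: (le_trans mB); rewrite ler_peMr//; lra.
rewrite (normrM (mm l rho * rho ^+ 2)) (normrM (mm l rho)).
apply: ler_pM; rewrite ?mulr_ge0//.
by apply: ler_pM => //; apply: (le_trans r2); lra.
Qed.

Lemma Pyy_bound : exists M, forall p, `|Pyy l p| <= M.
Proof.
have [M M0 hM] := mm_EE_bound; exists (2 + 2 * M) => p.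
have [h _] := hM (slope p); have e1 := ee_ang_le1 l1 p.
rewrite /Pyy (le_trans (ler_normD _ _))//; apply: lerD.
  by rewrite normrM normrX ger0_norm// -[leRHS]mulr1 ler_pM2l// expr_le1.
by rewrite -mulrA normrM ger0_norm// ler_pM2l.
Qed.

Lemma Pzz_bound : exists M, forall p, `|Pzz l p| <= M.
Proof.
have [M M0 hM] := mm_EE_bound; exists (2 * nmax l ^+ 2 + 2 * M) => p.
have [_ h] := hM (slope p); have e1 := nn_ang_le l1 p.
rewrite /Pzz (le_trans (ler_normD _ _))//; apply: lerD.
  rewrite normrM normrX ger0_norm// ler_pM2l// ler_pXn2r ?nnegrE//.
  by rewrite ltW// nmax_gt0.
by rewrite -[2 * _ * _]mulrA -mulrA normrM ger0_norm// ler_pM2l.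
Qed.

Lemma Fq1y_bound : exists M, forall p, `|Fq1y l p| <= M.
Proof.
have l0 : 0 < l by exact: lt_trans l1.
have lm : 0 < l - 1 by rewrite subr_gt0.
suff [M hM] : exists M, forall rho, `|chain l (dQ1 l) rho| <= M by exists M => p; exact: hM.
apply: (@chain_bound _ (sm l * (1 + l) / (l - 1) ^+ 2)) => t tt.
have s0 := sm_gt0 l1; have c0 := one_l_cos_ge0 l1 tt; have h := l_cos_gt0 l1 t.
rewrite /dQ1 mulNr normrN ger0_norm; last by rewrite divr_ge0 ?sqr_ge0// mulr_ge0// ltW.
apply: ler_pM; rewrite ?invr_ge0 ?sqr_ge0 ?mulr_ge0 ?(ltW s0)//.
  by rewrite ler_pM2l// lerD2l ler_piMr ?cos_le1// ltW.
rewrite lef_pV2 ?posrE ?exprn_gt0// ler_pXn2r// ?nnegrE ?(ltW h) ?(ltW lm)//.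
by rewrite lerD2l cos_geN1.
Qed.

Lemma Fq2z_bound : exists M, forall p, `|Fq2z l p| <= M.
Proof.
have l0 : 0 < l by exact: lt_trans l1.
have lm : 0 < l - 1 by rewrite subr_gt0.
have mu0 : 0 < l ^+ 2 - 1 by rewrite subr_gt0 exprn_egt1.
have rp := r0_gt0 l1.
have [M hM] : exists M, forall rho, `|chain l (dQ2 l) rho| <= M.
  apply: (@chain_bound _ ((l ^+ 2 - 1) * 1 / (l - 1) ^+ 2)) => t tt.
  have h := l_cos_gt0 l1 t.
  rewrite /dQ2 mulNr normrN normrM normfV normrM (gtr0_norm mu0) [`|_ ^+ 2|]ger0_norm ?sqr_ge0//.
  apply: ler_pM; rewrite ?invr_ge0 ?sqr_ge0 ?mulr_ge0 ?(ltW mu0)//.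
    by rewrite ler_pM2l// sin_max.
  rewrite lef_pV2 ?posrE ?exprn_gt0// ler_pXn2r// ?nnegrE ?(ltW h) ?(ltW lm)//.
  by rewrite lerD2l cos_geN1.
exists (1 + r0 l * M) => p; rewrite /Fq2z (le_trans (ler_normD _ _))//; apply: lerD.
  by rewrite normrN; case: (Q_ang_le1 l1 p).
have M0 : 0 <= M by apply: le_trans (hM 0).
have [h|h] := ltP `|slope p| (r0 l); last first.
  by rewrite /chain ltNge h /= mulr0 normr0 mulr_ge0// ltW.
by rewrite normrM ler_pM// ltW.
Qed.

Lemma laplacian_PP p : Pyy l p + Pzz l p =
  2 * (ee l (ang l p) ^+ 2 + nn l (ang l p) ^+ 2) +
  2 * (mm l (slope p) * EE l (slope p) * (1 + slope p ^+ 2)).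
Proof. by rewrite /Pyy /Pzz; ring. Qed.

End SliceDerivatives.

(** * Comparison with the candidate *)

Section Candidate.
Context {R : realType}.
Variable l : R.
Hypothesis l1 : 1 < l.
Implicit Types (p : R * R) (y z rho t : R).

Let l0 : 0 < l. Proof. exact: lt_trans l1. Qed.
Let mu0 : 0 < l ^+ 2 - 1. Proof. by rewrite subr_gt0 exprn_egt1. Qed.
Let lm0 : 0 < l - 1. Proof. by rewrite subr_gt0. Qed.
Let a0 := aa_gt0 l1.
Let s0 := sm_gt0 l1.

(* With [w = cos t], [f_ l (Zt t)] is affine in [t + l sin t]. *)
Definition Zt t : R := (l + cos t) / (l ^+ 2 - 1).
Definition TT t : R := aa l * (t + l * sin t).

Lemma Zt_0 : Zt 0 = 1 / (l - 1).
Proof.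
rewrite /Zt cos0; have -> : l ^+ 2 - 1 = (l + 1) * (l - 1) by ring.
by field; rewrite !gt_eqF// addr_gt0.
Qed.

Lemma Zt_th0 : Zt (th0 l) = 1 / l.
Proof. by rewrite /Zt cos_th0//; field; rewrite !gt_eqF. Qed.

Lemma asin_cos t : 0 <= t <= pi -> asin (cos t) = pi / 2 - t.
Proof.
move=> /andP[t0 t1].
rewrite -[in LHS](opprK t) cosN -sinDpihalf addrC sinK// in_itv/=.
apply/andP; split; lra.
Qed.

Lemma sqrt_cos t : 0 <= t <= pi -> Num.sqrt (1 - cos t ^+ 2) = sin t.
Proof. by move=> tt; rewrite -sin2cos2 sqrtr_sqr ger0_norm// sin_ge0_pi. Qed.

Lemma f_Zt t : 0 <= t <= pi ->
  f_ l (Zt t) = (sm l * (l ^+ 2 - 1))^-1 * (pi / 2 - t - l * sin t).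
Proof.
move=> tt; rewrite /f_ /= /Zt.
have -> : (l ^+ 2 - 1) * ((l + cos t) / (l ^+ 2 - 1)) - l = cos t.
  by field; rewrite gt_eqF.
rewrite asin_cos// sqrt_cos//; congr (_^-1 * _).
have -> : 3 / 2 = 1 + 2^-1 :> R by field.
rewrite powRD; last by rewrite gt_eqF ?implybT.
by rewrite powRr1 ?ltW// powR12_sqrt ?ltW// mulrC.
Qed.

Let tpi t : 0 <= t <= th0 l -> 0 <= t <= pi.
Proof. by move=> /andP[-> h] /=; rewrite (le_trans h)// ltW// th0_ltpi. Qed.

Lemma K_E : K_ l = - (aa l * sm l * (l ^+ 2 - 1)).
Proof.
rewrite /K_ -Zt_0 -Zt_th0 !f_Zt ?lexx ?pi_ge0 ?(ltW (th0_gt0 l1)) ?(ltW (th0_ltpi l1))//.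
rewrite sin0 /aa; have h : 0 < th0 l + l * sin (th0 l).
  by rewrite addr_gt0 ?th0_gt0// mulr_gt0// sin_th0_gt0.
have -> : pi / 2 - th0 l - l * sin (th0 l) = pi / 2 - (th0 l + l * sin (th0 l)) by ring.
have := gt_eqF h; have := gt_eqF s0; have := gt_eqF mu0.
move: (th0 l + l * sin (th0 l)) => w h1 h2 h3.
rewrite mulr0 !subr0 -mulrBr.
have -> : pi / 2 - w - pi / 2 = - w by ring.
by field; rewrite h1 h2 h3.
Qed.

Let dTT t : is_derive t 1 TT (aa l * (1 + l * cos t)).
Proof. exact: (is_derive1Z (aa l) (is_derive_tls l t)). Qed.

Let dTT_pos x : - th0 l < x < th0 l -> 0 < aa l * (1 + l * cos x).
Proof. by move=> xx; rewrite mulr_gt0// one_l_cos_gt0// ltr_norml. Qed.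

Lemma TT_incr t1 t2 : - th0 l <= t1 -> t1 < t2 -> t2 <= th0 l -> TT t1 < TT t2.
Proof. exact: (increasing_of_derive (fun x _ => dTT x) dTT_pos). Qed.

Lemma TTN t : TT (- t) = - TT t.
Proof. by rewrite /TT sinN; ring. Qed.

Lemma TT_th0 : TT (th0 l) = 1.
Proof. exact: aaE. Qed.

Let nth0 : - th0 l < 0. Proof. by rewrite oppr_lt0 th0_gt0. Qed.

Lemma TT_ge0 t : 0 <= t <= th0 l -> 0 <= TT t.
Proof.
move=> /andP[t0 t1]; have T0 : TT 0 = 0 by rewrite /TT sin0; ring.
move: t0; rewrite le_eqVlt => /predU1P[<-|t0]; first by rewrite T0.
by rewrite -T0 ltW// TT_incr// ltW.
Qed.

Lemma TT_le1 t : `|t| <= th0 l -> `|TT t| <= 1.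
Proof.
rewrite !ler_norml -TT_th0 -TTN => /andP[t1 t2]; apply/andP; split.
  by move: t1; rewrite le_eqVlt => /predU1P[->//|h]; rewrite ltW// TT_incr.
by move: t2; rewrite le_eqVlt => /predU1P[->//|h]; rewrite ltW// TT_incr.
Qed.

Lemma TT_surj y : `|y| <= 1 -> exists2 t, `|t| <= th0 l & TT t = y.
Proof.
rewrite ler_norml => /andP[y1 y2].
have [|||x] := @IVT R TT (- th0 l) (th0 l) y.
- by rewrite (le_trans (ltW nth0))// ltW// th0_gt0.
- apply: continuous_in_subspaceT => z _; exact: is_derive1_continuous (dTT z).
- by rewrite TTN TT_th0 min_l ?max_r ?y1//; lra.
by rewrite in_itv/= -ler_norml => xt xv; exists x.
Qed.

(** Every [Z] in the interval is some [Zt t] with [0 <= t <= th0], and there [f_] is a nonconstant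
    affine function of the strictly increasing [TT]. This makes the partial inverse [finv] a genuine
    one. *)
Lemma f_inj : {in `[1 / l, 1 / (l - 1)] &, injective (f_ l)}.
Proof.
have surj Z : Z \in `[1 / l, 1 / (l - 1)] -> exists2 t, 0 <= t <= th0 l & Zt t = Z.
  rewrite in_itv/= -Zt_th0 -Zt_0 /Zt !ler_pdivrMr// !ler_pdivlMr//.
  rewrite cos0 cos_th0// => /andP[z1 z2].
  have il : l^-1 < 1 by rewrite invf_lt1.
  have wi : -1 <= Z * (l ^+ 2 - 1) - l <= 1 by apply/andP; split; lra.
  have ai : 0 <= acos (Z * (l ^+ 2 - 1) - l) by exact: acos_ge0.
  have api : acos (Z * (l ^+ 2 - 1) - l) <= pi by exact: acos_lepi.
  exists (acos (Z * (l ^+ 2 - 1) - l)); last first.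
    by rewrite acosK ?in_itv//; field; rewrite gt_eqF.
  rewrite ai/= leNgt; apply/negP => h.
  have : cos (acos (Z * (l ^+ 2 - 1) - l)) < cos (th0 l).
    by rewrite ltr_cos// in_itv/= ?ai ?api// !ltW ?th0_gt0 ?th0_ltpi.
  rewrite acosK ?in_itv// cos_th0//; lra.
move=> Z1 Z2 /surj[t1 t1i <-] /surj[t2 t2i <-].
rewrite !f_Zt ?tpi// => /mulfI; rewrite invr_eq0 mulf_neq0 ?gt_eqF// => /(_ isT) h.
have {}h : TT t1 = TT t2 by rewrite /TT; congr (_ * _); lra.
have /andP[u1 u2] := t1i; have /andP[u3 u4] := t2i.
have v1 := le_trans (ltW nth0) u1; have v2 := le_trans (ltW nth0) u3.
have [t12|t21|->//] := ltgtP t1 t2.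
  by have := TT_incr v1 t12 u4; rewrite h ltxx.
by have := TT_incr v2 t21 u2; rewrite h ltxx.
Qed.

(** For [t >= 0], adding [TT t / K_ l] to the value of [f_] at [Zt 0] gives its value at [Zt t], so
    that [finv] returns [Zt t]; negative [t] follow by evenness. *)
Lemma phi_TT t : `|t| <= th0 l -> phi_ l (TT t) = - (aa l * sm l * (l + cos t)).
Proof.
wlog t0 : t / 0 <= t => [hw tt|].
  have [t0|t0] := leP 0 t; first exact: hw.
  have := hw (- t); rewrite normrN oppr_ge0 => /(_ (ltW t0) tt).
  by rewrite cosN TTN /phi_ normrN.
rewrite ger0_norm// => tt; have ti : 0 <= t <= th0 l by rewrite t0.
rewrite /phi_ ger0_norm ?TT_ge0//.
have -> : f_ l (1 / (l - 1)) + TT t / K_ l = f_ l (Zt t).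
  rewrite -Zt_0 (f_Zt (tpi ti)) f_Zt ?lexx ?pi_ge0//.
  rewrite K_E sin0 /TT; field.
  by rewrite !gt_eqF.
rewrite /Defs.finv pinvKV.
- rewrite K_E /Zt; field; by rewrite gt_eqF.
- by move=> x y /set_mem xi /set_mem yi; exact: f_inj.
- rewrite inE /= in_itv/= -Zt_th0 -Zt_0 /Zt !ler_pM2r ?invr_gt0// !lerD2l cos0 cos_le1 andbT.
  by apply: cos_ge_of_norm_le; rewrite ?ger0_norm// !ltW ?th0_gt0 ?th0_ltpi.
Qed.

(** By [K_E] this is [- l / K_ l]: the rays of parameters [th0] and [- th0] bound [cone l]. *)
Lemma r0E : r0 l = l / (aa l * sm l * (l ^+ 2 - 1)).
Proof.
rewrite /r0 /rr cos_th0//.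
have -> : th0 l + l * sin (th0 l) = (aa l)^-1 by rewrite /aa invrK.
by field; rewrite !gt_eqF.
Qed.

Lemma coneE p : cone l p <-> `|p.1| < - r0 l * p.2.
Proof.
rewrite /cone /= K_E r0E.
suff -> : p.2 * l / - (aa l * sm l * (l ^+ 2 - 1)) = - (l / (aa l * sm l * (l ^+ 2 - 1))) * p.2 by [].
by field; rewrite !gt_eqF.
Qed.

Lemma cone_lt0 p : cone l p -> p.2 < 0.
Proof.
move=> /coneE h; have : 0 < - r0 l * p.2 by exact: le_lt_trans h.
by rewrite mulNr oppr_gt0 pmulr_rlt0// r0_gt0.
Qed.

Lemma cone_slope p : cone l p -> `|slope p| < r0 l.
Proof. by move=> h; rewrite slope_lt ?cone_lt0//; apply/coneE. Qed.

Lemma cone_ang p : cone l p -> `|ang l p| < th0 l.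
Proof.
move=> /cone_slope h; rewrite lt_neqAle Ang_itv// andbT.
apply: contraTneq h => h; rewrite -leNgt.
have [hs|/ltW//] := leP `|slope p| (r0 l).
rewrite -(rr_Ang l1 hs) -/(ang l p).
case: (ger0P (ang l p)) h => _ h; first by rewrite h ler_norm.
have -> : ang l p = - th0 l by rewrite -h opprK.
by rewrite rrN normrN ler_norm.
Qed.

(** An admissible [L] places [p] on the curve dilated by [L]. Dilations preserve the slope, which
    determines the parameter [t], and then [z] determines [L]. *)
Lemma L_E p : cone l p -> L_ l p = Lt l p.
Proof.
move=> cp; have p2 := cone_lt0 cp; have sr := cone_slope cp; have lc t := l_cos_gt0 l1 t.
have LtE : Lt l p = - p.2 * ih l (ang l p) by rewrite Lt_mm// mm_in ?ltW.
have key t : `|t| <= th0 l -> forall L, 0 < L -> p.1 = L * TT t ->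
    p.2 = L * - (aa l * sm l * (l + cos t)) -> L = Lt l p.
  move=> tt L L0 e1 e2.
  have st : slope p = rr l t.
    rewrite /slope e1 e2 /TT /rr; field.
    by rewrite !gt_eqF.
  have at_ : ang l p = t by rewrite /ang st Ang_rr.
  rewrite LtE at_ e2 /ih; field.
  by rewrite !gt_eqF.
(* The second case, the default value, is excluded by showing that [Lt l p] belongs to the set. *)
rewrite /L_; case: xgetP => [L _ [L0 yL zL]|/(_ (Lt l p))].
  have yL1 : `|p.1 / L| <= 1.
    by rewrite normrM normfV (gtr0_norm L0) ler_pdivrMr// mul1r.
  have [t tt tE] := TT_surj yL1.
  apply: (key t tt L L0); first by rewrite tE mulrC divfK// gt_eqF.
  by rewrite -phi_TT// tE.
have Lp := Lt_gt0 l1 p2; case.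
have tt := Ang_itv l1 (slope p); rewrite -/(ang l p) in tt.
have e1 : p.1 = Lt l p * TT (ang l p).
  have : slope p = rr l (ang l p) by rewrite rr_Ang ?ltW.
  rewrite LtE /ih /TT /rr /slope => /(congr1 (fun x => x * - p.2)).
  rewrite divfK ?oppr_eq0 ?lt_eqF// => ->; field.
  by rewrite !gt_eqF.
split=> //.
- by rewrite {1}e1 normrM gtr0_norm//; apply: ler_piMr; [exact: ltW|exact: TT_le1].
- have -> : p.1 / Lt l p = TT (ang l p) by rewrite {1}e1 mulrC mulKf// gt_eqF.
  by rewrite phi_TT// LtE /ih; field; rewrite !gt_eqF.
Qed.

(** Parametric differentiation, [dz/dt] over [dy/dt]; the denominator is positive only for
    [|t| < th0]. *)
Lemma derive1_phi t : `|t| < th0 l ->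
  derive1 (phi_ l) (TT t) = sm l * sin t / (1 + l * cos t).
Proof.
move=> tt; have ti : - th0 l < t < th0 l by rewrite -ltr_norml.
pose Ti := inverse_on (th0 l) TT.
have TiK x : `|x| <= th0 l -> Ti (TT x) = x.
  move=> xx; apply: (inverse_onK (fun x _ => dTT x) dTT_pos).
  by rewrite -ler_norml.
have dTi : is_derive (TT t) 1 Ti (aa l * (1 + l * cos t))^-1.
  exact: (is_derive_inverse_on (fun x _ => dTT x) dTT_pos ti).
have TiE : Ti (TT t) = t by rewrite TiK// ltW.
have dl : is_derive (Ti (TT t)) 1 (fun x => - (aa l * sm l * (l + cos x))) (aa l * sm l * sin t).
  rewrite TiE; apply: (is_derive1_eq (is_derive1N (is_derive1Z (aa l * sm l) (is_derive1_lcos l t)))) => //.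
  by ring.
have d := is_derive1_comp' dTi dl.
have d' : is_derive (TT t) 1 (phi_ l) (aa l * sm l * sin t * (aa l * (1 + l * cos t))^-1).
  apply: (is_derive1_near d); near=> y.
  have [x xx <-] : exists2 x, `|x| <= th0 l & TT x = y.
    apply: TT_surj; rewrite ler_norml -TT_th0 -TTN; apply/andP; split; apply/ltW; near: y.
      by apply: lt_nbhsr; apply: TT_incr => //; case/andP: ti => // _ /ltW.
    by apply: lt_nbhsl; apply: TT_incr => //; case/andP: ti => // /ltW.
  by rewrite TiK// phi_TT.
rewrite derive1E (@derive_val _ _ _ _ _ _ _ d'); field.
by rewrite !gt_eqF// one_l_cos_gt0.
Unshelve. all: by end_near. Qed.

Lemma q_E p : cone l p -> q_ l p = (Q1 l (ang l p), Q2 l (ang l p)).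
Proof.
move=> cp; have p2 := cone_lt0 cp; have sr := cone_slope cp; have lc t := l_cos_gt0 l1 t.
have Lp := Lt_gt0 l1 p2; have LtE : Lt l p = - p.2 * ih l (ang l p) by rewrite Lt_mm// mm_in ?ltW.
have oc := one_l_cos_gt0 l1 (cone_ang cp).
rewrite /q_ L_E//.
have -> : p.1 / Lt l p = TT (ang l p).
  have : slope p = rr l (ang l p) by rewrite rr_Ang ?ltW.
  rewrite LtE /ih /TT /rr /slope => /(congr1 (fun x => x * - p.2)).
  rewrite divfK ?oppr_eq0 ?lt_eqF// => ->; field.
  by rewrite ?(gt_eqF a0) ?(gt_eqF s0) ?(gt_eqF (lc _)) ?(lt_eqF p2).
rewrite derive1_phi ?cone_ang// real_normK ?num_real//.
have -> : 1 + (sm l * sin (ang l p) / (1 + l * cos (ang l p))) ^+ 2 =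
    ((l + cos (ang l p)) / (1 + l * cos (ang l p))) ^+ 2.
  have := sm2 l1; have := sin2cos2 (ang l p) => h1 h2.
  by field: h1 h2; rewrite gt_eqF.
rewrite sqrtr_sqr ger0_norm ?divr_ge0 ?(ltW oc) ?(ltW (lc _))//.
by congr (_, _); rewrite /Q1 /Q2; field; rewrite !gt_eqF.
Qed.

Lemma dext_E p : Omega p -> dext l p = (Q1 l (ang l p), Q2 l (ang l p)).
Proof.
move=> [_ p2]; rewrite /dext; case: ifPn => [|/negP]; first by rewrite inE => /q_E.
rewrite inE => /coneE/negP; rewrite -leNgt => h.
(* A point of Omega off the cone has [y] nonzero, so the quotient in [dext] is a genuine sign. *)
have p1 : 0 < `|p.1|.
  by apply: lt_le_trans h; rewrite mulNr oppr_gt0 pmulr_rlt0// r0_gt0.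
rewrite ang_out//; case: (ltgtP 0 p.1) p1 => [p1|p1|<-]; last by rewrite normr0 ltxx.
- by move=> _; rewrite gtr0_norm// divff ?gt_eqF// Q1_th0// Q2_th0.
- move=> _; rewrite ltr0_norm// invrN mulrN divff ?lt_eqF// opprK.
  by rewrite Q1N Q2N Q1_th0// Q2_th0// opprK.
Qed.

Lemma nn_le0 t : `|t| <= th0 l -> nn l t <= 0.
Proof.
move=> tt; have c0 := one_l_cos_ge0 l1 tt.
have D0 : 0 < D_ l t by apply: lt_le_trans (D_ge l1 tt); rewrite divr_gt0.
by rewrite /nn mulNr oppr_le0 divr_ge0// mulr_ge0 ?(ltW D0)// mulr_ge0// ltW.
Qed.

Lemma Lt_nincr y z1 z2 : z1 <= z2 -> z2 < 0 -> Lt l (y, z2) <= Lt l (y, z1).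
Proof.
move=> z12 z20.
have [||c] := @MVT_segment R (fun t => Lt l (y, t)) (fun t => nn l (ang l (y, t))) z1 z2 z12.
- move=> x; rewrite in_itv/= => /andP[_ xz]; apply: is_derive_Lt_z => //.
  exact: lt_trans z20.
- by apply: continuous_subspaceT; apply: continuous_slice_z; exact: continuous_Lt.
move=> _ E; rewrite -subr_le0 E mulr_le0_ge0 ?subr_ge0//.
by apply: nn_le0; exact: Ang_itv.
Qed.

Lemma Lt_phi y : `|y| < 1 -> phi_ l y < 0 /\ Lt l (y, phi_ l y) = 1.
Proof.
move=> y1; have [t tt <-] := TT_surj (ltW y1); have lc := l_cos_gt0 l1 t.
rewrite phi_TT//; have n0 : - (aa l * sm l * (l + cos t)) < 0 by rewrite oppr_lt0 !mulr_gt0.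
split=> //; rewrite Lt_mm//=.
have -> : slope (TT t, - (aa l * sm l * (l + cos t))) = rr l t.
  by rewrite /slope /= /TT /rr; field; rewrite !gt_eqF.
rewrite mm_in ?Ang_rr//; last by rewrite ler_norml rr_itv.
by rewrite /ih; field; rewrite !gt_eqF.
Qed.

(** L is nonincreasing in [z] and equals 1 on the graph of [phi_], so the cut at [z = phi_ y] is the
    cut at [L = 1]. Off the cone [L = |y| < 1] and the positive part changes nothing. *)
Lemma u_E zeta p : Omega p -> u_ zeta l p = zeta * Num.max (1 - PP l p) 0.
Proof.
move=> [/andP[p1 p1'] p2]; have y1 : `|p.1| < 1 by rewrite ltr_norml p1.
rewrite /u_; case: ifPn => [|/negP]; rewrite inE; last first.
  move=> /coneE/negP; rewrite -leNgt => h; rewrite /PP Lt_out// real_normK ?num_real//.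
  rewrite max_l; first by ring.
  by rewrite subr_ge0 -real_normK ?num_real// expr_le1// ltW.
move=> cp; rewrite L_E//; have [ph0 ph1] := Lt_phi y1.
have Lp := Lt_gt0 l1 p2; have pE : (p.1, p.2) = p by case: p {p1 p1' p2 y1 cp ph0 ph1 Lp}.
case: ifPn => [h|].
  have L1 : Lt l p <= 1 by rewrite -pE -ph1; exact: Lt_nincr.
  rewrite max_l /PP; first by ring.
  by rewrite subr_ge0 expr_le1// ltW.
rewrite -ltNge => h.
have L1 : 1 <= Lt l p by rewrite -pE -ph1; apply: Lt_nincr => //; exact: ltW.
by rewrite max_r ?mulr0// subr_le0 expr_ge1// ltW.
Qed.

Lemma open_cone : open (cone l : set (R * R)).
Proof.
rewrite openE => p /coneE h.
have : (fun q : R * R => `|q.1| - - r0 l * q.2) @ p --> `|p.1| - - r0 l * p.2.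
  apply: cvgB; first by apply: cvg_norm; exact: cvg_fst.
  by apply: cvgM; [exact: cvg_cst|exact: cvg_snd].
move=> /cvgr_lt; move: h; rewrite -subr_lt0 => h /(_ _ h).
by apply: filterS => q; rewrite subr_lt0 => h'; apply/coneE.
Qed.

Let near_cone p (f g : R * R -> R) : cone l p -> (forall q, cone l q -> f q = g q) ->
  \forall q \near p, f q = g q.
Proof.
move=> cp fg; have : nbhs p (cone l) by apply: open_nbhs_nbhs; split => //; exact: open_cone.
by apply: filterS.
Qed.

(** Since [nn' = rr * ee'], L_yy is [EE / (- z)] and L_zz is [rho^2 EE / (- z)]; multiplying by
    [L = - z * mm] cancels [z]. The cone is open, so [L_] may be replaced by [Lt] near [p]. *)
Lemma laplacian_L p : cone l p ->
  L_ l p * laplacian (L_ l) p = mm l (slope p) * EE l (slope p) * (1 + slope p ^+ 2).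
Proof.
move=> cp; have p2 := cone_lt0 cp; have sr := cone_slope cp.
have dyE q : cone l q -> dy (L_ l) q = ee l (ang l q).
  move=> cq; rewrite /dy (near_eq_derive _ (near_cone cq L_E)).
  have := is_derive_Lt_y l1 q.1 (cone_lt0 cq).
  by move=> /is_derive_slice_y; rewrite -surjective_pairing => -[].
have dzE q : cone l q -> dz (L_ l) q = nn l (ang l q).
  move=> cq; rewrite /dz (near_eq_derive _ (near_cone cq L_E)).
  have := is_derive_Lt_z l1 q.1 (cone_lt0 cq).
  by move=> /is_derive_slice_z; rewrite -surjective_pairing => -[].
have sr' : `|slope p| != r0 l by rewrite lt_eqF.
have pE : (p.1, p.2) = p by case: p {cp p2 sr sr'}.
have e1 : dy (dy (L_ l)) p = EE l (slope p) / - p.2.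
  transitivity ('D_((1, 0) : R * R) (fun q => ee l (ang l q)) p).
    exact: (near_eq_derive _ (near_cone cp dyE)).
  have ds : is_derive p.1 1 (fun t => slope (t, p.2)) (- p.2)^-1 by exact: is_derive_slope_y.
  have de : is_derive (slope (p.1, p.2)) 1 (fun x => ee l (Ang l x)) (EE l (slope p)).
    by rewrite pE; exact: is_derive_ee_Ang.
  have := (is_derive_slice_y (fun q => ee l (ang l q)) p.1 p.2 _).2 (is_derive1_comp' ds de).
  by rewrite pE => -[_ <-].
have e2 : dz (dz (L_ l)) p = slope p * EE l (slope p) * (slope p / - p.2).
  transitivity ('D_((0, 1) : R * R) (fun q => nn l (ang l q)) p).
    exact: (near_eq_derive _ (near_cone cp dzE)).
  have ds : is_derive p.2 1 (fun t => slope (p.1, t)) (slope p / - p.2).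
    by rewrite -[X in slope X]pE; exact: is_derive_slope_z.
  have de : is_derive (slope (p.1, p.2)) 1 (fun x => nn l (Ang l x)) (slope p * EE l (slope p)).
    by rewrite pE; exact: is_derive_nn_Ang.
  have := (is_derive_slice_z (fun q => nn l (ang l q)) p.1 p.2 _).2 (is_derive1_comp' ds de).
  by rewrite pE => -[_ <-].
rewrite /laplacian e1 e2 L_E// Lt_mm//; field.
by rewrite lt_eqF.
Qed.

Lemma LLaplacian_bounded_exists : exists C1 C2 : R,
  [/\ 0 < C1, 0 < C2 & LLaplacian_bounded l (C1 + C2)].
Proof.
have [M M0 hM] := mm_EE_bound l1.
(* One constant bounds L L_yy and the other L L_zz; the [+ 1] makes them positive even if
   [M = 0]. *)
exists (M + 1), (M + 1); split; rewrite ?ltr_wpDl// => p [cp _].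
rewrite laplacian_L//; have [h1 h2] := hM (slope p).
have := ler_norm (mm l (slope p) * EE l (slope p)).
have := ler_norm (mm l (slope p) * slope p ^+ 2 * EE l (slope p)).
move: h1 h2; move: (mm l (slope p)) (EE l (slope p)) (slope p) => m e s; nra.
Qed.

Lemma C_E : C_ l = 1 + nmax l ^+ 2.
Proof.
rewrite /C_ K_E /nmax; have -> : l ^+ 2 - 1 = (l + 1) * (l - 1) by ring.
by field; rewrite !gt_eqF// addr_gt0.
Qed.

(** The hypothesis on [c] speaks of the cone only. Elsewhere [EE] vanishes, and [0 <= c]
    suffices. *)
Lemma laplacian_PP_le (c : R) : LLaplacian_bounded l c -> 0 <= c ->
  forall p, Omega p -> Pyy l p + Pzz l p <= 2 * (C_ l + c).
Proof.
move=> Lc c0 p Op; have p2 : p.2 < 0 by case: Op.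
rewrite laplacian_PP [leRHS]mulrDr; apply: lerD.
  rewrite ler_pM2l// C_E; apply: lerD.
    by rewrite -real_normK ?num_real// expr_le1// ee_ang_le1.
  rewrite -real_normK ?num_real// ler_pXn2r ?nnegrE ?nn_ang_le//.
  by rewrite ltW// nmax_gt0.
rewrite ler_pM2l//; have [h|h] := ltP `|slope p| (r0 l).
  have cp : cone l p by apply/coneE; rewrite -slope_lt.
  by rewrite -laplacian_L//; exact: Lc.
by rewrite /EE /chain ltNge h/= mulr0 mul0r.
Qed.

End Candidate.

(** * Smoothing and cutoff functions *)

Section Smoothing.
Context {R : realType}.
Implicit Types (c s x : R).

Definition pospart (f : R -> R) s : R := if s <= 0 then 0 else f s.

Lemma is_derive_pospart (f f' : R -> R) s :
  (forall x, 0 <= x -> is_derive x 1 f (f' x)) -> f 0 = 0 -> f' 0 = 0 ->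
  is_derive s 1 (pospart f) (pospart f' s).
Proof.
move=> df f0 f'0; rewrite {2}/pospart; have [s0|s0|->] := ltgtP s 0.
- apply: (is_derive1_near (is_derive1_cst 0 s)); near=> x.
  by rewrite /pospart ltW//; near: x; exact: lt_nbhsl.
- apply: (is_derive1_near (df s (ltW s0))); near=> x.
  by rewrite /pospart leNgt ifF//; apply/negbTE; rewrite negbK; near: x; exact: lt_nbhsr.
- have d0 := df 0 (lexx 0); rewrite f'0 in d0.
  exact: (is_derive1_glue (is_derive1_cst 0 0) d0 (esym f0)).
Unshelve. all: by end_near. Qed.

Definition sq : R -> R := pospart (fun s => s ^+ 2).
Definition dsq : R -> R := pospart (fun s => 2 * s).
(* [Hs c] is a C^2 convex nondecreasing approximation of the positive part; [eta] and [deta]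
   are its first two derivatives. *)
Definition Hs c : R -> R := pospart (fun s => s ^+ 3 / (s + c) ^+ 2).
Definition eta c : R -> R := pospart (fun s => s ^+ 2 * (s + 3 * c) / (s + c) ^+ 3).
Definition deta c : R -> R := pospart (fun s => 6 * c ^+ 2 * s / (s + c) ^+ 4).

Let is_derive1X n (f : R -> R) x a : is_derive x 1 f a ->
  is_derive x 1 (fun y => f y ^+ n.+1) (n.+1%:R * f x ^+ n * a).
Proof.
elim: n => [|n IH] fa.
  by apply: (is_derive1_eq fa) => //; rewrite expr0 !mul1r.
apply: (is_derive1_eq (is_derive1M fa (IH fa))).
  by move=> y; rewrite -exprS.
by rewrite -[n.+2%:R]natr1 !exprS; ring.
Qed.

Lemma is_derive_sq s : is_derive s 1 sq (dsq s).
Proof.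
apply: is_derive_pospart => [x _||]; rewrite ?expr0n ?mulr0//.
by apply: (is_derive1_eq (is_derive1X 1 (is_derive1_id x))) => //; rewrite mulr1 expr1.
Qed.

Let is_derive_shiftc c x : is_derive x 1 (fun y => y + c) (1 : R).
Proof.
by apply: (is_derive1_eq (is_derive1D (is_derive1_id x) (is_derive1_cst c x))) => //; rewrite addr0.
Qed.

Lemma is_derive_Hs c s : 0 < c -> is_derive s 1 (Hs c) (eta c s).
Proof.
move=> c0; apply: is_derive_pospart => [x x0||]; rewrite ?expr0n ?mul0r//.
have xc : x + c != 0 by rewrite gt_eqF// ltr_wpDl.
have xc2 : (x + c) ^+ 2 != 0 by rewrite expf_neq0.
apply: (is_derive1_eq (is_derive1_div (is_derive1X 2 (is_derive1_id x))
  (is_derive1X 1 (is_derive_shiftc c x)) xc2)) => //.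
by field.
Qed.

Lemma is_derive_eta c s : 0 < c -> is_derive s 1 (eta c) (deta c s).
Proof.
move=> c0; apply: is_derive_pospart => [x x0||]; rewrite ?expr0n ?mulr0 ?mul0r//.
have xc : x + c != 0 by rewrite gt_eqF// ltr_wpDl.
have xc3 : (x + c) ^+ 3 != 0 by rewrite expf_neq0.
apply: (is_derive1_eq (is_derive1_div (is_derive1M (is_derive1X 1 (is_derive1_id x))
  (is_derive_shiftc (3 * c) x))
  (is_derive1X 2 (is_derive_shiftc c x)) xc3)) => //.
by field.
Qed.

Lemma continuous_sq : continuous sq.
Proof. by move=> s; exact: is_derive1_continuous (is_derive_sq s). Qed.

Lemma continuous_Hs c : 0 < c -> continuous (Hs c).
Proof. by move=> c0 s; exact: is_derive1_continuous (is_derive_Hs s c0). Qed.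

Lemma continuous_eta c : 0 < c -> continuous (eta c).
Proof. by move=> c0 s; exact: is_derive1_continuous (is_derive_eta s c0). Qed.

Let maxE (f : R -> R) s : f 0 = 0 -> pospart f s = f (Num.max s 0).
Proof.
move=> f0; rewrite /pospart; case: (leP s 0) => // s0; by rewrite ?max_r ?max_l// ltW.
Qed.

Let continuous_max0 : continuous (fun s : R => Num.max s 0).
Proof. by move=> s; apply: continuous_max; [exact: cvg_id|exact: cst_continuous]. Qed.

Lemma continuous_dsq : continuous dsq.
Proof.
have -> : dsq = (fun s => 2 * Num.max s 0).
  by apply/funext => s; rewrite /dsq maxE// mulr0.
by move=> s; apply: cvgM; [exact: cvg_cst|exact: continuous_max0].
Qed.

Lemma continuous_deta c : 0 < c -> continuous (deta c).
Proof.
move=> c0; have -> : deta c = (fun s => 6 * c ^+ 2 * Num.max s 0 / (Num.max s 0 + c) ^+ 4).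
  by apply/funext => s; rewrite /deta maxE// mulr0 mul0r.
move=> s; apply: cvgM.
  by apply: cvgM; [exact: cvg_cst|exact: continuous_max0].
apply: cvgV; first by rewrite expf_neq0// gt_eqF// ltr_wpDl// le_max lexx orbT.
apply: (@continuous_comp _ _ _ (fun s => Num.max s 0 + c) (fun x => x ^+ 4)).
  by apply: cvgD; [exact: continuous_max0|exact: cvg_cst].
exact: exprn_continuous.
Qed.

Lemma pospart_le0 (f : R -> R) s : s <= 0 -> pospart f s = 0.
Proof. by rewrite /pospart => ->. Qed.

Lemma Hs_bound c s : 0 < c -> 0 <= Hs c s <= Num.max s 0.
Proof.
move=> c0; rewrite /Hs /pospart; have [s0|s0] := leP s 0; first by rewrite !lexx.
have sc : 0 < s + c by rewrite addr_gt0.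
rewrite divr_ge0 ?exprn_ge0 ?(ltW s0) ?(ltW sc)//= ler_pdivrMr ?exprn_gt0//.
rewrite exprS ler_pM2l// ler_pXn2r ?nnegrE ?(ltW s0) ?(ltW sc)//.
by rewrite lerDl ltW.
Qed.

Lemma eta_bound c s : 0 < c -> 0 <= eta c s <= 1.
Proof.
move=> c0; rewrite /eta /pospart; have [s0|s0] := leP s 0; first by rewrite lexx ler01.
have sc : 0 < s + c by rewrite addr_gt0.
have s3c : 0 < s + 3 * c by rewrite addr_gt0// mulr_gt0.
rewrite divr_ge0 ?mulr_ge0 ?exprn_ge0 ?(ltW s0) ?(ltW sc) ?(ltW s3c)//=.
rewrite ler_pdivrMr ?exprn_gt0// mul1r -subr_ge0.
have -> : (s + c) ^+ 3 - s ^+ 2 * (s + 3 * c) = c ^+ 2 * (3 * s + c) by ring.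
by rewrite mulr_ge0 ?sqr_ge0// addr_ge0 ?mulr_ge0 ?ltW.
Qed.

Lemma deta_ge0 c s : 0 < c -> 0 <= deta c s.
Proof.
move=> c0; rewrite /deta /pospart; have [//|s0] := leP s 0.
by rewrite divr_ge0 ?exprn_ge0 ?mulr_ge0 ?sqr_ge0 ?addr_ge0 ?(ltW s0) ?(ltW c0).
Qed.

Let cn (n : nat) : R := n.+1%:R^-1.

Let cn_cvg : cn @ \oo --> 0.
Proof. exact: cvg_harmonic. Qed.

Let cvg_scX (s : R) k : 0 < s ->
  (s + cn n) ^- k @[n --> \oo] --> (s ^- k : R).
Proof.
move=> s0; apply: cvgV; first by rewrite expf_neq0// gt_eqF.
have h : (fun n => s + cn n) @ \oo --> s + 0.
  by apply: cvgD; [exact: cvg_cst|exact: cn_cvg].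
rewrite addr0 in h; apply: (@cvg_comp _ _ _ (fun n => s + cn n) (fun x => x ^+ k) _ _ _ h).
exact: exprn_continuous.
Qed.

Lemma cvg_Hs s : Hs (cn n) s @[n --> \oo] --> Num.max s 0.
Proof.
rewrite /Hs /pospart; have [s0|s0] := leP s 0; first exact: cvg_cst.
rewrite [X in _ --> X](_ : s = s ^+ 3 / s ^+ 2); last by field; rewrite gt_eqF.
by apply: cvgM; [exact: cvg_cst|exact: cvg_scX].
Qed.

Lemma cvg_eta s : eta (cn n) s @[n --> \oo] --> (if s <= 0 then 0 else 1 : R).
Proof.
rewrite /eta /pospart; have [s0|s0] := leP s 0; first exact: cvg_cst.
rewrite [X in _ --> X](_ : 1 = s ^+ 2 * (s + 3 * 0) / s ^+ 3); last by field; rewrite gt_eqF.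
have h : (fun n => s + 3 * cn n) @ \oo --> s + 3 * 0.
  by apply: cvgD; [exact: cvg_cst|apply: cvgM; [exact: cvg_cst|exact: cn_cvg]].
by apply: cvgM; [apply: cvgM; [exact: cvg_cst|exact: h]|exact: cvg_scX].
Qed.

Lemma sq_ge0 s : 0 <= sq s.
Proof. by rewrite /sq /pospart; case: ifP => // _; exact: sqr_ge0. Qed.

Lemma sq_le1 s : s <= 1 -> sq s <= 1.
Proof.
by move=> s1; rewrite /sq /pospart; case: (leP s 0) => // s0; rewrite expr_le1// ltW.
Qed.

(** A C^1 step from 1 on [s <= 0] to 0 on [s >= 1], used in the variable [z] to truncate above the
    top side without changing anything in Omega. *)
Definition kappa s : R := sq (1 - sq s).
Definition dkappa s : R := - (dsq s * dsq (1 - sq s)).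

Lemma is_derive_kappa s : is_derive s 1 kappa (dkappa s).
Proof.
have d := is_derive1B (is_derive1_cst 1 s) (is_derive_sq s).
apply: (is_derive1_eq (is_derive1_comp' d (is_derive_sq (1 - sq s)))) => //.
by rewrite /dkappa; ring.
Qed.

Lemma kappa_le0 s : s <= 0 -> kappa s = 1.
Proof.
by move=> s0; rewrite /kappa {2}/sq pospart_le0// subr0 /sq /pospart ler10 expr1n.
Qed.

Lemma kappa_ge1 s : 1 <= s -> kappa s = 0.
Proof.
move=> s1; rewrite /kappa {1}/sq pospart_le0// subr_le0 /sq /pospart ifF ?expr_ge1//.
  exact: le_trans s1.
by apply/negbTE; rewrite -ltNge (lt_le_trans _ s1).
Qed.

Lemma continuous_kappa : continuous kappa.
Proof. by move=> s; exact: is_derive1_continuous (is_derive_kappa s). Qed.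

Lemma continuous_dkappa : continuous dkappa.
Proof.
move=> s; apply: cvgN; apply: cvgM; first exact: continuous_dsq.
apply: (@continuous_comp _ _ _ (fun x => 1 - sq x) dsq); last exact: continuous_dsq.
by apply: cvgB; [exact: cvg_cst|exact: continuous_sq].
Qed.

(* The cutoff at height [n], equal to [(1 + z / n)^2] for [- n <= z] and to [0] below. *)
Definition chi (n : nat) (z : R) : R := sq (1 + z * cn n).
Definition dchi (n : nat) (z : R) : R := dsq (1 + z * cn n) * cn n.

Let cn_gt0 n : 0 < cn n. Proof. by rewrite invr_gt0. Qed.

Lemma is_derive_chi n (z : R) : is_derive z 1 (chi n) (dchi n z).
Proof.
have d := is_derive1D (is_derive1_cst 1 z) (is_derive1M (is_derive1_id z) (is_derive1_cst (cn n) z)).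
apply: (is_derive1_eq (is_derive1_comp' d (is_derive_sq (1 + z * cn n)))) => //.
by rewrite /dchi; ring.
Qed.

Lemma continuous_chi n : continuous (chi n).
Proof. by move=> z; exact: is_derive1_continuous (is_derive_chi n z). Qed.

Lemma continuous_dchi n : continuous (dchi n).
Proof.
move=> z; apply: cvgM; last exact: cvg_cst.
apply: (@continuous_comp _ _ _ (fun x => 1 + x * cn n) dsq); last exact: continuous_dsq.
apply: cvgD; first exact: cvg_cst.
by apply: cvgM; [exact: cvg_id|exact: cvg_cst].
Qed.

Lemma chi_bound n (z : R) : z <= 0 -> 0 <= chi n z <= 1.
Proof.
move=> z0; rewrite sq_ge0/= sq_le1// gerDl.
by rewrite mulr_le0_ge0// ltW.
Qed.

Let le_cn n (z : R) : z < - n.+1%:R -> 1 + z * cn n <= 0.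
Proof.
by move=> zn; rewrite addrC -lerBrDr sub0r /cn ler_pdivrMr// mulN1r ltW.
Qed.

Lemma chi_eq0 n (z : R) : z < - n.+1%:R -> chi n z = 0.
Proof. by move=> zn; rewrite /chi /sq pospart_le0// le_cn. Qed.

Lemma dchi_eq0 n (z : R) : z < - n.+1%:R -> dchi n z = 0.
Proof. by move=> zn; rewrite /dchi /dsq pospart_le0 ?mul0r// le_cn. Qed.

Lemma dchi_bound n (z : R) : z <= 0 -> 0 <= dchi n z <= 2 * cn n.
Proof.
move=> z0; have h : z * cn n <= 0 by rewrite mulr_le0_ge0// ltW.
have c0 := cn_gt0 n; rewrite /dchi /dsq /pospart; case: ifPn => [_|].
  by rewrite mul0r lexx mulr_ge0// ltW.
rewrite -ltNge => w0; rewrite mulr_ge0 ?mulr_ge0 ?(ltW w0) ?(ltW c0)//=.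
rewrite ler_pM2r// ler_piMr//; lra.
Qed.

(** The cutoff varies over a depth [n + 1] with slope at most [2 / (n + 1)], so the weight [|z|] is
    compensated uniformly in [n]. *)
Lemma norm_mul_dchi n (z : R) : z <= 0 -> `|z * dchi n z| <= 2.
Proof.
move=> z0; have [zn|nz] := ltP z (- n.+1%:R).
  by rewrite dchi_eq0// mulr0 normr0.
have /andP[d0 d1] := dchi_bound n z0.
rewrite normrM (ger0_norm d0) ler0_norm//.
have -> : 2 = n.+1%:R * (2 * cn n) :> R by rewrite /cn mulrCA divff ?mulr1// pnatr_eq0.
by apply: ler_pM => //; rewrite ?oppr_ge0// lerNl.
Qed.

Lemma cvg_chi (z : R) : chi n z @[n --> \oo] --> (1 : R).
Proof.
rewrite [X in _ --> X](_ : 1 = sq (1 + z * 0)); last first.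
  by rewrite mulr0 addr0 /sq /pospart ler10 expr1n.
apply: (@cvg_comp _ _ _ (fun n => 1 + z * cn n) sq _ (nbhs (1 + z * 0))).
  apply: cvgD; first exact: cvg_cst.
  by apply: cvgM; [exact: cvg_cst|exact: cn_cvg].
exact: continuous_sq.
Qed.

Lemma cvg_dchi (z : R) : z <= 0 -> dchi n z @[n --> \oo] --> (0 : R).
Proof.
move=> z0; apply: (@squeeze_cvgr _ _ _ _ (fun=> 0) (fun n => 2 * cn n)).
- by apply: nearW => n; exact: dchi_bound.
- exact: cvg_cst.
- by rewrite -(mulr0 2); apply: cvgM; [exact: cvg_cst|exact: cn_cvg].
Qed.

End Smoothing.

(** * Membership in X *)

Section Membership.
Context {R : realType}.
Notation pl := (measurableTypeR R * measurableTypeR R)%type.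
Variables (l zeta : R).
Hypothesis l1 : 1 < l.
Implicit Types (p : R * R) (y z : R).

Lemma box_L2_cvg0 (f : nat -> R * R -> R) (N M : R) :
  (forall n, measurable_fun (Omega : set pl) (f n)) ->
  (forall n p, Omega p -> `|f n p| <= M) ->
  (forall n p, Omega p -> p.2 < - N -> f n p = 0) ->
  (forall p, Omega p -> f n p @[n --> \oo] --> 0) ->
  (\int[leb2]_(p in Omega) ((f n p) ^+ 2)%:E @[n --> \oo] --> 0)%E.
Proof.
move=> mf fM f0 fc; have mO := @measurable_Omega R.
pose g p : R := if p.2 < - N then 0 else M ^+ 2.
have ig : leb2.-integrable Omega (fun p => (g p)%:E).
  apply: (@box_integrable _ _ N (M ^+ 2)).
  - apply: measurable_funTS; apply: measurable_fun_ifT => //.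
    by apply: measurable_fun_ltr => //; exact: measurable_snd.
  - move=> p Op; rewrite /g; case: ifP => _; first by rewrite normr0 sqr_ge0.
    by rewrite ger0_norm// sqr_ge0.
  - by move=> p Op; rewrite /g => ->.
have [|||||_ _] := @dominated_convergence _ _ R leb2 Omega mO
  (fun n p => ((f n p) ^+ 2)%:E) (cst 0%E) (fun p => (g p)%:E).
- by move=> n; exact: measurable_sqr.
- by [].
- apply: aeW => p Op /=; apply: cvg_EFin; first exact: nearW.
  have h := cvgM (fc p Op) (fc p Op); rewrite mulr0 in h.
  rewrite (_ : fine \o _ = (fun n => f n p * f n p)); first exact: h.
  by apply/funext => n /=; rewrite expr2.
- exact: ig.
- apply: aeW => p n Op /=; rewrite lee_fin ger0_norm ?sqr_ge0// /g.
  case: ifPn => h; first by rewrite f0// expr0n.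
  have M0 : 0 <= M by apply: le_trans (fM n p Op).
  by rewrite -real_normK ?num_real// ler_pXn2r ?nnegrE// fM.
- by rewrite integral0.
Qed.

Lemma measurable_continuous_plane (f : R * R -> R) : continuous f ->
  measurable_fun (setT : set pl) f.
Proof. by move=> cf; apply: continuous_measurable_plane; [exact: openT|move=> p _; exact: cf]. Qed.

Lemma Lt_ge p : `|p.1| <= Lt l p.
Proof.
have [h|h] := leP (- r0 l * p.2) `|p.1|; first by rewrite Lt_out.
have cp : cone l p by exact/coneE.
have p2 := cone_lt0 l1 cp; have sr := cone_slope l1 cp.
have lc := l_cos_gt0 l1 (ang l p).
have tt : `|ang l p| <= th0 l by rewrite Ang_itv.
rewrite Lt_mm// (mm_in l1 (ltW sr)) mulrC -ler_pdivrMr ?oppr_gt0// -slope_norm//.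
rewrite -[X in `|X|](rr_Ang l1 (ltW sr)) -/(ang l p).
have -> : rr l (ang l p) = TT l (ang l p) * ih l (ang l p).
  rewrite /rr /TT /ih; field.
  by rewrite ?(gt_eqF (aa_gt0 l1)) ?(gt_eqF (sm_gt0 l1)) ?(gt_eqF lc).
have ih0 : 0 < ih l (ang l p) by rewrite invr_gt0 !mulr_gt0 ?aa_gt0 ?sm_gt0.
by rewrite normrM (gtr0_norm ih0) ler_piMl ?(ltW ih0)// TT_le1.
Qed.

(* [L >= 1] below the height [- depth], so that the candidate vanishes there. *)
Definition depth : R := (nmax l)^-1.

Lemma depth_gt0 : 0 < depth. Proof. by rewrite invr_gt0 nmax_gt0. Qed.

Lemma PP_ge1_deep p : p.2 < - depth -> 1 <= PP l p.
Proof.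
move=> h; have p2 : p.2 < 0 by rewrite (lt_trans h)// oppr_lt0 depth_gt0.
rewrite /PP expr_ge1 ?Lt_ge0// Lt_mm//.
have n0 := nmax_gt0 l1; rewrite -(mulVf (lt0r_neq0 n0)).
apply: ler_pM; [exact: ltW depth_gt0|exact: ltW|by rewrite lerNr ltW|exact: mm_ge].
Qed.

(** Makes the approximations [VV] vanish identically for [|y| >= 1], so that their lateral traces
    are exactly zero. *)
Lemma PP_ge1_wide p : 1 <= `|p.1| -> 1 <= PP l p.
Proof. by move=> h; rewrite /PP expr_ge1 ?Lt_ge0// (le_trans h)// Lt_ge. Qed.

Definition uu p : R := zeta * Num.max (1 - PP l p) 0.
(** The strict inequality assigns the value 0 on the kink [L = 1], which is also the limit of [eta]
    there; the smoothed gradients thus converge at every point. *)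
Definition gu p : R * R :=
  if PP l p < 1 then (- zeta * Py l p, - zeta * Pz l p) else (0, 0).

Let cn (n : nat) : R := n.+1%:R^-1.
Let cn_gt0 n : 0 < cn n. Proof. by rewrite invr_gt0. Qed.

(* [(Gy, Gz)] is the gradient of [zeta * Hs (1 - L^2)]; the factor [kappa] of [VV] equals
   [1] on [Omega] and makes the support compact. *)
Definition Gy n p : R := - zeta * eta (cn n) (1 - PP l p) * Py l p.
Definition Gz n p : R := - zeta * eta (cn n) (1 - PP l p) * Pz l p.
Definition VV n p : R := zeta * Hs (cn n) (1 - PP l p) * kappa p.2.

Lemma continuous_comp_1PP (f : R -> R) : continuous f -> continuous (fun p => f (1 - PP l p)).
Proof.
move=> cf p; apply: (@continuous_comp _ _ _ (fun p => 1 - PP l p) f); last exact: cf.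
by apply: cvgB; [exact: cvg_cst|exact: continuous_PP].
Qed.

Lemma continuous_comp_snd (f : R -> R) : continuous f -> continuous (fun p : R * R => f p.2).
Proof.
by move=> cf p; apply: (@continuous_comp _ _ _ (fun p : R * R => p.2) f); [exact: cvg_snd|exact: cf].
Qed.

Lemma continuous_uu : continuous uu.
Proof.
move=> p; apply: cvgM; first exact: cvg_cst.
apply: (@continuous_comp_1PP (fun s => Num.max s 0)) => s.
by apply: continuous_max; [exact: cvg_id|exact: cst_continuous].
Qed.

Lemma continuous_Gy n : continuous (Gy n).
Proof.
move=> p; apply: cvgM; last exact: continuous_Py.
apply: cvgM; first exact: cvg_cst.
by apply: continuous_comp_1PP; exact: continuous_eta.
Qed.

Lemma continuous_Gz n : continuous (Gz n).
Proof.
move=> p; apply: cvgM; last exact: continuous_Pz.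
apply: cvgM; first exact: cvg_cst.
by apply: continuous_comp_1PP; exact: continuous_eta.
Qed.

Let continuous_zH n : continuous (fun p => zeta * Hs (cn n) (1 - PP l p)).
Proof.
move=> p; apply: cvgM; first exact: cvg_cst.
by apply: continuous_comp_1PP; exact: continuous_Hs.
Qed.

Lemma continuous_VV n : continuous (VV n).
Proof.
move=> p; apply: cvgM; first exact: continuous_zH.
by apply: continuous_comp_snd; exact: continuous_kappa.
Qed.

Lemma is_derive_1PP_y y z : is_derive y 1 (fun t => 1 - PP l (t, z)) (- Py l (y, z)).
Proof.
apply: (is_derive1_eq (is_derive1B (is_derive1_cst 1 y) (is_derive_PP_y l1 y z))) => //.
by rewrite sub0r.
Qed.

Lemma is_derive_1PP_z y z : is_derive z 1 (fun t => 1 - PP l (y, t)) (- Pz l (y, z)).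
Proof.
apply: (is_derive1_eq (is_derive1B (is_derive1_cst 1 z) (is_derive_PP_z l1 y z))) => //.
by rewrite sub0r.
Qed.

Lemma is_derive_VV_y n y z :
  is_derive y 1 (fun t => VV n (t, z)) (Gy n (y, z) * kappa z).
Proof.
have d := is_derive1_comp' (is_derive_1PP_y y z) (is_derive_Hs (1 - PP l (y, z)) (cn_gt0 n)).
apply: (is_derive1_eq (is_derive1M (is_derive1Z zeta d) (is_derive1_cst (kappa z) y))) => //.
by rewrite /Gy; ring.
Qed.

Lemma is_derive_VV_z n y z : is_derive z 1 (fun t => VV n (y, t))
  (Gz n (y, z) * kappa z + zeta * Hs (cn n) (1 - PP l (y, z)) * dkappa z).
Proof.
have d := is_derive1_comp' (is_derive_1PP_z y z) (is_derive_Hs (1 - PP l (y, z)) (cn_gt0 n)).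
apply: (is_derive1_eq (is_derive1M (is_derive1Z zeta d) (is_derive_kappa z))) => //.
by rewrite /Gz; ring.
Qed.

Lemma dy_VV n : dy (VV n) = fun p => Gy n p * kappa p.2.
Proof.
apply/funext => -[y z]; rewrite /dy.
by have /is_derive_slice_y[_ ->] := is_derive_VV_y n y z.
Qed.

Lemma dz_VV n : dz (VV n) =
  fun p => Gz n p * kappa p.2 + zeta * Hs (cn n) (1 - PP l p) * dkappa p.2.
Proof.
apply/funext => -[y z]; rewrite /dz.
by have /is_derive_slice_z[_ ->] := is_derive_VV_z n y z.
Qed.

Lemma Ck1_VV n : Ck 1 (VV n).
Proof.
split.
- exact: continuous_VV.
- move=> [y z]; split.
  + by have /is_derive_slice_y[] := is_derive_VV_y n y z.
  + by have /is_derive_slice_z[] := is_derive_VV_z n y z.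
- rewrite dy_VV => p; apply: cvgM; first exact: continuous_Gy.
  by apply: continuous_comp_snd; exact: continuous_kappa.
- rewrite dz_VV => p; apply: cvgD; apply: cvgM.
  + exact: continuous_Gz.
  + by apply: continuous_comp_snd; exact: continuous_kappa.
  + exact: continuous_zH.
  + by apply: continuous_comp_snd; exact: continuous_dkappa.
Qed.

Lemma VV_eq0 n p : 1 <= PP l p -> VV n p = 0.
Proof. by move=> h; rewrite /VV /Hs pospart_le0 ?mulr0 ?mul0r// subr_le0. Qed.

Lemma compact_supp_VV n : compact (supp (VV n)).
Proof.
apply: (@subclosed_compact _ _ (`[-1, 1] `*` `[- depth, 1] : set (R * R))).
- exact: closed_closure.
- exact: compact_box.
- have cb : closed (`[-1, 1] `*` `[- depth, 1] : set (R * R)).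
    by apply: compact_closed; [exact: norm_hausdorff|exact: compact_box].
  rewrite [X in _ `<=` X]((closure_id _).1 cb); apply: closureS => p /= Vp.
  have [P1|P1] := leP 1 (PP l p); first by move: Vp; rewrite VV_eq0// eqxx.
  split; rewrite /= in_itv/=.
    rewrite -ler_norml leNgt; apply/negP => h.
    by move: P1; rewrite ltNge PP_ge1_wide// ltW.
  apply/andP; split.
    by rewrite leNgt; apply/negP => h; move: P1; rewrite ltNge PP_ge1_deep.
  rewrite leNgt; apply/negP => h; move: Vp; rewrite /VV kappa_ge1 ?mulr0 ?eqxx//.
  exact: ltW.
Qed.

Definition ind p : R := if PP l p < 1 then 1 else 0.

Lemma gu1E p : (gu p).1 = - zeta * ind p * Py l p.
Proof. by rewrite /gu /ind; case: ifP => _ /=; rewrite ?mulr1// mulr0 mul0r. Qed.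

Lemma gu2E p : (gu p).2 = - zeta * ind p * Pz l p.
Proof. by rewrite /gu /ind; case: ifP => _ /=; rewrite ?mulr1// mulr0 mul0r. Qed.

Lemma measurable_ind : measurable_fun (setT : set pl) ind.
Proof.
apply: measurable_fun_ifT => //; apply: measurable_fun_ltr => //.
by apply: measurable_continuous_plane; exact: continuous_PP.
Qed.

Let eta_ind_bound n p : `|eta (cn n) (1 - PP l p) - ind p| <= 1.
Proof.
have /andP[e0 e1] := eta_bound (1 - PP l p) (cn_gt0 n).
by rewrite /ind ler_norml; case: ifP => _; apply/andP; split; lra.
Qed.

Let eta_ind_cvg p : eta (cn n) (1 - PP l p) @[n --> \oo] --> ind p.
Proof.
rewrite /ind; have := @cvg_eta R (1 - PP l p); rewrite subr_le0 ltNge.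
by case: ifP.
Qed.

Lemma deep_box (Q : R * R -> R) : continuous Q ->
  exists2 M, 0 <= M & forall p, Omega p -> - depth <= p.2 -> `|Q p| <= M.
Proof.
move=> cQ; have [M M0 hM] := bounded_on_box (-1) 1 (- depth) 0 cQ.
exists M => // p [/andP[p1 p1'] p2] h; apply: hM; first by rewrite !ltW.
by rewrite h ltW.
Qed.

Lemma gradient_L2 (Q : R * R -> R) : continuous Q ->
  square_integrable leb2 Omega (fun p => - zeta * ind p * Q p).
Proof.
move=> cQ; have [M M0 hM] := deep_box cQ.
apply: (@box_L2 _ _ depth (`|zeta| * M)).
- apply: measurable_funTS; apply: measurable_funM; last exact: measurable_continuous_plane.
  by apply: measurable_funM => //; exact: measurable_ind.
- move=> p Op; have [h|h] := ltP p.2 (- depth).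
    by rewrite /ind ltNge PP_ge1_deep// mulr0 mul0r normr0 mulr_ge0.
  rewrite normrM ler_pM ?hM// normrM normrN /ind.
  by case: ifP => _; rewrite ?normr1 ?mulr1// normr0 mulr0.
- by move=> p Op h; rewrite /ind ltNge PP_ge1_deep// mulr0 mul0r.
Qed.

(** Dominated convergence on a bounded box, everything vanishing below [- depth]; applied with
    [Q = Py] and [Q = Pz]. *)
Lemma gradient_cvg (Q : R * R -> R) : continuous Q ->
  (\int[leb2]_(p in Omega) ((- zeta * eta (cn n) (1 - PP l p) * Q p -
     - zeta * ind p * Q p) ^+ 2)%:E @[n --> \oo] --> 0)%E.
Proof.
move=> cQ; have [M M0 hM] := deep_box cQ.
apply: (@box_L2_cvg0 _ depth (`|zeta| * M)).
- move=> n; apply: measurable_funTS; apply: measurable_funB; apply: measurable_funM.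
  + apply: measurable_funM => //; apply: measurable_continuous_plane.
    by apply: continuous_comp_1PP; exact: continuous_eta.
  + exact: measurable_continuous_plane.
  + by apply: measurable_funM => //; exact: measurable_ind.
  + exact: measurable_continuous_plane.
- move=> n p Op; have [h|h] := ltP p.2 (- depth).
    rewrite /ind ltNge PP_ge1_deep// /eta pospart_le0 ?subr_le0 ?PP_ge1_deep//.
    by rewrite mulr0 mul0r subr0 normr0 mulr_ge0.
  have -> : - zeta * eta (cn n) (1 - PP l p) * Q p - - zeta * ind p * Q p =
    - zeta * (eta (cn n) (1 - PP l p) - ind p) * Q p by ring.
  rewrite normrM ler_pM ?hM// normrM normrN -[leRHS]mulr1 ler_pM//.
- move=> n p Op h.
  rewrite /ind ltNge PP_ge1_deep// /eta pospart_le0 ?subr_le0 ?PP_ge1_deep//.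
  by rewrite mulr0 mul0r subr0.
- move=> p Op.
  have h : (fun n => - zeta * eta (cn n) (1 - PP l p) * Q p) @ \oo --> - zeta * ind p * Q p.
    by apply: cvgM; [apply: cvgM; [exact: cvg_cst|exact: eta_ind_cvg]|exact: cvg_cst].
  have hh := cvgB h (cvg_cst (- zeta * ind p * Q p)); rewrite subrr in hh.
  exact: hh.
Qed.

Let uu_bound p : `|uu p| <= `|zeta|.
Proof.
rewrite /uu normrM ler_piMr// ger0_norm ?le_max ?lexx ?orbT//.
by rewrite ge_max ler01 andbT gerBl sqr_ge0.
Qed.

Let uu_deep p : p.2 < - depth -> uu p = 0.
Proof. by move=> h; rewrite /uu max_r ?mulr0// subr_le0 PP_ge1_deep. Qed.

Lemma uu_L2 : square_integrable leb2 Omega uu.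
Proof.
apply: (@box_L2 _ _ depth `|zeta|) => //.
- by apply: measurable_funTS; apply: measurable_continuous_plane; exact: continuous_uu.
- by move=> p _; exact: uu_deep.
Qed.

Lemma VV_cvg : (\int[leb2]_(p in Omega) ((VV n p - uu p) ^+ 2)%:E @[n --> \oo] --> 0)%E.
Proof.
have VE n p : Omega p -> VV n p = zeta * Hs (cn n) (1 - PP l p).
  by move=> [_ p2]; rewrite /VV kappa_le0 ?mulr1// ltW.
apply: (@box_L2_cvg0 _ depth `|zeta|).
- move=> n; apply: measurable_funTS; apply: measurable_funB; apply: measurable_continuous_plane.
    exact: continuous_VV.
  exact: continuous_uu.
- move=> n p Op; rewrite VE// /uu -mulrBr normrM ler_piMr//.
  have /andP[h0 h1] := Hs_bound (1 - PP l p) (cn_gt0 n).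
  have : Num.max (1 - PP l p) 0 <= 1 by rewrite ge_max ler01 andbT gerBl sqr_ge0.
  move: h1; move: (Num.max _ _) => m h1 h2.
  by rewrite ler_norml; apply/andP; split; lra.
- by move=> n p Op h; rewrite uu_deep// VV_eq0 ?subr0// PP_ge1_deep.
- move=> p Op; rewrite -(subrr (uu p)); apply: cvgB; last exact: cvg_cst.
  rewrite (_ : (fun n => VV n p) = (fun n => zeta * Hs (cn n) (1 - PP l p))).
    by apply: cvgM; [exact: cvg_cst|exact: cvg_Hs].
  by apply/funext => n; rewrite VE.
Qed.

Lemma Gy_cvg : (\int[leb2]_(p in Omega) ((Gy n p - (gu p).1) ^+ 2)%:E @[n --> \oo] --> 0)%E.
Proof.
have := gradient_cvg (continuous_Py l1); apply: cvg_trans; apply: near_eq_cvg.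
by apply: nearW => n; apply: eq_integral => p _; rewrite gu1E.
Qed.

Lemma Gz_cvg : (\int[leb2]_(p in Omega) ((Gz n p - (gu p).2) ^+ 2)%:E @[n --> \oo] --> 0)%E.
Proof.
have := gradient_cvg (continuous_Pz l1); apply: cvg_trans; apply: near_eq_cvg.
by apply: nearW => n; apply: eq_integral => p _; rewrite gu2E.
Qed.

Lemma gu1_L2 : L2 (fst \o gu).
Proof.
have -> : fst \o gu = (fun p => - zeta * ind p * Py l p) by apply/funext => p; exact: gu1E.
exact: gradient_L2 (continuous_Py l1).
Qed.

Lemma gu2_L2 : L2 (snd \o gu).
Proof.
have -> : snd \o gu = (fun p => - zeta * ind p * Pz l p) by apply/funext => p; exact: gu2E.
exact: gradient_L2 (continuous_Pz l1).
Qed.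

End Membership.

(** * Trace and weak gradient of the candidate *)

Section USection.
Context {R : realType}.
Notation mu := (@lebesgue_measure R).
Notation pl := (measurableTypeR R * measurableTypeR R)%type.
Variables (l zeta : R).
Hypothesis l1 : 1 < l.
Implicit Types (p : R * R) (y z : R).
Notation depth := (depth l).
Notation uu := (uu l zeta).
Notation gu := (gu l zeta).
Notation VV := (VV l zeta).
Let cn (n : nat) : R := n.+1%:R^-1.

Let cvg_integral_eq (f g : nat -> R * R -> R) :
  (forall n p, Omega p -> f n p = g n p) ->
  (\int[leb2]_(p in Omega) (f n p)%:E @[n --> \oo] --> 0)%E ->
  (\int[leb2]_(p in Omega) (g n p)%:E @[n --> \oo] --> 0)%E.
Proof.
move=> fg h; rewrite (_ : (fun n => _) = (fun n => \int[leb2]_(p in Omega) (f n p)%:E))%E; first exact: h.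
by apply/funext => n; apply: eq_integral => p; rewrite inE => Op; rewrite fg.
Qed.

Section u.
Variable u : R * R -> R.
Hypothesis uE : forall p, Omega p -> u p = uu p.

Lemma u_L2 : L2 u.
Proof.
have [m1 m2] := @uu_L2 R l zeta l1; split.
  by apply: eq_measurable_fun m1 => p; rewrite inE => Op; rewrite uE.
suff -> : (\int[leb2]_(p in Omega) ((u p) ^+ 2)%:E = \int[leb2]_(p in Omega) ((uu p) ^+ 2)%:E)%E by [].
by apply: eq_integral => p; rewrite inE => Op; rewrite uE.
Qed.

Lemma u_trace : lateral_trace u gu (cst 0) (cst 0).
Proof.
split; [exact: measurable_cst|exact: measurable_cst|].
have wide c : `|c| = 1 -> (\int[mu]_(z in `]-oo, 0%R[)
    ((VV n (c, z) - cst 0 z) ^+ 2)%:E @[n --> \oo] --> 0)%E.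
  move=> c1; rewrite (_ : (fun n => _) = (fun n => 0%E)); first exact: cvg_cst.
  apply/funext => n; rewrite -[RHS](integral0 mu (`]-oo, 0[ : set R)).
  apply: eq_integral => z _; rewrite VV_eq0 ?subr0 ?expr0n//.
  by apply: PP_ge1_wide => //=; rewrite c1.
exists VV; split; first by move=> n; split; [exact: Ck1_VV|exact: compact_supp_VV].
split.
- apply: cvg_integral_eq (@VV_cvg R l zeta l1) => n p Op.
  by rewrite uE.
- apply: cvg_integral_eq (@Gy_cvg R l zeta l1) => n p [_ p2].
  by rewrite dy_VV// kappa_le0 ?mulr1// ltW.
- apply: cvg_integral_eq (@Gz_cvg R l zeta l1) => n p [_ p2].
  rewrite dz_VV// kappa_le0 ?mulr1 ?(ltW p2)//.
  by rewrite /dkappa /dsq [pospart _ p.2]pospart_le0 ?(ltW p2)// mul0r oppr0 mulr0 addr0.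
- by apply: wide; rewrite normrN1.
- by apply: wide; rewrite normr1.
Qed.

(** Integration by parts with the roles exchanged: [psi] is the smooth field and [u] the function
    with zero trace, whose approximations [u_trace] supplies. The kinks of [u] are never met. *)
Lemma u_weak_gradient : weak_gradient u gu.
Proof.
move=> psi [spsi kpsi spO]; have C1 := spsi 1%N.
have [cpsi cy cz dpy dpz] := Ck1P C1.
have psi0 p : ~ Omega p -> psi p = 0.
  move=> nO; apply/eqP; apply: contrapT => /negP h; apply: nO; apply: spO.
  by apply: subset_closure; exact: h.
(* The compact support of [psi] provides the depth below which the field vanishes. *)
have [N N0 hN] : exists2 N : R, 0 <= N & forall p, supp psi p -> - N <= p.2.
  have cs : continuous (snd : R * R -> R) by move=> p; exact: cvg_snd.
  have := continuous_compact (continuous_subspaceT cs) kpsi.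
  move=> /compact_bounded[M [_ hM]]; exists (`|M| + 1); first by rewrite addr_ge0.
  move=> p sp; have : `|p.2| <= `|M| + 1.
    apply: (hM (`|M| + 1)); last by exists p.
    by rewrite (le_lt_trans (ler_norm M))// ltrDl.
  by rewrite ler_norml => /andP[].
have psiN p : p.2 < - N -> psi p = 0.
  move=> h; apply/eqP; apply: contrapT => /negP h'; move: h; rewrite ltNge hN//.
  by apply: subset_closure; exact: h'.
have bnd (f : R * R -> R) : continuous f -> (forall p : R * R, p.2 < - N -> f p = 0) ->
    exists M, forall p, Omega p -> `|f p| <= M.
  move=> cf f0; have [M M0 hM] := bounded_on_box (-1) 1 (- N) 0 cf.
  exists M => p [/andP[p1 p1'] p2]; have [h|h] := ltP p.2 (- N); first by rewrite f0// normr0.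
  by apply: hM; [rewrite !ltW|rewrite h ltW].
have dyN p : p.2 < - N -> dy psi p = 0.
  case: p => y z /= h; have := dpy y z.
  have -> : (fun t => psi (t, z)) = (fun=> 0) by apply/funext => t; exact: psiN.
  by move=> [_ <-]; exact: (@derive_val _ _ _ _ _ _ _ (is_derive1_cst 0 y)).
have dzN p : p.2 < - N -> dz psi p = 0.
  case: p => y z /= h; have d := dpz y z.
  have : is_derive z 1 (fun t => psi (y, t)) 0.
    apply: (is_derive1_near (is_derive1_cst 0 z)); near=> t.
    by rewrite psiN//=; near: t; exact: lt_nbhsl.
  by move=> [_ <-]; case: d => _ <-.
have [By hBy] := bnd _ cy dyN; have [Bz hBz] := bnd _ cz dzN.
have my := measurable_Omega_continuous cy.
have mz := measurable_Omega_continuous cz.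
have mO := @measurable_Omega R.
have oN (a b : \bar R) : a \is a fin_num -> (a + b = 0 -> b = - a)%E.
  by case: a b => [a| |] [b| |]//= _ [] /eqP; rewrite addrC addr_eq0 => /eqP ->.
have split_ibp (h f : R * R -> R) : leb2.-integrable Omega (fun p => (psi p * h p)%:E) ->
    leb2.-integrable Omega (fun p => (f p * u p)%:E) ->
    (\int[leb2]_(p in Omega) (psi p * h p + f p * u p)%:E = 0)%E ->
    (\int[leb2]_(p in Omega) (u p * f p)%:E = - \int[leb2]_(p in Omega) (h p * psi p)%:E)%E.
  move=> i1 i2; under eq_integral do rewrite EFinD.
  rewrite integralD// => E.
  under eq_integral do rewrite mulrC.
  under [in RHS]eq_integral do rewrite mulrC.
  by apply: oN E; exact: integrable_fin_num.
split; [apply: (split_ibp (fst \o gu) (dy psi))|apply: (split_ibp (snd \o gu) (dz psi))].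
- exact: (field_integrable1 cpsi psiN (gu1_L2 zeta l1)).
- exact: (field_integrable0 my hBy (fun p _ => @dyN p) u_L2).
- by apply: (ibp_y cpsi my hBy psiN (fun p _ => @dyN p) u_L2 (gu1_L2 zeta l1) u_trace (s := fun=> [::])).
- exact: (field_integrable2 cpsi psiN (gu2_L2 zeta l1)).
- exact: (field_integrable0 mz hBz (fun p _ => @dzN p) u_L2).
- apply: (ibp_z N0 cpsi mz hBz psiN (fun p _ => @dzN p) u_L2 (gu2_L2 zeta l1) u_trace (s := fun=> [::])) => //.
  (* Points with [z = 0] are outside Omega, hence outside the support of [psi]. *)
  by move=> y _; apply: psi0 => -[_ /=]; rewrite ltxx.
Unshelve. all: by end_near. Qed.

Lemma u_inX : inX u gu.
Proof.
have weighted (Q : R * R -> R) : continuous Q ->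
    leb2.-integrable Omega (fun p => (p.2 * (- zeta * ind l p * Q p))%:E).
  move=> cQ; have [M M0 hM] := bounded_on_box (-1) 1 (- depth) 0 cQ.
  have deep p : p.2 < - depth -> ind l p = 0 by move=> h; rewrite /ind ltNge PP_ge1_deep.
  apply: (@box_integrable _ _ depth (depth * (`|zeta| * 1 * M))).
  - apply: measurable_funTS; apply: measurable_funM; first exact: measurable_snd.
    apply: measurable_funM; last exact: measurable_continuous_plane.
    by apply: measurable_funM => //; exact: measurable_ind.
  - move=> p [/andP[p1 p1'] p2]; have [h|h] := ltP p.2 (- depth).
      by rewrite deep// mulr0 mul0r mulr0 normr0 !mulr_ge0// ltW ?depth_gt0.
    rewrite normrM ler_pM// ?(ler0_norm (ltW p2)) 1?lerNl//.
    rewrite normrM ler_pM//; last by apply: hM; [rewrite !ltW|rewrite h ltW].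
    by rewrite normrM normrN ler_pM// /ind; case: ifP => _; rewrite ?normr1 ?normr0.
  - by move=> p Op h; rewrite deep// mulr0 mul0r mulr0.
split.
- by split; [exact: u_L2|exact: gu1_L2|exact: gu2_L2|exact: u_weak_gradient].
- exact: u_trace.
- by under eq_fun do rewrite gu1E; apply: weighted; exact: continuous_Py.
- by under eq_fun do rewrite gu2E; apply: weighted; exact: continuous_Pz.
Qed.

End u.
End USection.

(** * The direction field: measurability, norm and alignment with the gradient *)

Section Vector.
Context {R : realType}.
Notation pl := (measurableTypeR R * measurableTypeR R)%type.
Variable l : R.
Hypothesis l1 : 1 < l.
Implicit Types (p : R * R) (y z t : R).

Lemma measurable_lt0_continuous (f : R * R -> R) :
  (forall p, p.2 < 0 -> {for p, continuous f}) -> measurable_fun (Omega : set pl) f.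
Proof.
move=> cf; apply: continuous_measurable_plane; first exact: open_Omega.
by move=> p [_ p2]; exact: cf.
Qed.

Let continuous_l_cos : continuous (fun t => l + cos t).
Proof. by move=> t; apply: cvgD; [exact: cvg_cst|exact: continuous_cos]. Qed.

Let continuous_D : continuous (D_ l).
Proof.
move=> t; rewrite /D_; apply: cvgD; first apply: cvgD.
- exact: cvg_cst.
- by apply: cvgM; [exact: cvg_cst|exact: continuous_cos].
- by apply: cvgM; [exact: cvg_id|exact: continuous_sin].
Qed.

Let continuous_sqr (f : R -> R) t : {for t, continuous f} -> {for t, continuous (fun s => f s ^+ 2)}.
Proof. by move=> cf; apply: (@continuous_comp _ _ _ f (fun x => x ^+ 2) t cf); exact: exprn_continuous. Qed.

Let continuous_dTh t : `|t| <= th0 l -> {for t, continuous (dTh l)}.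
Proof.
move=> tt; apply: cvgM; first apply: cvgM.
- exact: cvg_cst.
- exact: (continuous_sqr (@continuous_l_cos t)).
- by apply: cvgV; [exact: (D_neq0 l1 tt)|exact: continuous_D].
Qed.

Let continuous_ee' t : `|t| <= th0 l -> {for t, continuous (ee' l)}.
Proof.
move=> tt; apply: cvgM; first exact: (continuous_sqr (@continuous_l_cos t)).
apply: cvgV; first by rewrite mulf_neq0 ?expf_neq0 ?D_neq0// gt_eqF// aa_gt0.
by apply: cvgM; [exact: cvg_cst|exact: (continuous_sqr (@continuous_D t))].
Qed.

Let continuous_inv_sqr t : {for t, continuous (fun s => ((l + cos s) ^+ 2)^-1)}.
Proof.
apply: cvgV; first by rewrite expf_neq0// gt_eqF// l_cos_gt0.
exact: (continuous_sqr (@continuous_l_cos t)).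
Qed.

Let continuous_dQ1 t : {for t, continuous (dQ1 l)}.
Proof.
apply: cvgM; last exact: continuous_inv_sqr.
apply: cvgN; apply: cvgM; first exact: cvg_cst.
apply: cvgD; first exact: cvg_cst.
by apply: cvgM; [exact: cvg_cst|exact: continuous_cos].
Qed.

Let continuous_dQ2 t : {for t, continuous (dQ2 l)}.
Proof.
apply: cvgM; last exact: continuous_inv_sqr.
by apply: cvgN; apply: cvgM; [exact: cvg_cst|exact: continuous_sin].
Qed.

(** [chain] may jump at the boundary of the cone; on Omega it is the indicator of the cone times a
    continuous function of [ang]. *)
Lemma measurable_chain (G' : R -> R) :
  (forall t, `|t| <= th0 l -> {for t, continuous G'}) ->
  measurable_fun (Omega : set pl) (fun p => chain l G' (slope p)).
Proof.
move=> cG; apply: (@eq_measurable_fun _ _ _ _ _ (fun p : pl =>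
  (if `|p.1| < - r0 l * p.2 then 1 else 0) * (G' (ang l p) * dTh l (ang l p)))).
  move=> p; rewrite inE => -[_ p2]; rewrite /chain slope_lt//.
  by case: ifP => _; rewrite ?mul1r// mul0r.
apply: measurable_funM.
  apply: measurable_funTS; apply: measurable_fun_ifT => //.
  apply: measurable_fun_ltr.
    by apply: measurableT_comp => //; exact: measurable_fst.
  by apply: measurable_funM => //; exact: measurable_snd.
apply: measurable_lt0_continuous => p p2; apply: cvgM.
  by apply: continuous_at_ang => //; apply: cG; exact: Ang_itv.
by apply: continuous_at_ang => //; apply: continuous_dTh; exact: Ang_itv.
Qed.

Let measurable_slope : measurable_fun (Omega : set pl) (fun p : pl => slope (p : R * R)).
Proof. by apply: measurable_lt0_continuous; exact: continuous_slope. Qed.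

Let measurable_mm_slope : measurable_fun (Omega : set pl) (fun p : pl => mm l (slope (p : R * R))).
Proof.
apply: measurable_lt0_continuous => p p2; apply: continuous_at_slope => //.
exact: continuous_mm.
Qed.

Lemma measurable_Pyy : measurable_fun (Omega : set pl) (Pyy l).
Proof.
apply: measurable_funD; apply: measurable_funM.
- exact: measurable_cst.
- apply: measurable_funX; apply: measurable_lt0_continuous => p p2.
  exact: ee_ang_continuous.
- by apply: measurable_funM; [exact: measurable_cst|exact: measurable_mm_slope].
- exact: measurable_chain continuous_ee'.
Qed.

Lemma measurable_Pzz : measurable_fun (Omega : set pl) (Pzz l).
Proof.
apply: measurable_funD; apply: measurable_funM.
- exact: measurable_cst.
- apply: measurable_funX; apply: measurable_lt0_continuous => p p2.
  exact: nn_ang_continuous.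
- apply: measurable_funM; last by apply: measurable_funX; exact: measurable_slope.
  by apply: measurable_funM; [exact: measurable_cst|exact: measurable_mm_slope].
- exact: measurable_chain continuous_ee'.
Qed.

Lemma measurable_Fq1y : measurable_fun (Omega : set pl) (Fq1y l).
Proof. exact: (measurable_chain (fun t _ => @continuous_dQ1 t)). Qed.

Lemma measurable_Q2_ang : measurable_fun (Omega : set pl) (fun p : pl => Q2 l (ang l p)).
Proof. by apply: measurable_lt0_continuous => p p2; exact: Q2_ang_continuous. Qed.

Lemma measurable_Q1_ang : measurable_fun (Omega : set pl) (fun p : pl => Q1 l (ang l p)).
Proof. by apply: measurable_lt0_continuous => p p2; exact: Q1_ang_continuous. Qed.

Lemma measurable_Fq2z : measurable_fun (Omega : set pl) (Fq2z l).
Proof.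
apply: measurable_funD.
  by apply: measurableT_comp => //; exact: measurable_Q2_ang.
apply: measurable_funM; first exact: measurable_slope.
exact: (measurable_chain (fun t _ => @continuous_dQ2 t)).
Qed.

Lemma bounded_L2loc (f : R * R -> R) (M : R) :
  measurable_fun (Omega : set pl) f -> (forall p, Omega p -> `|f p| <= M) -> L2loc f.
Proof.
move=> mf fM; split => // A kA AO.
have mA : measurable (A : set pl).
  by apply: closed_measurable_plane; apply: compact_closed => //; exact: norm_hausdorff.
have [N [_ hN]] := compact_bounded kA.
pose B := `|N| + 1.
have AB : A `<=` (`[- B, B] `*` `[- B, B] : set (R * R)).
  move=> p Ap; have : `|p| <= B by apply: (hN B) => //; rewrite (le_lt_trans (ler_norm N))// ltrDl.
  rewrite prod_normE ge_max => /andP[]; rewrite !ler_norml => h1 h2.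
  by split; rewrite /= in_itv/=.
have B0 : 0 <= B by rewrite addr_ge0.
have fA : (leb2 (A : set pl) < +oo)%E.
  apply: (@le_lt_trans _ _ (leb2 (`[- B, B] `*` `[- B, B] : set pl))).
    apply: le_measure; rewrite ?inE//; apply: measurableX; exact: measurable_itv.
  by rewrite leb2_box ?ltry//; move: B0; lra.
apply: (@le_lt_trans _ _ (\int[leb2]_(p in A) (M ^+ 2)%:E)%E).
  apply: ge0_le_integral => //.
  - by move=> p _; rewrite lee_fin sqr_ge0.
  - by apply/measurable_EFinP; apply: measurable_funX; exact: (measurable_funS (@measurable_Omega R) AO mf).
  - move=> p /AO Op; rewrite lee_fin -real_normK ?num_real//.
    have := fM p Op; have := normr_ge0 (f p); move: `|f p| => a a0 aM.
    by rewrite ler_pXn2r ?nnegrE// (le_trans a0).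
by rewrite integral_cst// ltey_eq fin_numM// ge0_fin_numE.
Qed.

Lemma dext_inLambda : inLambda (dext l).
Proof.
have Q p : Omega p -> `|(dext l p).1| <= 1 /\ `|(dext l p).2| <= 1.
  by move=> Op; rewrite dext_E//; exact: Q_ang_le1.
split.
- apply: (@bounded_L2loc _ 1); last by move=> p /Q[].
  by apply: eq_measurable_fun measurable_Q1_ang => p; rewrite inE => Op /=; rewrite dext_E.
- apply: (@bounded_L2loc _ 1); last by move=> p /Q[].
  by apply: eq_measurable_fun measurable_Q2_ang => p; rewrite inE => Op /=; rewrite dext_E.
- by apply: aeW => p Op; rewrite dext_E// /enorm /dot /= -!expr2 Q12// sqrtr1.
Qed.

Variable zeta : R.
Hypothesis zeta0 : 0 < zeta.

Lemma dext_gu p : Omega p -> dot (dext l p) (gu l zeta p) = enorm (gu l zeta p).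
Proof.
move=> Op; have [_ p2] := Op; rewrite dext_E// /gu; case: ifP => _; last first.
  by rewrite /enorm /dot /= !mulr0 addr0 sqrtr0.
have D0 : D_ l (ang l p) != 0 by apply: D_neq0 => //; exact: Ang_itv.
have Dp : 0 < D_ l (ang l p).
  by apply: lt_le_trans (D_ge l1 (Ang_itv l1 _)); rewrite divr_gt0 ?(lt_trans _ l1)// subr_gt0 exprn_egt1.
pose k := zeta * 2 * Lt l p * ((l + cos (ang l p)) / (aa l * sm l * D_ l (ang l p))).
have k0 : 0 <= k.
  apply: mulr_ge0; first by rewrite !mulr_ge0 ?Lt_ge0// ltW.
  by rewrite divr_ge0 ?mulr_ge0 ?(ltW (aa_gt0 l1)) ?(ltW (sm_gt0 l1)) ?(ltW Dp) ?(ltW (l_cos_gt0 l1 _)).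
have -> : - zeta * Py l p = k * Q1 l (ang l p).
  by rewrite /Py p2 ee_Q1// /k; ring.
have -> : - zeta * Pz l p = k * Q2 l (ang l p).
  by rewrite /Pz p2 nn_Q2// /k; ring.
rewrite /enorm /dot /=.
have -> : k * Q1 l (ang l p) * (k * Q1 l (ang l p)) + k * Q2 l (ang l p) * (k * Q2 l (ang l p)) =
  k ^+ 2 * (Q1 l (ang l p) ^+ 2 + Q2 l (ang l p) ^+ 2) by ring.
rewrite Q12// mulr1 sqrtr_sqr ger0_norm//.
have -> : Q1 l (ang l p) * (k * Q1 l (ang l p)) + Q2 l (ang l p) * (k * Q2 l (ang l p)) =
  k * (Q1 l (ang l p) ^+ 2 + Q2 l (ang l p) ^+ 2) by ring.
by rewrite Q12// mulr1.
Qed.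

End Vector.

(** * The differential inequality *)

Section Inequality.
Context {R : realType}.
Notation pl := (measurableTypeR R * measurableTypeR R)%type.
Variables (phi : R * R -> R) (g : R * R -> R * R).
Hypothesis Xphi : inX phi g.
Hypothesis phi_ge0 : ae_nonneg phi.
Implicit Types (p : R * R) (y z : R).

Let mO := @measurable_Omega R.

Let L2phi : L2 phi. Proof. by case: Xphi => -[]. Qed.
Let L2g1 : L2 (fst \o g). Proof. by case: Xphi => -[]. Qed.
Let L2g2 : L2 (snd \o g). Proof. by case: Xphi => -[]. Qed.
Let mphi : measurable_fun (Omega : set pl) phi. Proof. by case: L2phi. Qed.

(** [phi] is nonnegative only almost everywhere; passing to [|phi|] allows pointwise comparison of
    integrands. *)
Lemma integral_ae_norm (w : R * R -> R) : measurable_fun (Omega : set pl) w ->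
  (\int[leb2]_(p in Omega) (w p * phi p)%:E = \int[leb2]_(p in Omega) (w p * `|phi p|)%:E)%E.
Proof.
move=> mw; apply: ae_eq_integral => //.
- by apply/measurable_EFinP; apply: measurable_funM.
- by apply/measurable_EFinP; apply: measurable_funM => //; exact: measurableT_comp.
- apply: (@filterS _ _ (ae_filter_ringOfSetsType leb2) _ _ _ phi_ge0) => p h Op;
  by rewrite ger0_norm// h.
Qed.

Lemma ae_le_integral (v w : R * R -> R) :
  measurable_fun (Omega : set pl) v -> measurable_fun (Omega : set pl) w ->
  leb2.-integrable Omega (fun p => (v p * phi p)%:E) ->
  leb2.-integrable Omega (fun p => (w p * phi p)%:E) ->
  (forall p, Omega p -> v p <= w p) ->
  (\int[leb2]_(p in Omega) (v p * phi p)%:E <= \int[leb2]_(p in Omega) (w p * phi p)%:E)%E.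
Proof.
move=> mv mw iv iw vw; rewrite !integral_ae_norm//.
have norm_int (h : R * R -> R) : measurable_fun (Omega : set pl) h ->
    leb2.-integrable Omega (fun p => (h p * phi p)%:E) ->
    leb2.-integrable Omega (fun p => (h p * `|phi p|)%:E).
  move=> mh; apply: le_integrable => //.
    by apply/measurable_EFinP; apply: measurable_funM => //; exact: measurableT_comp.
  by move=> p Op; rewrite lee_fin /= !normrM normr_id.
apply: le_integral => //; [exact: norm_int|exact: norm_int|].
by move=> p; rewrite inE => Op; rewrite lee_fin ler_wpM2r// vw.
Qed.

Section Field.
Variables (F1 F2 d1 d2 w : R * R -> R) (N B1 B2 : R) (s1 s2 : R -> seq R).
Hypothesis N0 : 0 <= N.
Hypothesis cF1 : continuous F1.
Hypothesis cF2 : continuous F2.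
Hypothesis md1 : measurable_fun (Omega : set pl) d1.
Hypothesis md2 : measurable_fun (Omega : set pl) d2.
Hypothesis d1B : forall p, Omega p -> `|d1 p| <= B1.
Hypothesis d2B : forall p, Omega p -> `|d2 p| <= B2.
Hypothesis F1N : forall p, p.2 < - N -> F1 p = 0.
Hypothesis F2N : forall p, p.2 < - N -> F2 p = 0.
Hypothesis d1N : forall p, Omega p -> p.2 < - N -> d1 p = 0.
Hypothesis d2N : forall p, Omega p -> p.2 < - N -> d2 p = 0.
Hypothesis F20 : forall y, -1 < y < 1 -> F2 (y, 0) = 0.
Hypothesis dF1 : forall y z, z < 0 -> -1 < y < 1 -> y \notin s1 z ->
  is_derive y 1 (fun t => F1 (t, z)) (d1 (y, z)).
Hypothesis dF2 : forall y z, z < 0 -> -1 < y < 1 -> z \notin s2 y ->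
  is_derive z 1 (fun t => F2 (y, t)) (d2 (y, z)).
Hypothesis mw : measurable_fun (Omega : set pl) w.
Hypothesis iw : leb2.-integrable Omega (fun p => (w p * phi p)%:E).
Hypothesis dw : forall p, Omega p -> - (d1 p + d2 p) <= w p.

Lemma integrable_field_dot :
  leb2.-integrable Omega (fun p => (F1 p * (g p).1 + F2 p * (g p).2)%:E).
Proof.
have := integrableD mO (field_integrable1 cF1 F1N L2g1) (field_integrable2 cF2 F2N L2g2).
by apply: eq_integrable.
Qed.

(** The weak form of [- div (F1, F2) <= w], shared by the diffusion and transport terms. The
    condition [F20] stands in for the boundary condition that [phi] lacks at the top. *)
Lemma field_dot_le : (\int[leb2]_(p in Omega) (F1 p * (g p).1 + F2 p * (g p).2)%:E <=
  \int[leb2]_(p in Omega) (w p * phi p)%:E)%E.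
Proof.
have [_ tr _ _] := Xphi.
have E1 := ibp_y cF1 md1 d1B F1N d1N L2phi L2g1 tr dF1.
have E2 := ibp_z N0 cF2 md2 d2B F2N d2N L2phi L2g2 tr F20 dF2.
have j1 := field_integrable0 md1 d1B d1N L2phi.
have j2 := field_integrable0 md2 d2B d2N L2phi.
have i1 := field_integrable1 cF1 F1N L2g1.
have i2 := field_integrable2 cF2 F2N L2g2.
have iv : leb2.-integrable Omega (fun p => (- (d1 p + d2 p) * phi p)%:E).
  have := integrableN (integrableD mO j1 j2); apply: eq_integrable => // p _ /=.
  by rewrite -mulrDl mulNr; congr (_%:E).
suff -> : (\int[leb2]_(p in Omega) (F1 p * (g p).1 + F2 p * (g p).2)%:E =
    \int[leb2]_(p in Omega) (- (d1 p + d2 p) * phi p)%:E)%E.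
  apply: ae_le_integral => //; apply: measurableT_comp => //; exact: measurable_funD.
have oE (a b : \bar R) : b \is a fin_num -> (a - b = 0 -> a = b)%E.
  by case: a b => [a| |] [b| |]//= _ [] /eqP; rewrite subr_eq0 => /eqP ->.
apply: oE; first exact: integrable_fin_num.
apply/eqP; rewrite -integralB//; last exact: integrable_field_dot.
rewrite -[X in _ == X]add0e -{1}E1 -E2 -integralD//.
- apply/eqP; apply: eq_integral => p _; rewrite -EFinB -EFinD; congr (_%:E); ring.
- by have := integrableD mO i1 j1; apply: eq_integrable.
- by have := integrableD mO i2 j2; apply: eq_integrable.
Qed.

End Field.
End Inequality.

(** * The diffusion term *)

Section Estimates.
Context {R : realType}.
Notation pl := (measurableTypeR R * measurableTypeR R)%type.
Variables (l zeta c : R).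
Hypothesis l1 : 1 < l.
Hypothesis zeta0 : 0 < zeta.
Hypothesis c0 : 0 <= c.
Hypothesis Lc : LLaplacian_bounded l c.
Variables (phi : R * R -> R) (g : R * R -> R * R).
Hypothesis Xphi : inX phi g.
Hypothesis phi_ge0 : ae_nonneg phi.
Hypothesis iphi : leb2.-integrable Omega (fun p => (phi p)%:E).
Implicit Types (p : R * R) (y z : R).

Let mO := @measurable_Omega R.
Let cn (n : nat) : R := n.+1%:R^-1.
Let cn_gt0 n : 0 < cn n. Proof. by rewrite invr_gt0. Qed.
Let L2g1 : L2 (fst \o g). Proof. by case: Xphi => -[]. Qed.
Let L2g2 : L2 (snd \o g). Proof. by case: Xphi => -[]. Qed.
Let mphi : measurable_fun (Omega : set pl) phi. Proof. by case: Xphi => -[[]]. Qed.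

Let bounded_mul_integrable (w : R * R -> R) (M : R) : measurable_fun (Omega : set pl) w ->
  (forall p, Omega p -> `|w p| <= M) -> leb2.-integrable Omega (fun p => (w p * phi p)%:E).
Proof.
move=> mw wM; have := integrableZl mO M iphi; apply: le_integrable => //.
  by apply/measurable_EFinP; apply: measurable_funM.
move=> p Op; rewrite lee_fin /= !normrM ler_wpM2r//.
by rewrite (le_trans (wM p Op))// ler_norm.
Qed.

(* With [(Q, QQ) = (Py, Pyy)] or [(Pz, Pzz)], the diagonal second derivatives of the
   smoothed candidate. *)
Definition dG (Q QQ : R * R -> R) n p : R :=
  - zeta * (eta (cn n) (1 - PP l p) * QQ p - deta (cn n) (1 - PP l p) * Q p ^+ 2).

Section Component.
Variables Q QQ : R * R -> R.
Hypothesis cQ : continuous Q.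
Hypothesis mQQ : measurable_fun (Omega : set pl) QQ.
Hypothesis QQ_bound : exists M, forall p, `|QQ p| <= M.

Lemma dG_deep n p : p.2 < - depth l -> dG Q QQ n p = 0.
Proof.
move=> h; have P1 : 1 - PP l p <= 0 by rewrite subr_le0 PP_ge1_deep.
by rewrite /dG /eta /deta !pospart_le0// !mul0r subr0 mulr0.
Qed.

Lemma continuous_deta_Q n : continuous (fun p => deta (cn n) (1 - PP l p) * Q p ^+ 2).
Proof.
move=> p; apply: cvgM.
  by apply: (continuous_comp_1PP l1); exact: continuous_deta.
by apply: (@continuous_comp _ _ _ Q (fun x => x ^+ 2)); [exact: cQ|exact: exprn_continuous].
Qed.

Lemma measurable_dG n : measurable_fun (Omega : set pl) (dG Q QQ n).
Proof.
apply: measurable_funM => //; apply: measurable_funB.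
  apply: measurable_funM => //; apply: measurable_Omega_continuous.
  by apply: (continuous_comp_1PP l1); exact: continuous_eta.
by apply: measurable_Omega_continuous; exact: continuous_deta_Q.
Qed.

Lemma dG_bound n : exists M, forall p, Omega p -> `|dG Q QQ n p| <= M.
Proof.
have [M1 hM1] := QQ_bound; have [M2 M20 hM2] := deep_box l (@continuous_deta_Q n).
have M10 : 0 <= M1 by apply: le_trans (hM1 0).
exists (`|zeta| * (1 * M1 + M2)) => p Op; have [h|h] := ltP p.2 (- depth l).
  by rewrite dG_deep// normr0 mulr_ge0// addr_ge0// mul1r.
rewrite normrM normrN ler_wpM2l// (le_trans (ler_normB _ _))// lerD ?hM2//.
rewrite normrM ler_pM//; have /andP[e0 e1] := eta_bound (1 - PP l p) (cn_gt0 n).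
by rewrite ger0_norm.
Qed.

End Component.

Lemma is_derive_Gy n y z : z < 0 -> y \notin kink_y l z ->
  is_derive y 1 (fun t => Gy l zeta n (t, z)) (dG (Py l) (Pyy l) n (y, z)).
Proof.
move=> z0 yk.
have d1 := is_derive1_comp' (is_derive_1PP_y l1 y z) (is_derive_eta (1 - PP l (y, z)) (cn_gt0 n)).
apply: (is_derive1_eq (is_derive1M (is_derive1Z (- zeta) d1) (is_derive_Py_y l1 z0 yk))) => //.
by rewrite /dG -/(cn n); ring.
Qed.

Lemma is_derive_Gz n y z : z < 0 -> z \notin kink_z l y ->
  is_derive z 1 (fun t => Gz l zeta n (y, t)) (dG (Pz l) (Pzz l) n (y, z)).
Proof.
move=> z0 zk.
have d1 := is_derive1_comp' (is_derive_1PP_z l1 y z) (is_derive_eta (1 - PP l (y, z)) (cn_gt0 n)).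
apply: (is_derive1_eq (is_derive1M (is_derive1Z (- zeta) d1) (is_derive_Pz_z l1 z0 zk))) => //.
by rewrite /dG -/(cn n); ring.
Qed.

Lemma G_deep (Q : R * R -> R) n p : p.2 < - depth l ->
  - zeta * eta (cn n) (1 - PP l p) * Q p = 0.
Proof.
by move=> h; rewrite /eta pospart_le0 ?mulr0 ?mul0r// subr_le0 PP_ge1_deep.
Qed.

Let k := 2 * zeta * (C_ l + c).

(** Minus the divergence of the smoothed gradient is [zeta * eta * Delta(L^2)] minus
    [zeta * deta * |grad L^2|^2]. The second term, which carries the kink along [L = 1] and blows up
    with [n], has a sign and is dropped; [0 <= eta <= 1] leaves the bound [k], independent of
    [n]. *)
Lemma smoothed_gradient_dot_le n :
  (\int[leb2]_(p in Omega) (Gy l zeta n p * (g p).1 + Gz l zeta n p * (g p).2)%:E <=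
   \int[leb2]_(p in Omega) (k * phi p)%:E)%E.
Proof.
have [B1 hB1] := dG_bound (continuous_Py l1) (Pyy_bound l1) n.
have [B2 hB2] := dG_bound (continuous_Pz l1) (Pzz_bound l1) n.
apply: (@field_dot_le _ phi g Xphi phi_ge0 _ _ (dG (Py l) (Pyy l) n) (dG (Pz l) (Pzz l) n)
  (fun=> k) (depth l) B1 B2 (kink_y l) (kink_z l)) => //.
- exact/ltW/depth_gt0.
- exact: continuous_Gy.
- exact: continuous_Gz.
- by apply: measurable_dG; [exact: continuous_Py|exact: measurable_Pyy].
- by apply: measurable_dG; [exact: continuous_Pz|exact: measurable_Pzz].
- by move=> p; exact: G_deep.
- by move=> p; exact: G_deep.
- by move=> p _; exact: dG_deep.
- by move=> p _; exact: dG_deep.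
- by move=> y _; rewrite /Gz /Pz /= ltxx mulr0.
- by move=> y z z0 _; exact: is_derive_Gy.
- by move=> y z z0 _; exact: is_derive_Gz.
- exact: (bounded_mul_integrable (M := `|k|)).
- move=> p Op; have hP := laplacian_PP_le l1 Lc c0 Op.
  have /andP[e0 e1] := eta_bound (1 - PP l p) (cn_gt0 n).
  have de := deta_ge0 (1 - PP l p) (cn_gt0 n).
  have C0 : 0 <= 2 * (C_ l + c) by rewrite mulr_ge0// addr_ge0// /C_ addr_ge0// sqr_ge0.
  have -> : - (dG (Py l) (Pyy l) n p + dG (Pz l) (Pzz l) n p) =
    zeta * (eta (cn n) (1 - PP l p) * (Pyy l p + Pzz l p)) -
    zeta * (deta (cn n) (1 - PP l p) * (Py l p ^+ 2 + Pz l p ^+ 2)) by rewrite /dG; ring.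
  apply: (@le_trans _ _ (zeta * (eta (cn n) (1 - PP l p) * (Pyy l p + Pzz l p)))).
    by rewrite gerBl !mulr_ge0// ?(ltW zeta0)// addr_ge0// sqr_ge0.
  rewrite /k [2 * zeta]mulrC -mulrA ler_pM2l//.
  apply: (@le_trans _ _ (eta (cn n) (1 - PP l p) * (2 * (C_ l + c)))).
    exact: ler_wpM2l.
  exact: ler_piMl.
Qed.

Lemma integrable_gradient_dot :
  leb2.-integrable Omega (fun p => (dot (gu l zeta p) (g p))%:E).
Proof.
have i1 := L2_mul_integrable mO (gu1_L2 zeta l1) L2g1.
have i2 := L2_mul_integrable mO (gu2_L2 zeta l1) L2g2.
by have := integrableD mO i1 i2; apply: eq_integrable.
Qed.

Lemma gradient_dot_le : (\int[leb2]_(p in Omega) (dot (gu l zeta p) (g p))%:E <=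
  \int[leb2]_(p in Omega) (k * phi p)%:E)%E.
Proof.
have mG1 n : measurable_fun (Omega : set pl) (Gy l zeta n).
  by apply: measurable_Omega_continuous; exact: continuous_Gy.
have mG2 n : measurable_fun (Omega : set pl) (Gz l zeta n).
  by apply: measurable_Omega_continuous; exact: continuous_Gz.
have [m1 _] := gu1_L2 zeta l1; have [m2 _] := gu2_L2 zeta l1.
have [mg1 _] := L2g1; have [mg2 _] := L2g2.
apply/lee_addgt0Pr => e e0; have e2 : 0 < e / 2 by rewrite divr_gt0.
have n1 := L2_weight_near mO e2 L2g1 (fun n => measurable_funB (mG1 n) m1) (@Gy_cvg R l zeta l1).
have n2 := L2_weight_near mO e2 L2g2 (fun n => measurable_funB (mG2 n) m2) (@Gz_cvg R l zeta l1).
near \oo => n.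
have iG : leb2.-integrable Omega
    (fun p => (Gy l zeta n p * (g p).1 + Gz l zeta n p * (g p).2)%:E).
  apply: (integrable_field_dot Xphi (N := depth l)).
  - exact: continuous_Gy.
  - exact: continuous_Gz.
  - by move=> p; exact: G_deep.
  - by move=> p; exact: G_deep.
(* The error of the smoothing, arranged so that the fixed L^2 weights are the components of [g]. *)
pose r p := (g p).1 * (Gy l zeta n p - (gu l zeta p).1) + (g p).2 * (Gz l zeta n p - (gu l zeta p).2).
have ir : leb2.-integrable Omega (fun p => (r p)%:E).
  have := integrableB mO iG integrable_gradient_dot; apply: eq_integrable => // p _ /=.
  by rewrite -EFinB; congr (_%:E); rewrite /r /dot; ring.
have -> : (\int[leb2]_(p in Omega) (dot (gu l zeta p) (g p))%:E =
  \int[leb2]_(p in Omega) (Gy l zeta n p * (g p).1 + Gz l zeta n p * (g p).2)%:E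
  - \int[leb2]_(p in Omega) (r p)%:E)%E.
  rewrite -integralB//; apply: eq_integral => p _; rewrite -EFinB; congr (_%:E).
  by rewrite /r /dot; ring.
apply: leeD; first exact: smoothed_gradient_dot_le.
apply: (le_trans (lee_abs _)); rewrite abseN.
apply: (le_trans (le_abse_integral _ mO _)).
  by have /integrableP[] := ir.
have h1 : measurable_fun (Omega : set pl)
    (fun p => (g p).1 * (Gy l zeta n p - (gu l zeta p).1)).
  by apply: measurable_funM => //; exact: measurable_funB.
have h2 : measurable_fun (Omega : set pl)
    (fun p => (g p).2 * (Gz l zeta n p - (gu l zeta p).2)).
  by apply: measurable_funM => //; exact: measurable_funB.
apply: (@le_trans _ _ (\int[leb2]_(p in Omega)
  (`|((g p).1 * (Gy l zeta n p - (gu l zeta p).1))%:E| +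
   `|((g p).2 * (Gz l zeta n p - (gu l zeta p).2))%:E|))%E).
  apply: ge0_le_integral => //.
  - by apply: measurableT_comp => //; have /integrableP[] := ir.
  - by apply: emeasurable_funD; apply: measurableT_comp => //; exact/measurable_EFinP.
  - by move=> p _; rewrite /r EFinD; exact: lee_abs_add.
rewrite ge0_integralD//; last 2 first.
- by apply: measurableT_comp => //; exact/measurable_EFinP.
- by apply: measurableT_comp => //; exact/measurable_EFinP.
rewrite [e]splitr EFinD; apply: leeD; near: n; [exact: n1|exact: n2].
Unshelve. all: by end_near. Qed.

End Estimates.

(** * The transport term *)

Section Transport.
Context {R : realType}.
Notation pl := (measurableTypeR R * measurableTypeR R)%type.
Variable l : R.
Hypothesis l1 : 1 < l.
Variables (phi : R * R -> R) (g : R * R -> R * R).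
Hypothesis Xphi : inX phi g.
Hypothesis phi_ge0 : ae_nonneg phi.
Implicit Types (p : R * R) (y z : R).

Let mO := @measurable_Omega R.
Let L2g1 : L2 (fst \o g). Proof. by case: Xphi => -[]. Qed.
Let L2g2 : L2 (snd \o g). Proof. by case: Xphi => -[]. Qed.
Let mphi : measurable_fun (Omega : set pl) phi. Proof. by case: Xphi => -[[]]. Qed.

Let Fq_bound p : Omega p -> `|Fq1 l p| <= `|p.2| /\ `|Fq2 l p| <= `|p.2|.
Proof.
move=> [_ p2]; have [q1 q2] := Q_ang_le1 l1 p.
rewrite /Fq1 /Fq2 p2 (normrM _ (Q1 l _)) (normrM _ (Q2 l _)) normrN.
by split; exact: ler_piMr.
Qed.

Let mFq1 : measurable_fun (Omega : set pl) (Fq1 l).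
Proof. by apply: measurable_Omega_continuous; exact: continuous_Fq1. Qed.

Let mFq2 : measurable_fun (Omega : set pl) (Fq2 l).
Proof. by apply: measurable_Omega_continuous; exact: continuous_Fq2. Qed.

Let mFg : measurable_fun (Omega : set pl) (fun p => Fq1 l p * (g p).1 + Fq2 l p * (g p).2).
Proof.
have [m1 _] := L2g1; have [m2 _] := L2g2.
apply: measurable_funD; apply: measurable_funM.
- exact: mFq1.
- exact: m1.
- exact: mFq2.
- exact: m2.
Qed.

(** Integrable by the condition on [z grad phi] in X; it dominates the transport integrand and all
    its truncations. *)
Let weight p := `|p.2 * (g p).1| + `|p.2 * (g p).2|.

Let integrable_weight : leb2.-integrable Omega (fun p => (weight p)%:E).
Proof.
have [_ _ i1 i2] := Xphi.
have := integrableD mO (integrable_norm i1) (integrable_norm i2).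
by apply: eq_integrable.
Qed.

Let Fg_bound p : Omega p -> `|Fq1 l p * (g p).1 + Fq2 l p * (g p).2| <= weight p.
Proof.
move=> Op; have [f1 f2] := Fq_bound Op.
rewrite (le_trans (ler_normD _ _))// /weight (normrM (Fq1 l p)) (normrM (Fq2 l p)).
by rewrite (normrM p.2 (g p).1) (normrM p.2 (g p).2) lerD// ler_wpM2r.
Qed.

Lemma integrable_Fq_dot :
  leb2.-integrable Omega (fun p => (Fq1 l p * (g p).1 + Fq2 l p * (g p).2)%:E).
Proof.
apply: le_integrable integrable_weight => //; first exact/measurable_EFinP.
by move=> p Op; rewrite lee_fin /= (le_trans (Fg_bound Op))// ler_norm.
Qed.

Hypothesis iphi : leb2.-integrable Omega (fun p => (phi p)%:E).

(** Majorant of minus the divergence of the truncated field: [l] comes from the field, the other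
    term from differentiating the cutoff. The latter is at most 2 and tends to 0 pointwise in
    Omega. *)
Let w n p := l + `|p.2 * dchi n p.2|.

Let mw n : measurable_fun (Omega : set pl) (w n).
Proof.
apply: measurable_Omega_continuous => p; apply: cvgD; first exact: cvg_cst.
apply: cvg_norm; apply: cvgM; first exact: cvg_snd.
by apply: continuous_comp_snd; exact: continuous_dchi.
Qed.

Let w_bound n p : Omega p -> `|w n p| <= l + 2.
Proof.
move=> [_ p2]; have l0 : 0 < l by exact: lt_trans l1.
by rewrite ger0_norm ?addr_ge0 ?(ltW l0)// lerD2l norm_mul_dchi// ltW.
Qed.

Let iw n : leb2.-integrable Omega (fun p => (w n p * phi p)%:E).
Proof.
have := integrableZl mO (l + 2) iphi; apply: le_integrable => //.
  by apply/measurable_EFinP; apply: measurable_funM.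
move=> p Op; rewrite lee_fin /= !normrM ler_wpM2r//.
by rewrite (le_trans (w_bound n Op))// ler_norm.
Qed.

Lemma truncated_Fq_dot_le n :
  (\int[leb2]_(p in Omega)
     (chi n p.2 * Fq1 l p * (g p).1 + chi n p.2 * Fq2 l p * (g p).2)%:E <=
   \int[leb2]_(p in Omega) (w n p * phi p)%:E)%E.
Proof.
have [B1 hB1] := Fq1y_bound l1; have [B2 hB2] := Fq2z_bound l1.
have cchi : continuous (fun p : R * R => chi n p.2).
  by apply: continuous_comp_snd; exact: continuous_chi.
have cdchi : continuous (fun p : R * R => dchi n p.2).
  by apply: continuous_comp_snd; exact: continuous_dchi.
have mchi := measurable_Omega_continuous cchi.
have mdchi := measurable_Omega_continuous cdchi.
have chi1 p : Omega p -> `|chi n p.2| <= 1.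
  by move=> [_ /ltW p2]; have /andP[? ?] := chi_bound n p2; rewrite ger0_norm.
have B10 : 0 <= B1 by apply: le_trans (hB1 0).
have dF2b p : Omega p -> `|dchi n p.2 * Fq2 l p| <= `|p.2 * dchi n p.2|.
  move=> Op; rewrite mulrC (normrM (Fq2 l p)) (normrM p.2) ler_wpM2r//.
  by have [] := Fq_bound Op.
apply: (@field_dot_le _ phi g Xphi phi_ge0
  (fun p => chi n p.2 * Fq1 l p) (fun p => chi n p.2 * Fq2 l p)
  (fun p => chi n p.2 * Fq1y l p) (fun p => chi n p.2 * Fq2z l p + dchi n p.2 * Fq2 l p)
  (w n) n.+1%:R B1 (B2 + 2) (kink_y l) (kink_z l)) => //.
- by move=> p; apply: cvgM; [exact: cchi|exact: continuous_Fq1].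
- by move=> p; apply: cvgM; [exact: cchi|exact: continuous_Fq2].
- by apply: measurable_funM => //; exact: measurable_Fq1y.
- apply: measurable_funD; apply: measurable_funM => //; exact: measurable_Fq2z.
- by move=> p Op; rewrite normrM -[leRHS]mul1r ler_pM// chi1.
- move=> p Op; rewrite (le_trans (ler_normD _ _))// lerD//.
    by rewrite normrM -[leRHS]mul1r ler_pM// chi1.
  by rewrite (le_trans (dF2b p Op))// norm_mul_dchi//; case: Op => _ /ltW.
- by move=> p h; rewrite chi_eq0// mul0r.
- by move=> p h; rewrite chi_eq0// mul0r.
- by move=> p _ h; rewrite chi_eq0// mul0r.
- by move=> p _ h; rewrite chi_eq0// dchi_eq0// !mul0r addr0.
- by move=> y _; rewrite /Fq2 /= ltxx mulr0.
- move=> y z z0 _ yk.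
  by apply: (is_derive1_eq (is_derive1Z (chi n z) (is_derive_Fq1_y l1 z0 yk))).
- move=> y z z0 _ zk.
  apply: (is_derive1_eq (is_derive1M (is_derive_chi n z) (is_derive_Fq2_z l1 z0 zk))) => //.
  by rewrite /=; ring.
- move=> p Op; have := dF2b p Op; rewrite /w => db.
  have /andP[c0 c1] := chi_bound n (ltW Op.2).
  have : - (chi n p.2 * (Fq1y l p + Fq2z l p)) <= l.
    rewrite -mulrN (@le_trans _ _ (chi n p.2 * l))//.
      by rewrite ler_wpM2l// lerNl div_q_ge.
    by rewrite ler_piMl// ltW// (lt_trans _ l1).
  have := ler_norm (- (dchi n p.2 * Fq2 l p)); rewrite normrN.
  move: db; rewrite mulrDr; lra.
Qed.

Lemma Fq_dot_le : (\int[leb2]_(p in Omega) (Fq1 l p * (g p).1 + Fq2 l p * (g p).2)%:E <=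
  \int[leb2]_(p in Omega) (l * phi p)%:E)%E.
Proof.
have cchi n : continuous (fun p : R * R => chi n p.2).
  by apply: continuous_comp_snd; exact: continuous_chi.
have [m1 _] := L2g1; have [m2 _] := L2g2.
pose lhs n p := chi n p.2 * Fq1 l p * (g p).1 + chi n p.2 * Fq2 l p * (g p).2.
have lhsE n p : lhs n p = chi n p.2 * (Fq1 l p * (g p).1 + Fq2 l p * (g p).2).
  by rewrite /lhs; ring.
have cl : (\int[leb2]_(p in Omega) (lhs n p)%:E @[n --> \oo] -->
    \int[leb2]_(p in Omega) (Fq1 l p * (g p).1 + Fq2 l p * (g p).2)%:E)%E.
  have [|||||_ _] := @dominated_convergence _ _ R leb2 Omega mO
    (fun n p => (lhs n p)%:E) (fun p => (Fq1 l p * (g p).1 + Fq2 l p * (g p).2)%:E)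
    (fun p => (weight p)%:E) => //.
  - move=> n; apply/measurable_EFinP; apply: (@eq_measurable_fun _ _ _ _ _
      (fun p : pl => chi n p.2 * (Fq1 l p * (g p).1 + Fq2 l p * (g p).2))).
      by move=> p _; rewrite lhsE.
    by apply: measurable_funM => //; exact: measurable_Omega_continuous.
  - exact/measurable_EFinP.
  - apply: aeW => p Op; apply: cvg_EFin; first exact: nearW.
    rewrite -[X in _ --> X]mul1r (_ : fine \o _ = (fun n =>
      chi n p.2 * (Fq1 l p * (g p).1 + Fq2 l p * (g p).2))).
      by apply: cvgM; [exact: cvg_chi|exact: cvg_cst].
    by apply/funext => n /=; rewrite lhsE.
  - apply: aeW => p n Op; rewrite lee_fin lhsE normrM -[leRHS]mul1r ler_pM ?Fg_bound//.
    by have /andP[? ?] := chi_bound n (ltW Op.2); rewrite ger0_norm.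
have cr : (\int[leb2]_(p in Omega) (w n p * phi p)%:E @[n --> \oo] -->
    \int[leb2]_(p in Omega) (l * phi p)%:E)%E.
  have [|||||_ _] := @dominated_convergence _ _ R leb2 Omega mO
    (fun n p => (w n p * phi p)%:E) (fun p => (l * phi p)%:E)
    (fun p => ((l + 2) * `|phi p|)%:E) => //.
  - by move=> n; apply/measurable_EFinP; exact: measurable_funM.
  - by apply/measurable_EFinP; exact: measurable_funM.
  - apply: aeW => p Op; apply: cvg_EFin; first exact: nearW.
    rewrite (_ : fine \o _ = (fun n => w n p * phi p))//.
    apply: cvgM; last exact: cvg_cst.
    rewrite -[X in _ --> X]addr0; apply: cvgD; first exact: cvg_cst.
    rewrite -[X in _ --> X](@normr0 _ R) -[X in `|X|](mulr0 p.2); apply: cvg_norm.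
    by apply: cvgM; [exact: cvg_cst|apply: cvg_dchi; exact: ltW Op.2].
  - have := integrableZl mO (l + 2) (integrable_norm iphi).
    by apply: eq_integrable.
  - by apply: aeW => p n Op; rewrite lee_fin normrM ler_wpM2r// w_bound.
rewrite -(cvg_lim _ cl)// -(cvg_lim _ cr)//.
apply: lee_lim; [by apply/cvg_ex; eexists; exact: cl|by apply/cvg_ex; eexists; exact: cr|].
by apply: nearW => n; exact: truncated_Fq_dot_le.
Qed.

End Transport.

(** * Diffusion and transport combined *)

Section Subsolution.
Context {R : realType}.
Notation pl := (measurableTypeR R * measurableTypeR R)%type.
Variables (lambda l zeta c : R).
Hypothesis l1 : 1 < l.
Hypothesis llambda : l < lambda.
Hypothesis c0 : 0 < c.
Hypothesis Lc : LLaplacian_bounded l c.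
Hypothesis zetaP : 0 < zeta <= (lambda - l) / (2 * (C_ l + c)).
Implicit Types p : R * R.

Let mO := @measurable_Omega R.

Let Cc_gt0 : 0 < C_ l + c.
Proof. by rewrite addr_gt0// /C_ ltr_pwDl// sqr_ge0. Qed.

(** The only place where the upper bound on [zeta] enters: diffusion may use up [lambda - l]. *)
Let rate_le : 2 * zeta * (C_ l + c) + l <= lambda.
Proof.
case/andP: zetaP => _; rewrite ler_pdivlMr ?mulr_gt0// => h.
by rewrite -lerBrDr (le_trans _ h)// mulrA [2 * _]mulrC.
Qed.

Lemma subsolution_ineq (phi : R * R -> R) (g : R * R -> R * R) :
  inX phi g -> ae_nonneg phi ->
  (\int[leb2]_(p in Omega)
     (dot (gu l zeta p) (g p) + `|p.2| * dot (dext l p) (g p))%:E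
   <= lambda%:E * \int[leb2]_(p in Omega) (phi p)%:E)%E.
Proof.
move=> Xphi phi0; have /andP[zeta0 _] := zetaP.
have l0 : 0 < lambda by rewrite (lt_trans _ llambda)// (lt_trans _ l1).
have mphi : measurable_fun (Omega : set pl) phi by case: Xphi => -[[]].
have phiE : (\int[leb2]_(p in Omega) (phi p)%:E = \int[leb2]_(p in Omega) `|(phi p)%:E|)%E.
  have := integral_ae_norm Xphi phi0 (measurable_cst (1 : R)).
  by under eq_integral do rewrite mul1r; under [in X in _ = X]eq_integral do rewrite mul1r.
(* If a nonnegative [phi] is not integrable, the right-hand side is [+oo] and the inequality is
   trivial; otherwise [phi] can dominate the limits. *)
have [iphi|niphi] := pselect (leb2.-integrable Omega (fun p => (phi p)%:E)); last first.
  suff -> : (\int[leb2]_(p in Omega) (phi p)%:E = +oo)%E by rewrite gt0_muley ?lte_fin// leey.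
  rewrite phiE; apply/eqP; rewrite -leye_eq leNgt; apply/negP => h; apply: niphi.
  by apply/integrableP; split => //; exact/measurable_EFinP.
have iA := integrable_gradient_dot zeta l1 Xphi.
have iB := integrable_Fq_dot l1 Xphi.
have -> : (\int[leb2]_(p in Omega)
     (dot (gu l zeta p) (g p) + `|p.2| * dot (dext l p) (g p))%:E =
   \int[leb2]_(p in Omega) (dot (gu l zeta p) (g p))%:E +
   \int[leb2]_(p in Omega) (Fq1 l p * (g p).1 + Fq2 l p * (g p).2)%:E)%E.
  rewrite -integralD//; apply: eq_integral => p; rewrite inE => Op.
  rewrite -EFinD; congr (_%:E); congr (_ + _); rewrite dext_E// /dot /Fq1 /Fq2 Op.2 /=.
  by rewrite (ltr0_norm Op.2); ring.
apply: (le_trans (leeD (gradient_dot_le l1 zeta0 (ltW c0) Lc Xphi phi0 iphi)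
  (Fq_dot_le l1 Xphi phi0 iphi))).
under eq_integral do rewrite EFinM.
under [X in (_ + X)%E]eq_integral do rewrite EFinM.
rewrite !integralZl//.
rewrite -ge0_muleDl ?lee_fin.
- rewrite -EFinD lee_wpmul2r ?lee_fin//.
  by rewrite phiE; exact: integral_ge0.
- by rewrite mulr_ge0 ?(ltW Cc_gt0)// mulr_ge0// ltW.
- by rewrite ltW// (lt_trans _ l1).
Qed.

Lemma subsolution_candidate : subsolution lambda (u_ zeta l) (dext l).
Proof.
have /andP[zeta0 _] := zetaP; exists (gu l zeta); split.
- by apply: u_inX => // p; exact: u_E.
- by apply: aeW => p Op; rewrite u_E// mulr_ge0 ?(ltW zeta0)// le_max lexx orbT.
- exact: dext_inLambda.
- exact: subsolution_ineq.
- by apply: aeW => p Op; exact: dext_gu.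
Qed.

End Subsolution.

Theorem proposition4p9 (R : realType) (lambda : R) (hlambda : 1 < lambda) :
  exists lambda0 : R,
    [/\ 1 < lambda0 < lambda,
        (exists C1 C2 : R,
           [/\ 0 < C1, 0 < C2 & LLaplacian_bounded lambda0 (C1 + C2)]) &
        forall C1 C2 : R, 0 < C1 -> 0 < C2 ->
          LLaplacian_bounded lambda0 (C1 + C2) ->
        forall zeta0 : R,
          0 < zeta0 <= (lambda - lambda0) / (2 * (C_ lambda0 + C1 + C2)) ->
          subsolution lambda (u_ zeta0 lambda0) (dext lambda0)].
Proof.
(* The midpoint is an arbitrary choice: the preceding lemmas use only [1 < l] and [l < lambda]. *)
have h : 1 < (1 + lambda) / 2 < lambda by apply/andP; split; lra.
have /andP[h1 h2] := h; exists ((1 + lambda) / 2); split => //.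
  exact: LLaplacian_bounded_exists.
move=> C1 C2 C10 C20 LC zeta0; rewrite -addrA.
by apply: subsolution_candidate => //; exact: addr_gt0.
Qed.
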